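(* Let $\mathfrak{g}$ be a $2n$-dimensional real Lie algebra equipped with an abelian complex structure $J$. Then $(\mathfrak{g},J)$ has a nonzero closed $(n,0)$-form if and only if $\mathfrak{g}$ is unimodular. In particular, any complex solvmanifold equipped with an abelian complex structure has trivial canonical bundle.
   Context: An abelian complex structure on a real Lie algebra $\mathfrak{g}$ is a linear endomorphism $J$ with $J^2=-I$ and $[Jx,Jy]=[x,y]$ for all $x,y\in\mathfrak{g}$ (such a $J$ is automatically integrable). $\mathfrak{g}$ is unimodular if $\operatorname{Tr}(\operatorname{ad}x)=0$ for all $x\in\mathfrak{g}$. A complex-valued linear form $\gamma$ on $\mathfrak{g}$ is of type $(1,0)$ if $\gamma(Jx)=i\gamma(x)$; $(n,0)$-forms are elements of the $n$-th exterior power of the space of $(1,0)$-forms, and closedness refers to the Chevalley–Eilenberg differential. A complex solvmanifold is a compact quotient $\Gamma\backslash G$, where $G$ is a simply connected solvable Lie group and $\Gamma\subset G$ is a lattice (necessarily uniform), equipped with an invariant complex structure, i.e. one induced by a left invariant complex structure on $G$ (equivalently by a complex structure $J$ on $\mathfrak{g}=\operatorname{Lie}(G)$); it is said to be equipped with an abelian complex structure if $J$ is abelian on $\mathfrak{g}$. The canonical bundle of a complex manifold $M$ of complex dimension $n$ is $K_M=\bigwedge^n\mathcal{T}^*_M$, with $\mathcal{T}^*_M$ the holomorphic cotangent bundle; ''trivial'' means holomorphically trivial, i.e. there is a nowhere vanishing holomorphic (equivalently closed) $(n,0)$-form on $M$. *)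

(* Defs.v *)
From HB Require Import structures.
From mathcomp Require Import all_boot all_order all_algebra.
From mathcomp Require Import all_classical all_reals all_analysis.
From mathcomp Require Import complex.

Set Implicit Arguments.
Unset Strict Implicit.
Unset Printing Implicit Defensive.

Import Order.TTheory GRing.Theory Num.Theory.
Import numFieldNormedType.Exports.

Local Open Scope classical_set_scope.
Local Open Scope ring_scope.

Section LieAlgebra.
Variables (R : realType) (g : vectType R) (br : g -> g -> g) (J : 'End(g)).

Record lie_bracket : Prop := LieBracket {
  lie_linearl : forall (a : R) x y z, br (a *: x + y) z = a *: br x z + br y z;
  lie_linearr : forall (a : R) x y z, br x (a *: y + z) = a *: br x y + br x z;
  lie_alternating : forall x, br x x = 0;
  lie_jacobi : forall x y z,
    br x (br y z) + br y (br z x) + br z (br x y) = 0 }.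

Definition lfun_trace (f : 'End(g)) : R :=
  \tr (passmx.mxof (vbasis {:g}) (vbasis {:g}) f).

Definition unimodular : Prop := forall x, lfun_trace (linfun (br x)) = 0.

Record abelian_complex_structure : Prop := AbelianComplexStructure {
  acs_square : forall x, J (J x) = - x;
  acs_abelian : forall x y, br (J x) (J y) = br x y }.

Definition form10 (gamma : g -> R[i]) : Prop :=
  [/\ forall x y, gamma (x + y) = gamma x + gamma y,
      forall (a : R) x, gamma (a *: x) = a%:C%C * gamma x
    & forall x, gamma (J x) = 'i%C * gamma x].

(* A complex n-form on g is represented by its values on n-families; the wedge
   product of gamma_1, ..., gamma_n takes the value det (gamma_i (x_j)).      *)
Definition formn0 n (omega : ('I_n -> g) -> R[i]) : Prop :=
  exists (N : nat) (a : 'I_N -> R[i]) (gamma : 'I_N -> 'I_n -> g -> R[i]),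
    (forall k i, form10 (gamma k i)) /\
    (forall x, omega x =
       \sum_(k < N) a k * \det (\matrix_(i < n, j < n) gamma k i (x j))).

(* The n-family [x_i, x_j], x_0, ..., x_n with x_i and x_j omitted. *)
Definition bracket_family n (x : 'I_n.+1 -> g) (i j : 'I_n.+1) : 'I_n -> g :=
  fun k => nth 0 (br (x i) (x j) ::
    [seq x l | l <- enum 'I_n.+1 & (l != i) && (l != j)]) k.

Definition ce_differential n (omega : ('I_n -> g) -> R[i])
    : ('I_n.+1 -> g) -> R[i] :=
  fun x => \sum_(i < n.+1) \sum_(j < n.+1 | (i < j)%N)
    (-1) ^+ (i + j) * omega (bracket_family x i j).

Definition closed_form n (omega : ('I_n -> g) -> R[i]) : Prop :=
  forall x, ce_differential omega x = 0.

End LieAlgebra.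

Section Regularity.

Fixpoint Ck_on (R : realType) m (V : normedModType R) (k : nat)
    (U : set 'rV[R]_m) (f : 'rV[R]_m -> V) : Prop :=
  (forall x, U x -> {for x, continuous f}) /\
  if k is k'.+1 then
    forall v, (forall x, U x -> derivable f x v) /\
              Ck_on k' U (fun x => 'D_v f x)
  else True.

Definition smooth_on (R : realType) m (V : normedModType R)
    (U : set 'rV[R]_m) (f : 'rV[R]_m -> V) : Prop := forall k, Ck_on k U f.

(* Frechet differentiability over K; used with K the field of complex numbers. *)
Definition holomorphic_on (K : numFieldType) m (V : normedModType K)
    (U : set 'rV[K]_m) (f : 'rV[K]_m -> V) : Prop :=
  forall z, U z -> differentiable f z.

End Regularity.

Section Manifolds.

(* [cinv] is only meaningful on the image [crange] of the domain. *)
Record chart (K : numFieldType) (m : nat) (X : topologicalType) := Chart {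
  cdom : set X;
  cmap : X -> 'rV[K]_m;
  cinv : 'rV[K]_m -> X }.

Definition crange K m X (c : @chart K m X) : set 'rV[K]_m := cmap c @` cdom c.

Record is_chart K m X (c : @chart K m X) : Prop := IsChart {
  chart_open : open (cdom c);
  chart_open_range : open (crange c);
  chart_mapK : forall x, cdom c x -> cinv c (cmap c x) = x;
  chart_map_continuous : forall x, cdom c x -> {for x, continuous (cmap c)};
  chart_inv_continuous : forall u, crange c u -> {for u, continuous (cinv c)} }.

Record is_atlas (K : numFieldType) m (X : topologicalType)
    (regular : set 'rV[K]_m -> ('rV[K]_m -> 'rV[K]_m) -> Prop)
    (A : set (chart K m X)) : Prop := IsAtlas {
  atlas_chart : forall c, A c -> is_chart c;
  atlas_cover : forall x, exists2 c, A c & cdom c x;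
  atlas_transition : forall c d, A c -> A d ->
    regular (cmap c @` (cdom c `&` cdom d)) (cmap d \o cinv c) }.

Definition smooth_manifold (R : realType) m (X : topologicalType)
    (A : set (chart R m X)) : Prop :=
  [/\ hausdorff_space X, @second_countable X
    & is_atlas (@smooth_on R m 'rV[R]_m) A].

Definition complex_manifold (R : realType) n (X : topologicalType)
    (B : set (chart R[i] n X)) : Prop :=
  [/\ hausdorff_space X, @second_countable X
    & is_atlas (@holomorphic_on R[i] n 'rV[R[i]]_n) B].

Definition smooth_fun_on (R : realType) m (X : topologicalType)
    (A : set (chart R m X)) (U : set X) (f : X -> R) : Prop :=
  forall c, A c -> smooth_on (cmap c @` (cdom c `&` U)) (f \o cinv c).

Definition smooth_map_on (R : realType) m k (X Y : topologicalType)
    (A : set (chart R m X)) (B : set (chart R k Y)) (U : set X) (f : X -> Y)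
    : Prop :=
  (forall x, U x -> {for x, continuous f}) /\
  (forall c d, A c -> B d ->
     smooth_on (cmap c @` (cdom c `&` U `&` f @^-1` cdom d))
               (cmap d \o f \o cinv c)).

Definition local_diffeomorphism (R : realType) m (X Y : topologicalType)
    (A : set (chart R m X)) (B : set (chart R m Y)) (f : X -> Y) : Prop :=
  forall p, exists (U : set X) (s : Y -> X),
    [/\ open U, U p & open (f @` U)] /\
    [/\ forall q, U q -> s (f q) = q,
        smooth_map_on A B U f & smooth_map_on B A (f @` U) s].

Definition prod_chart (K : numFieldType) m k (X Y : topologicalType)
    (c : chart K m X) (d : chart K k Y) : chart K (m + k) (X * Y)%type :=
  {| cdom := cdom c `*` cdom d;
     cmap := fun p => row_mx (cmap c p.1) (cmap d p.2);
     cinv := fun u => (cinv c (lsubmx u), cinv d (rsubmx u)) |}.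

Definition prod_atlas (K : numFieldType) m k (X Y : topologicalType)
    (A : set (chart K m X)) (B : set (chart K k Y))
    : set (chart K (m + k) (X * Y)%type) :=
  [set prod_chart c d | c in A & d in B].

(* The real manifold underlying a complex one: z = u + iv is read in R^2n as
   (u, v).                                                                    *)
Definition real_chart (R : realType) n (X : topologicalType)
    (c : chart R[i] n X) : chart R (n + n) X :=
  {| cdom := cdom c;
     cmap := fun x => row_mx (map_mx (@complex.Re R) (cmap c x))
                             (map_mx (@complex.Im R) (cmap c x));
     cinv := fun w => cinv c
       (\row_j (lsubmx w 0 j +i* rsubmx w 0 j)%C) |}.

Definition real_atlas (R : realType) n (X : topologicalType)
    (B : set (chart R[i] n X)) : set (chart R (n + n) X) :=
  @real_chart R n X @` B.

(* A holomorphic n-form h_c(z) dz_1 /\ ... /\ dz_n in each chart c, i.e. a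
   section of K_X: since w = tau(z) gives dw_1 /\ ... /\ dw_n =
   det(tau'(z)) dz_1 /\ ... /\ dz_n, the coefficients transform by the complex
   Jacobian determinant of the change of coordinates.                         *)
Definition holomorphic_top_form (R : realType) n (X : topologicalType)
    (B : set (chart R[i] n X)) (h : chart R[i] n X -> 'rV[R[i]]_n -> R[i])
    : Prop :=
  (forall c, B c -> holomorphic_on (V := R[i]^o) (crange c) (h c)) /\
  (forall c d, B c -> B d -> forall x, cdom c x -> cdom d x ->
     h c (cmap c x) =
     h d (cmap d x) * \det (jacobian (cmap d \o cinv c) (cmap c x))).

Definition trivial_canonical_bundle (R : realType) n (X : topologicalType)
    (B : set (chart R[i] n X)) : Prop :=
  exists2 h, holomorphic_top_form B h
           & forall c, B c -> forall z, crange c z -> h c z != 0.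

Definition path_connected (R : realType) (X : topologicalType) : Prop :=
  forall x y : X, exists f : R -> X,
    [/\ {within `[0, 1], continuous f}, f 0 = x & f 1 = y].

Definition simply_connected (R : realType) (X : topologicalType) : Prop :=
  path_connected R X /\
  forall f : R -> X, {within `[0, 1], continuous f} -> f 0 = f 1 ->
    exists H : R * R -> X,
      {within `[0, 1]%classic `*` `[0, 1]%classic, continuous H} /\
      (forall t : R, 0 <= t <= 1 ->
         [/\ H (0, t) = f t, H (1, t) = f 0, H (t, 0) = f 0
           & H (t, 1) = f 0]).

End Manifolds.

#[short(type="topGroupType")]
HB.structure Definition TopGroup := {G of Topological G & Group G}.

Section Groups.
Variable G : topGroupType.

Definition subgroup (H : set G) : Prop :=
  H 1%g /\ forall x y, H x -> H y -> H (x * y^-1)%g.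

Definition generated_subgroup (S : set G) : set G :=
  [set x | forall H, subgroup H -> S `<=` H -> H x].

Definition derived_subgroup (H : set G) : set G :=
  generated_subgroup [set [~ x, y]%g | x in H & y in H].

Definition solvable_group : Prop :=
  exists k, iter k derived_subgroup [set: G] = [set 1%g].

Definition discrete_subgroup (Gamma : set G) : Prop :=
  subgroup Gamma /\
  exists U, [/\ open U, U 1%g & U `&` Gamma = [set 1%g]].

End Groups.

Section LieGroups.
Variables (R : realType) (m : nat) (G : topGroupType).
Variable A : set (chart R m G).

Definition lie_group : Prop :=
  [/\ smooth_manifold A,
      smooth_map_on (prod_atlas A A) A [set: (G * G)%type]
        (fun p => p.1 * p.2)%g
    & smooth_map_on A A [set: G] (fun x => x^-1)%g].

(* The tangent space of G at 1 is identified with R^m by a chart c at 1;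
   [left_field c v] is the left invariant vector field whose value at 1 is v,
   acting on functions.                                                       *)
Definition left_field (c : chart R m G) (v : 'rV[R]_m) (f : G -> R) : G -> R :=
  fun p => derive1 (fun t : R => f (p * cinv c (cmap c 1%g + t *: v)%R)%g) 0.

Definition left_fieldC (c : chart R m G) (v : 'rV[R]_m) (f : G -> R[i])
    : G -> R[i] :=
  fun p => (left_field c v (fun q => complex.Re (f q)) p +i*
            left_field c v (fun q => complex.Im (f q)) p)%C.

(* theta identifies the Lie algebra (g, br) with that of left invariant vector
   fields on G, with the commutator of vector fields as bracket.              *)
Record lie_algebra_of_group (g : vectType R) (br : g -> g -> g)
    (c : chart R m G) (theta : g -> 'rV[R]_m) : Prop := LieAlgebraOfGroup {
  lag_chart : A c;
  lag_dom1 : cdom c 1%g;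
  lag_linear : linear theta;
  lag_bijective : bijective theta;
  lag_bracket : forall (U : set G) (f : G -> R),
    open U -> smooth_fun_on A U f -> forall x y p, U p ->
    left_field c (theta (br x y)) f p =
      left_field c (theta x) (left_field c (theta y) f) p -
      left_field c (theta y) (left_field c (theta x) f) p }.

End LieGroups.

(* M = Gamma\G, with quotient map proj and Lie(G) = (g, br), as a compact complex
   manifold whose complex structure is induced by the left invariant one
   defined by J. A discrete subgroup with compact quotient has finite covolume,
   hence is a lattice.                                                        *)
Record complex_solvmanifold (R : realType) (n : nat)
    (g : vectType R) (br : g -> g -> g) (J : 'End(g))
    (G : topGroupType) (A : set (chart R (n + n) G))
    (c : chart R (n + n) G) (theta : g -> 'rV[R]_(n + n))
    (Gamma : set G)
    (M : topologicalType) (B : set (chart R[i] n M)) (proj : G -> M)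
    : Prop := ComplexSolvmanifold {
  csm_lie_group : lie_group A;
  csm_simply_connected : simply_connected R G;
  csm_solvable : solvable_group G;
  csm_lie_algebra : lie_algebra_of_group A br c theta;
  csm_discrete : discrete_subgroup Gamma;
  csm_complex_manifold : complex_manifold B;
  csm_compact : compact [set: M];
  csm_surjective : forall p, exists a, proj a = p;
  csm_fibers : forall a b, proj a = proj b <-> exists2 y, Gamma y & b = (y * a)%g;
  csm_local_diffeomorphism : local_diffeomorphism A (real_atlas B) proj;
  (* the holomorphic coordinates z_j of M satisfy dz_j(J x) = i dz_j(x) *)
  csm_complex_structure : forall d a, B d -> cdom d (proj a) ->
    forall (x : g) (j : 'I_n),
    let z := fun q => cmap d (proj q) 0 j in
    left_fieldC c (theta (J x)) z a = 'i%C * left_fieldC c (theta x) z a }.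

(* Main.v *)
(** Choose a real basis X_k, J X_k of g, let gam_k be the dual (1,0)-forms and put
    T x = sum_k (gam_k [x, X_k] - i gam_k [x, J X_k]). As J is abelian,
    T (J x) = - i T x, and Re (T x) = Tr (ad x); so g is unimodular iff T = 0.
    Every (n,0)-form is a multiple of w = gam_1 /\ ... /\ gam_n, and
    dw (x_0, ..., x_n) = - 1/2 sum_i (-1)^i T (x_i) w (x_0, ..., x_n without x_i),
    which vanishes iff T = 0.

    For a solvmanifold Gamma\G, unimodularity of g is obtained without Haar measure.
    The solvable group G carries a right invariant mean I on bounded functions, and
    lambda h = I (x |-> sum_(y in Gamma) h (y x)) is a positive functional on
    functions with compact support, right invariant and Gamma-invariant on the left.
    For a bump function f at 1, p |-> lambda (y |-> f (p y)) descends, after inversion of p,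
    to the compact quotient, so it attains its maximum; there its derivative along the
    right invariant field of w vanishes. That field has divergence Tr (ad w) at 1 with
    respect to the left invariant frame, and if Tr (ad w) > 0 the derivative, computed
    by integration by parts, is negative.

    Once T = 0, let P be the matrix of the derivatives of holomorphic coordinates z_j
    along the left invariant fields X_k. Then (J x) P = i (x P) + N P with
    tr N = T (J x) = 0, so det P satisfies the Cauchy-Riemann equations and the
    functions 1 / det P are the coefficients of a nowhere vanishing holomorphic
    n-form. *)

Require Import Defs.
From HB Require Import structures.
From mathcomp Require Import all_boot all_order all_algebra perm.
From mathcomp Require Import all_classical all_reals all_analysis.
From mathcomp Require Import complex.
From mathcomp Require Import ring lra zify.

Set Implicit Arguments.
Unset Strict Implicit.
Unset Printing Implicit Defensive.

Import Order.TTheory GRing.Theory Num.Theory.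
Import numFieldNormedType.Exports.

Local Open Scope classical_set_scope.
Local Open Scope ring_scope.

(** * Differential calculus *)

Section Differentiability.

(** On the left, lambda is known to be invariant under Gamma only. Were it invariant under all of G,
    p |-> lambda (y |-> f (p y)) would be constant and every derivative of it zero; a maximum over
    the compact quotient is the substitute. The mean is merely finitely additive, so no limit is
    exchanged with it: each derivative comes with a remainder that is uniform on one compact
    support. A mean may also vanish on a nonzero nonnegative function; compactness of the quotient
    is used a second time to exclude this for the bump. The form on the quotient is w itself: dz_j =
    sum_k P_kj gam_k gives dz_1 /\ ... /\ dz_n = det P . w, whence the coefficients 1 / det P; and P
    descends because left invariant fields commute with left translations. Holomorphy on the
    quotient means complex Frechet differentiability, whereas smoothness is given by iterated
    directional derivatives over the reals. Hence the detour: C^1 functions are shown to be really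
    differentiable, and a differential that is C-linear then makes them complex differentiable. *)

Lemma differentiable_eps (K : numFieldType) (V W : normedModType K)
    (f : V -> W) (x : V) (df : {linear V -> W}) :
  continuous df ->
  (forall e : K, 0 < e -> \forall h \near 0, `|f (h + x) - f x - df h| <= e * `|h|) ->
  differentiable f x /\ 'd f x = df :> (V -> W).
Proof.
move=> cdf H.
have E : f \o shift x = cst (f x) + df +o_ 0 id.
  apply/eqaddoP => e e0; have := H e e0; apply: filterS => h /=.
  by rewrite /GRing.add /= /cst /= opprD addrA.
have dE := diff_unique cdf E.
split=> //; apply/diff_locallyxP; rewrite dE; split=> //.
by move=> h; have := congr1 (fun F => F h) E => /= ->.
Qed.

Lemma cvg_sumr (K : numFieldType) (V : normedModType K) (T : Type)
    (F : set_system T) {FF : Filter F} (I : Type) (s : seq I) (P : pred I)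
    (f : I -> T -> V) (l : I -> V) :
  (forall i, P i -> f i @ F --> l i) ->
  (fun x => \sum_(i <- s | P i) f i x) @ F --> \sum_(i <- s | P i) l i.
Proof.
move=> H; elim: s => [|i s IHs].
  by rewrite big_nil; under eq_fun do rewrite big_nil; exact: cvg_cst.
rewrite big_cons; under eq_fun do rewrite big_cons.
by case: ifPn => // Pi; apply: cvgD => //; exact: H.
Qed.

Lemma continuous_atD (K : numFieldType) (V : normedModType K)
    (T : topologicalType) (f g : T -> V) x :
  {for x, continuous f} -> {for x, continuous g} ->
  {for x, continuous (fun y => f y + g y)}.
Proof. by move=> cf cg; apply: cvgD. Qed.

Lemma continuous_atM (K : numFieldType) (T : topologicalType) (f g : T -> K) x :
  {for x, continuous f} -> {for x, continuous g} ->
  {for x, continuous (fun y => f y * g y)}.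
Proof. by move=> cf cg; apply: cvgM. Qed.

Lemma continuous_atV (K : numFieldType) (T : topologicalType) (f : T -> K) x :
  f x != 0 -> {for x, continuous f} -> {for x, continuous (fun y => (f y)^-1)}.
Proof. by move=> f0 cf; apply: cvgV. Qed.

Lemma continuous_at_sum (K : numFieldType) (V : normedModType K)
    (T : topologicalType) (I : Type) (s : seq I) (f : I -> T -> V) x :
  (forall i, {for x, continuous (f i)}) ->
  {for x, continuous (fun y => \sum_(i <- s) f i y)}.
Proof.
by move=> cf; apply: (@cvg_sumr K V _ (nbhs x) _ _ _ _ f (f^~ x)) => i _; exact: cf.
Qed.

Variables (R : realType).

Lemma MVT_along (V : normedModType R) (f : V -> R) (x h : V) :
  (forall t : R, 0 <= t <= 1 -> derivable f (x + t *: h) h) ->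
  exists2 t : R, 0 <= t <= 1 & f (x + h) - f x = 'D_h f (x + t *: h).
Proof.
move=> df; pose g (t : R) : R := f (x + t *: h).
have dg (t : R) : 0 <= t <= 1 -> is_derive t (1 : R) g ('D_h f (x + t *: h)).
  move=> t01.
  have E : (fun k : R => k^-1 *: (g (k *: (1 : R) + t) - g t)) =
           (fun k : R => k^-1 *: (f (k *: h + (x + t *: h)) - f (x + t *: h))).
    apply/funext => k; rewrite /g; congr (_ *: (f _ - _)).
    by rewrite [k *: 1]mulr1 scalerDl addrCA.
  split.
    by rewrite /derivable E; exact: df.
  by rewrite /derive E.
have [|//|c] := @MVT_segment R g (fun t => 'D_h f (x + t *: h)) 0 1 ler01.
- move=> t; rewrite in_itv /= => /andP[t0 t1].
  by apply: dg; rewrite !ltW.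
- apply: continuous_in_subspaceT => t; rewrite inE /= in_itv /= => t01.
  apply: differentiable_continuous; apply/derivable1_diffP.
  by have [] := dg t t01.
rewrite in_itv /= => c01 E; exists c => //.
by move: E; rewrite /g scale1r scale0r addr0 subr0 mulr1.
Qed.

(** The form without division is harmless at k = 0 and turns substitutions in the argument into
    plain inequalities. *)
Lemma is_derive_epsP (V W : normedModType R) (f : V -> W) (x v : V) (l : W) :
  is_derive x v f l <->
  forall e : R, 0 < e -> exists2 d, 0 < d & forall k : R, `|k| < d ->
    `|f (k *: v + x) - f x - k *: l| <= e * `|k|.
Proof.
have E (k e : R) (l' : W) : k != 0 -> (`|f (k *: v + x) - f x - k *: l'| <= e * `|k|) =
    (`|l' - k^-1 *: (f (k *: v + x) - f x)| <= e).
  move=> k0; rewrite -[RHS](@ler_pM2l _ `|k|) ?normr_gt0// -normrZ scalerBr scalerA.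
  by rewrite mulfV// scale1r distrC mulrC.
split=> [[df <-] e e0|H].
  have /cvgrPdist_le /(_ e e0) [d /= d0 Hd] : (fun k : R => k^-1 *: (f (k *: v + x) - f x)) @ 0^' --> 'D_v f x by exact: df.
  exists d => // k kd; have [->|k0] := eqVneq k 0.
    by rewrite !scale0r add0r !subrr !normr0 mulr0.
  have := E k e _ k0 => ->; apply: Hd => //.
  by rewrite /ball_/= sub0r normrN.
have C : (fun k : R => k^-1 *: (f (k *: v + x) - f x)) @ 0^' --> l.
  apply/cvgrPdist_le => e e0; have [d d0 Hd] := H e e0.
  exists d => //= k; rewrite /ball_/= sub0r normrN => kd k0.
  by have := Hd k kd; have := E k e _ k0 => ->.
by split; [apply/cvg_ex; exists l|exact: cvg_lim C].
Qed.

Lemma is_deriveE (V W : normedModType R) (f : V -> W) (x v : V) (l : W) :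
  is_derive x v f l -> 'D_v f x = l.
Proof. by move=> H; exact: derive_val. Qed.

Lemma is_derive_derivable (V W : normedModType R) (f : V -> W) (x v : V) (l : W) :
  is_derive x v f l -> derivable f x v.
Proof. by move=> H; exact: ex_derive. Qed.

Lemma is_deriveZv (V W : normedModType R) (f : V -> W) (x v : V) (l : W) (a : R) :
  is_derive x v f l -> is_derive x (a *: v) f (a *: l).
Proof.
move=> /is_derive_epsP H; apply/is_derive_epsP => e e0.
have a1 : 0 < `|a| + 1 by rewrite ltr_wpDl.
have [d d0 Hd] := H (e / (`|a| + 1)) (divr_gt0 e0 a1).
exists (d / (`|a| + 1)); first exact: divr_gt0.
move=> k kd; rewrite !scalerA; apply: le_trans (Hd _ _) _.
  rewrite normrM; apply: le_lt_trans (_ : `|k| * (`|a| + 1) < _).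
    by rewrite ler_wpM2l// lerDl.
  by rewrite -ltr_pdivlMr.
rewrite normrM -mulrA ler_pM2l// mulrCA ler_piMr// mulrC ler_pdivrMr//.
by rewrite mul1r lerDl.
Qed.

Lemma nbhs_ex_ball (V : normedModType R) (x : V) (P : set V) :
  nbhs x P -> exists2 d : R, 0 < d & forall y, `|x - y| < d -> P y.
Proof.
move=> /nbhs_ballP [d /= d0 H]; exists d => // y yd; apply: H.
by rewrite -ball_normE.
Qed.

(** A step k (u + v) is a step k u followed by a step k v. The first is controlled by the derivative
    at x, the second by the mean value theorem, whose intermediate derivative is close to the one at
    x by continuity of ['D_v f]. *)
Lemma C1_deriveD (V : normedModType R) (U : set V) (f : V -> R) (x u v : V) :
  open U -> U x -> (forall y w, U y -> derivable f y w) ->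
  {for x, continuous ('D_v f)} ->
  is_derive x (u + v) f ('D_u f x + 'D_v f x).
Proof.
move=> oU Ux df cf; apply/is_derive_epsP => e e0.
have e20 : 0 < e / 2 by rewrite divr_gt0.
have [d1 d10 H1] := (is_derive_epsP _ _ _ _).1 (derivableP (df x u Ux)) _ e20.
have : nbhs x (fun y => U y /\ `|'D_v f x - 'D_v f y| <= e / 2).
  apply: filterI; first exact: open_nbhs_nbhs.
  by move/cvgrPdist_le : cf => /(_ _ e20).
move=> /nbhs_ex_ball [d2 d20 H2].
have N : 0 < `|u| + `|v| + 1 by rewrite ltr_wpDl// addr_ge0.
exists (Num.min d1 (d2 / (`|u| + `|v| + 1))).
  by rewrite lt_min d10 divr_gt0.
move=> k; rewrite lt_min => /andP[k1 k2].
have near t : 0 <= t <= 1 -> `|x - (k *: u + x + t *: (k *: v))| < d2.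
  move=> /andP[t0 t1].
  have -> : x - (k *: u + x + t *: (k *: v)) = - (k *: (u + t *: v)).
    by rewrite addrAC opprD addrCA subrr addr0 scalerDr !scalerA mulrC.
  rewrite normrN normrZ; apply: le_lt_trans (_ : `|k| * (`|u| + `|v| + 1) < _).
    rewrite ler_wpM2l// (le_trans (ler_normD _ _))// -addrA lerD2l.
    by rewrite normrZ ger0_norm// ler_wpDr// ler_piMl.
  by rewrite -ltr_pdivlMr.
have [t /near t01] : exists2 t, 0 <= t <= 1 & f (k *: u + x + k *: v) - f (k *: u + x) =
   'D_(k *: v) f (k *: u + x + t *: (k *: v)).
  by apply: MVT_along => t t01; apply: df; have [] := H2 _ (near t t01).
have [Ut Dt] := H2 _ t01.
have -> : 'D_(k *: v) f (k *: u + x + t *: (k *: v)) = k *: 'D_v f (k *: u + x + t *: (k *: v)).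
  by apply: derive_val; apply: is_deriveZv; apply: derivableP; exact: df.
set y := (_ + t *: _) in Ut Dt *.
move=> E.
have -> : f (k *: (u + v) + x) - f x - k *: ('D_u f x + 'D_v f x) =
   (f (k *: u + x) - f x - k *: 'D_u f x) + k * ('D_v f y - 'D_v f x).
  have -> : k *: (u + v) + x = k *: u + x + k *: v by rewrite scalerDr addrAC.
  move: E; rewrite /GRing.scale /= => /eqP; rewrite subr_eq => /eqP ->.
  by ring.
rewrite (le_trans (ler_normD _ _))// [e]splitr mulrDl lerD// ?H1//.
by rewrite normrM mulrC ler_wpM2r// distrC.
Qed.

End Differentiability.

Lemma coord_le_norm (K : numFieldType) m (h : 'rV[K]_m) j : `|h 0 j| <= `|h|.
Proof.
rewrite [leRHS]/Num.Def.normr /= mx_normE [leLHS]nngE num_le.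
exact: (@le_bigmax _ _ _ _ (fun i : 'I_1 * 'I_m => `|h i.1 i.2|%:nng) (ord0, j)).
Qed.

Section FiniteDimension.
Variables (R : realType) (m : nat).
Implicit Types (U : set 'rV[R]_m) (f : 'rV[R]_m -> R).

Lemma C1_derive_sum U f (x : 'rV[R]_m) (h : 'rV[R]_m) :
  open U -> U x -> (forall y w, U y -> derivable f y w) ->
  (forall w, {for x, continuous ('D_w f)}) ->
  'D_h f x = \sum_i h 0 i * 'D_('e_i) f x.
Proof.
move=> oU Ux df cf; rewrite {1}[h]row_sum_delta; apply: derive_val.
elim: (index_enum _) => [|i s IHs].
  by rewrite !big_nil; apply: is_derive_eq; [apply: is_derive0|].
rewrite !big_cons; have := @C1_deriveD R _ U f x (h 0 i *: 'e_i)
  (\sum_(j <- s) h 0 j *: 'e_j) oU Ux df (cf _).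
rewrite (is_deriveE IHs).
by rewrite (is_deriveE (is_deriveZv (h 0 i) (derivableP (df x 'e_i Ux)))).
Qed.

Definition derive_lin f (x : 'rV[R]_m) (h : 'rV[R]_m) : R :=
  \sum_i h 0 i * 'D_('e_i) f x.

Fact derive_lin_is_linear f x : linear (derive_lin f x).
Proof.
move=> a u v; rewrite /derive_lin scaler_sumr -big_split /=; apply: eq_bigr => i _.
by rewrite !mxE mulrDl -mulrA.
Qed.

HB.instance Definition _ f x :=
  GRing.isLinear.Build R 'rV[R]_m R _ (derive_lin f x) (derive_lin_is_linear f x).

Lemma derive_lin_continuous f x : continuous (derive_lin f x).
Proof.
move=> h; suff : {for h, continuous (fun h : 'rV[R]_m => \sum_i h 0 i * 'D_('e_i) f x)} by [].
apply: continuous_at_sum => i.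
by apply: continuous_atM; [exact: coord_continuous|exact: cst_continuous].
Qed.

(** On the segment from x to x + h the mean value theorem gives ['D_h f] at an intermediate point.
    In terms of partial derivatives this differs from the value at x by m errors of size e / (m + 1)
    times the norm of h; m + 1 instead of m also covers dimension 0. *)
Lemma C1_differentiable U f (x : 'rV[R]_m) :
  open U -> (forall y w, U y -> derivable f y w) ->
  (forall y w, U y -> {for y, continuous ('D_w f)}) ->
  U x -> differentiable f x.
Proof.
move=> oU df cf Ux.
apply: (@differentiable_eps _ _ _ f x (derive_lin f x) (@derive_lin_continuous f x) _).1.
move=> e e0; have e1 : 0 < e / (m%:R + 1).
  by rewrite divr_gt0// ltr_wpDl.
have : nbhs x (fun y => U y /\ forall i, `|'D_('e_i) f x - 'D_('e_i) f y| <= e / (m%:R + 1)).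
  apply: filterI; first exact: open_nbhs_nbhs.
  apply: (@filter_forall _ _ (fun (i : 'I_m) y => `|'D_('e_i) f x - 'D_('e_i) f y| <= e / (m%:R + 1)) (nbhs x) _) => i.
  by have /cvgrPdist_le := cf x 'e_i Ux; apply.
move=> /nbhs_ex_ball [d d0 Hd].
apply/nbhs_ballP; exists d => //= h; rewrite -ball_normE /= sub0r normrN => hd.
have near t : 0 <= t <= 1 -> `|x - (x + t *: h)| < d.
  move=> /andP[t0 t1]; rewrite opprD addNKr normrN normrZ ger0_norm//.
  by apply: le_lt_trans hd; rewrite ler_piMl.
have [t t01 E] : exists2 t, 0 <= t <= 1 & f (x + h) - f x = 'D_h f (x + t *: h).
  by apply: MVT_along => t t01; apply: df; have [] := Hd _ (near t t01).
have [Ut Dt] := Hd _ (near t t01).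
rewrite [h + x]addrC E (C1_derive_sum h oU Ut) //; last by move=> w; exact: cf.
rewrite /= /derive_lin -sumrB; apply: (le_trans (ler_norm_sum _ _ _)).
apply: (le_trans (_ : _ <= \sum_(i < m) (e / (m%:R + 1) * `|h|))).
  apply: ler_sum => i _; rewrite -mulrBr normrM mulrC ler_pM//.
    by rewrite distrC.
  exact: coord_le_norm.
rewrite sumr_const card_ord -[leLHS]mulr_natl mulrA ler_wpM2r//.
rewrite mulrCA ler_piMr ?ltW// ?ltr_pdivrMr ?ltr_wpDl// mul1r; last by rewrite ltrDl.
Qed.

End FiniteDimension.

Section Schwarz.
Variables (R : realType) (V : normedModType R).

Lemma is_derive_shift_arg (W : normedModType R) (f : V -> W) (x a v : V) (l : W) :
  is_derive (x + a) v f l -> is_derive x v (fun y => f (y + a)) l.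
Proof.
move=> /is_derive_epsP H; apply/is_derive_epsP => e /H[d d0 Hd]; exists d => // k kd.
by have := Hd k kd; rewrite addrA.
Qed.

(** The mean value theorem, applied to y |-> f (y + s v) - f y along u and then to ['D_u f] along v,
    turns the second difference into s^2 times the mixed derivative at a point near x. The second
    difference is symmetric in u and v, which is the reason for [schwarz]. *)
Lemma second_difference (U : set V) (f : V -> R) (x u v : V) (e : R) :
  open U -> U x -> (forall y, U y -> derivable f y u) ->
  (forall y, U y -> derivable ('D_u f) y v) ->
  {for x, continuous ('D_v ('D_u f))} -> 0 < e ->
  exists2 d, 0 < d & forall s : R, 0 < s < d ->
    `|(f (x + s *: u + s *: v) - f (x + s *: u) - (f (x + s *: v) - f x)) / s ^+ 2
      - 'D_v ('D_u f) x| <= e.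
Proof.
move=> oU Ux du duv cuv e0.
have : nbhs x (fun y => U y /\ `|'D_v ('D_u f) x - 'D_v ('D_u f) y| <= e).
  apply: filterI; first exact: open_nbhs_nbhs.
  by have /cvgrPdist_le := cuv; apply.
move=> /nbhs_ex_ball [d d0 Hd].
have N : 0 < `|u| + `|v| + 1 by rewrite ltr_wpDl// addr_ge0.
exists (d / (`|u| + `|v| + 1)); first exact: divr_gt0.
move=> s /andP[s0 sd].
have near t1 t2 : 0 <= t1 <= 1 -> 0 <= t2 <= 1 ->
    `|x - (x + t1 *: (s *: u) + t2 *: (s *: v))| < d.
  move=> /andP[a0 a1] /andP[b0 b1]; rewrite -addrA opprD addNKr normrN.
  apply: le_lt_trans (_ : s * (`|u| + `|v| + 1) < _); last first.
    by rewrite -ltr_pdivlMr.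
  rewrite (le_trans (ler_normD _ _))// !normrZ !ger0_norm ?(ltW s0)//.
  rewrite !mulrDr mulr1. apply: ler_wpDr; first exact: ltW.
  by rewrite lerD// ler_piMl// mulr_ge0// ltW.
pose g y := f (y + s *: v) - f y.
have dg t : 0 <= t <= 1 -> is_derive (x + t *: (s *: u)) (s *: u) g
   (s *: ('D_u f (x + t *: (s *: u) + s *: v) - 'D_u f (x + t *: (s *: u)))).
  move=> t01; apply: is_deriveZv; rewrite /g; apply: is_deriveB.
    apply: is_derive_shift_arg; apply: derivableP; apply: du.
    by have [] := Hd _ (near t 1 t01 _); rewrite ?ler01 ?lexx// scale1r.
  apply: derivableP; apply: du.
  by have [] := Hd _ (near t 0 t01 _); rewrite ?lexx ?ler01// scale0r addr0.
have [t t01 E] := @MVT_along R V g x (s *: u) (fun t t01 => is_derive_derivable (dg t t01)).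
have D2 r : 0 <= r <= 1 -> U (x + t *: (s *: u) + r *: (s *: v)).
  by move=> r01; have [] := Hd _ (near t r t01 r01).
have [r r01 E2] : exists2 r : R, 0 <= r <= 1 & 'D_u f (x + t *: (s *: u) + s *: v) - 'D_u f (x + t *: (s *: u)) =
   'D_(s *: v) ('D_u f) (x + t *: (s *: u) + r *: (s *: v)).
  apply: (@MVT_along R V ('D_u f) (x + t *: (s *: u)) (s *: v)) => r r01.
  exact: (is_derive_derivable (is_deriveZv s (derivableP (duv _ (D2 r r01))))).
move: E; rewrite (is_deriveE (dg t t01)) E2.
rewrite (is_deriveE (is_deriveZv s (derivableP (duv _ (D2 r r01))))).
have [_ +] := Hd _ (near t r t01 r01).
rewrite /g [in X in X -> _]distrC => H E.
have -> : f (x + s *: u + s *: v) - f (x + s *: u) - (f (x + s *: v) - f x) =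
   s ^+ 2 * 'D_v ('D_u f) (x + t *: (s *: u) + r *: (s *: v)).
  by rewrite E expr2 -mulrA.
by rewrite mulrC mulKf// sqrf_eq0 gt_eqF.
Qed.

Lemma schwarz (U : set V) (f : V -> R) (x u v : V) :
  open U -> U x -> (forall y w, U y -> derivable f y w) ->
  (forall y, U y -> derivable ('D_u f) y v) ->
  (forall y, U y -> derivable ('D_v f) y u) ->
  {for x, continuous ('D_v ('D_u f))} -> {for x, continuous ('D_u ('D_v f))} ->
  'D_v ('D_u f) x = 'D_u ('D_v f) x.
Proof.
move=> oU Ux df duv dvu cuv cvu; apply/eqP; rewrite -subr_eq0 -normr_le0.
apply/ler_addgt0Pl => e e0; rewrite addr0.
have e2 : 0 < e / 2 by rewrite divr_gt0.
have [d1 d10 H1] := second_difference oU Ux (fun y => df y u) duv cuv e2.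
have [d2 d20 H2] := second_difference oU Ux (fun y => df y v) dvu cvu e2.
pose s := Num.min d1 d2 / 2.
have s0 : 0 < s by rewrite divr_gt0// lt_min d10.
have sm : s < Num.min d1 d2 by rewrite ltr_pdivrMr// ltr_pMr ?ltr1n// lt_min d10.
move: (sm); rewrite lt_min => /andP[s1 s2].
have /H1 A : 0 < s < d1 by rewrite s0.
have /H2 B : 0 < s < d2 by rewrite s0.
have E : f (x + s *: u + s *: v) - f (x + s *: u) - (f (x + s *: v) - f x) =
   f (x + s *: v + s *: u) - f (x + s *: v) - (f (x + s *: u) - f x).
  rewrite [x + s *: u + s *: v]addrAC.
  by move: (f _) (f _) (f _) (f _) => a b c d; ring.
rewrite E in A; move: A B; set q := _ / _; set a := 'D_v _ _; set b := 'D_u _ _; clearbody q a b.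
move=> A B; rewrite [e]splitr -(subrKA q) (le_trans (ler_normD _ _))// lerD//.
by rewrite distrC.
Qed.

End Schwarz.

(** * Calculus of C^k functions defined by iterated directional derivatives *)

Section Ck.
Variables (R : realType).

Lemma is_derive_line (V W : normedModType R) (f : V -> W) (x v : V) (l : W) :
  is_derive x v f l <-> is_derive (0 : R) (1 : R) (fun h : R => f (h *: v + x)) l.
Proof.
split=> /is_derive_epsP H; apply/is_derive_epsP => e /H[d d0 Hd]; exists d => // k kd.
  by have := Hd k kd; rewrite scale0r add0r addr0 [k *: 1]mulr1.
by have := Hd k kd; rewrite scale0r add0r addr0 [k *: 1]mulr1.
Qed.

(** On the line through x along v, g becomes a function of one real variable, for which derivability
    is already differentiability; the chain rule for differentials then applies. *)
Lemma is_derive_comp (V W W' : normedModType R) (f : W -> W') (g : V -> W) (x v : V) (l : W) :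
  differentiable f (g x) -> is_derive x v g l ->
  is_derive x v (f \o g) ('D_l f (g x)).
Proof.
move=> df /is_derive_line dg; apply/is_derive_line.
pose gg := fun h : R => g (h *: v + x).
have gg0 : gg 0 = g x by rewrite /gg scale0r add0r.
have dgg : differentiable gg 0 by apply/derivable1_diffP; exact: is_derive_derivable dg.
have dfg : differentiable f (gg 0) by rewrite gg0.
have dc := differentiable_comp dgg dfg.
split; first by apply/derivable1_diffP.
rewrite -[LHS]/('D_1 (f \o gg) 0) deriveE// diff_comp//= gg0 -deriveE// -deriveE//.
by rewrite (is_deriveE dg).
Qed.

Lemma Ck_on_continuous m (V : normedModType R) k (U : set 'rV[R]_m) (f : 'rV[R]_m -> V) x :
  Ck_on k U f -> U x -> {for x, continuous f}.
Proof. by case: k => [|k] [cf _]; exact: cf. Qed.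

Lemma Ck_on_derivable m (V : normedModType R) k (U : set 'rV[R]_m) (f : 'rV[R]_m -> V) x v :
  Ck_on k.+1 U f -> U x -> derivable f x v.
Proof. by move=> [_ /(_ v)[df _]]; exact: df. Qed.

Lemma Ck_on_derive m (V : normedModType R) k (U : set 'rV[R]_m) (f : 'rV[R]_m -> V) v :
  Ck_on k.+1 U f -> Ck_on k U ('D_v f).
Proof. by move=> [_ /(_ v)[_ df]]. Qed.

Lemma Ck_on_pred m (V : normedModType R) k (U : set 'rV[R]_m) (f : 'rV[R]_m -> V) :
  Ck_on k.+1 U f -> Ck_on k U f.
Proof.
elim: k f => [|k IHk] f /=; first by move=> [cf _]; split.
move=> [cf df]; split=> // v; have [dfv ddf] := df v; split=> //.
by apply: IHk; exact: ddf.
Qed.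

Lemma Ck_on_subset m (V : normedModType R) k (U W : set 'rV[R]_m) (f : 'rV[R]_m -> V) :
  W `<=` U -> Ck_on k U f -> Ck_on k W f.
Proof.
move=> WU; elim: k f => [|k IHk] f /=; first by move=> [cf _]; split=> // x /WU; exact: cf.
move=> [cf df]; split=> [x /WU|v]; first exact: cf.
have [dfv ddf] := df v; split=> [x /WU|]; first exact: dfv.
exact: IHk.
Qed.

(** [Ck_on] is a condition at each point of the set, stated with full neighbourhoods in the ambient
    space, so it may be verified piecewise. *)
Lemma Ck_on_local m (V : normedModType R) k (U : set 'rV[R]_m) (f : 'rV[R]_m -> V) :
  (forall x, U x -> exists2 W, W x & Ck_on k W f) -> Ck_on k U f.
Proof.
elim: k f => [|k IHk] f H.
  by split=> // x /H[W Wx]; move/Ck_on_continuous; exact.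
split=> [x /H[W Wx]|v]; first by move/Ck_on_continuous; exact.
split=> [x /H[W Wx]|]; first by move/Ck_on_derivable; exact.
by apply: IHk => x /H[W Wx /Ck_on_derive Wf]; exists W.
Qed.

Lemma open_near_eq (T : topologicalType) (S : Type) (U : set T) (f g : T -> S) x :
  open U -> (forall y, U y -> f y = g y) -> U x -> \forall y \near x, f y = g y.
Proof.
move=> oU fg Ux; apply: filterS (_ : nbhs x U); first exact: fg.
exact: open_nbhs_nbhs.
Qed.

Lemma near_eq_continuous_at (T S : topologicalType) (f g : T -> S) x :
  (\forall y \near x, f y = g y) -> {for x, continuous f} -> {for x, continuous g}.
Proof.
move=> fg cf; have E : f x = g x := nbhs_singleton fg; change (g @ x --> g x); rewrite -E.
exact: cvg_trans (near_eq_cvg fg) cf.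
Qed.

Lemma Ck_on_ext m (V : normedModType R) k (U : set 'rV[R]_m) (f g : 'rV[R]_m -> V) :
  open U -> (forall y, U y -> f y = g y) -> Ck_on k U f -> Ck_on k U g.
Proof.
move=> oU; elim: k f g => [|k IHk] f g fg [cf df].
  by split=> // x Ux; apply: near_eq_continuous_at (cf x Ux); exact: open_near_eq fg Ux.
split=> [x Ux|v].
  by apply: near_eq_continuous_at (cf x Ux); exact: open_near_eq fg Ux.
have [dfv ddf] := df v; split=> [x Ux|].
  by apply: near_eq_derivable (dfv x Ux); exact: open_near_eq fg Ux.
apply: IHk ddf => y Uy; apply: near_eq_derive; exact: open_near_eq fg Uy.
Qed.

Lemma Ck_on_cst m (V : normedModType R) k (U : set 'rV[R]_m) (c : V) :
  Ck_on k U (fun=> c).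
Proof.
elim: k c => [|k IHk] c; first by split=> // x _; exact: cst_continuous.
split=> [x _|v]; first exact: cst_continuous.
split=> [x _|]; first exact: derivable_cst.
have -> : 'D_v (fun=> c) = (fun _ : 'rV[R]_m => 0 : V); last exact: IHk.
by apply/funext => x; rewrite derive_cst.
Qed.

Lemma Ck_onD m (V : normedModType R) k (U : set 'rV[R]_m) (f g : 'rV[R]_m -> V) :
  open U -> Ck_on k U f -> Ck_on k U g -> Ck_on k U (fun x => f x + g x).
Proof.
move=> oU; elim: k f g => [|k IHk] f g [cf df] [cg dg].
  by split=> // x Ux; apply: continuous_atD; [exact: (cf _ Ux)|exact: (cg _ Ux)].
split=> [x Ux|v]; first by apply: continuous_atD; [exact: (cf _ Ux)|exact: (cg _ Ux)].
have [dfv ddf] := df v; have [dgv ddg] := dg v; split=> [x Ux|].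
  by apply: derivableD; [exact: dfv|exact: dgv].
apply: Ck_on_ext (IHk _ _ ddf ddg) => // x Ux.
by rewrite deriveD//; [exact: dfv|exact: dgv].
Qed.

Lemma Ck_onM m k (U : set 'rV[R]_m) (f g : 'rV[R]_m -> R) :
  open U -> Ck_on k U f -> Ck_on k U g -> Ck_on k U (fun x => f x * g x).
Proof.
move=> oU; elim: k f g => [|k IHk] f g Cf Cg.
  split=> // x Ux; apply: continuous_atM.
    exact: (Ck_on_continuous Cf Ux).
  exact: (Ck_on_continuous Cg Ux).
split=> [x Ux|v].
  by apply: continuous_atM; [exact: (Ck_on_continuous Cf Ux)|exact: (Ck_on_continuous Cg Ux)].
split=> [x Ux|].
  by apply: derivableM; [exact: (Ck_on_derivable Cf)|exact: (Ck_on_derivable Cg)].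
have := Ck_onD oU (IHk _ _ (Ck_on_pred Cf) (Ck_on_derive v Cg))
   (IHk _ _ (Ck_on_pred Cg) (Ck_on_derive v Cf)).
apply: Ck_on_ext => // x Ux.
by rewrite deriveM//; [exact: (Ck_on_derivable Cf)|exact: (Ck_on_derivable Cg)].
Qed.

Lemma Ck_on_sum m (V : normedModType R) k (U : set 'rV[R]_m) I (s : seq I) (f : I -> 'rV[R]_m -> V) :
  open U -> (forall i, Ck_on k U (f i)) -> Ck_on k U (fun x => \sum_(i <- s) f i x).
Proof.
move=> oU Cf; elim: s => [|i s IHs].
  by under eq_fun do rewrite big_nil; exact: Ck_on_cst.
by under eq_fun do rewrite big_cons; exact: Ck_onD.
Qed.

Lemma Ck_on_prod m k (U : set 'rV[R]_m) I (s : seq I) (f : I -> 'rV[R]_m -> R) :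
  open U -> (forall i, Ck_on k U (f i)) -> Ck_on k U (fun x => \prod_(i <- s) f i x).
Proof.
move=> oU Cf; elim: s => [|i s IHs].
  by under eq_fun do rewrite big_nil; exact: Ck_on_cst.
by under eq_fun do rewrite big_cons; exact: Ck_onM.
Qed.

Lemma continuous_rowP (T : topologicalType) p (f : T -> 'rV[R]_p) x :
  {for x, continuous f} <-> forall j, {for x, continuous (fun y => f y 0 j)}.
Proof.
split=> [cf j|cf].
  by apply: (@continuous_comp _ _ _ f (fun M : 'rV[R]_p => M 0 j)) => //; exact: coord_continuous.
apply/cvgrPdist_le => e e0.
have : \forall y \near x, forall j, `|f x 0 j - f y 0 j| <= e.
  apply: (@filter_forall _ _ (fun (j : 'I_p) y => `|f x 0 j - f y 0 j| <= e) (nbhs x) _) => j.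
  by have /cvgrPdist_le := cf j; exact.
apply: filterS => y Hy; rewrite [leLHS]/Num.Def.normr/= mx_normrE.
apply: bigmax_le => [|[i j] _]; first exact: ltW.
by rewrite !mxE !ord1.
Qed.

Lemma derivable_rowP (V : normedModType R) p (f : V -> 'rV[R]_p) x v :
  derivable f x v <-> forall j, derivable (fun y => f y 0 j) x v.
Proof.
rewrite derivable_mxP; split=> [H j|H i j]; first exact: H.
by rewrite ord1; exact: H.
Qed.

Lemma derive_row (V : normedModType R) p (f : V -> 'rV[R]_p) x v j :
  derivable f x v -> ('D_v f x) 0 j = 'D_v (fun y => f y 0 j) x.
Proof. by move=> df; rewrite derive_mx// mxE. Qed.

Lemma Ck_on_rowP m p k (U : set 'rV[R]_m) (f : 'rV[R]_m -> 'rV[R]_p) :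
  open U -> Ck_on k U f <-> forall j, Ck_on k U (fun x => f x 0 j).
Proof.
move=> oU; elim: k f => [|k IHk] f.
  split=> [[cf _] j|H]; split=> // x Ux.
    by have /continuous_rowP := cf x Ux; exact.
  by apply/continuous_rowP => j; have [cf _] := H j; exact: cf.
split=> [[cf df] j|H]; split=> [x Ux|v].
- by have /continuous_rowP := cf x Ux; exact.
- have [dfv ddf] := df v; split=> [x Ux|]; first exact: ((derivable_rowP _ _ _).1 (dfv x Ux)).
  apply: Ck_on_ext ((IHk _).1 ddf j) => // x Ux; apply: derive_row; exact: dfv.
- by apply/continuous_rowP => j; have [cf _] := H j; exact: cf.
- have dfv x : U x -> derivable f x v.
    by move=> Ux; apply/derivable_rowP => j; exact: (Ck_on_derivable (H j)).
  split=> //; apply/IHk => j; apply: Ck_on_ext (Ck_on_derive v (H j)) => // x Ux.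
  by rewrite derive_row//; exact: dfv.
Qed.

Lemma Ck_on_differentiable m k (U : set 'rV[R]_m) (f : 'rV[R]_m -> R) x :
  open U -> Ck_on k.+1 U f -> U x -> differentiable f x.
Proof.
move=> oU Cf; apply: C1_differentiable => // y w Uy; first exact: (Ck_on_derivable Cf).
exact: (Ck_on_continuous (Ck_on_derive w Cf)).
Qed.

Lemma Ck_on_derive_sum m k (U : set 'rV[R]_m) (f : 'rV[R]_m -> R) x h :
  open U -> Ck_on k.+1 U f -> U x -> 'D_h f x = \sum_i h 0 i * 'D_('e_i) f x.
Proof.
move=> oU Cf Ux; apply: (C1_derive_sum h oU Ux) => [y w Uy|w].
  exact: (Ck_on_derivable Cf).
exact: (Ck_on_continuous (Ck_on_derive w Cf)).
Qed.

(** The derivative along v is the sum over i of ['D_v] of the i-th coordinate of g times the i-th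
    partial derivative of f composed with g. The induction replaces f by its partial derivatives and
    keeps g, viewed as one order less regular. *)
Lemma Ck_on_comp m p k (U : set 'rV[R]_m) (W : set 'rV[R]_p)
    (f : 'rV[R]_p -> R) (g : 'rV[R]_m -> 'rV[R]_p) :
  open U -> open W -> (forall x, U x -> W (g x)) ->
  Ck_on k W f -> Ck_on k U g -> Ck_on k U (f \o g).
Proof.
move=> oU oW gUW; elim: k f => [|k IHk] f Cf Cg.
  split=> // x Ux; apply: continuous_comp; first exact: (Ck_on_continuous Cg).
  by apply: (Ck_on_continuous Cf); exact: gUW.
have cfg x : U x -> {for x, continuous (f \o g)}.
  move=> Ux; apply: continuous_comp; first exact: (Ck_on_continuous Cg).
  by apply: (Ck_on_continuous Cf); exact: gUW.
have dfg v x : U x -> is_derive x v (f \o g) ('D_('D_v g x) f (g x)).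
  move=> Ux; apply: is_derive_comp.
    by apply: (Ck_on_differentiable oW Cf); exact: gUW.
  by apply: derivableP; exact: (Ck_on_derivable Cg).
split=> // v; split=> [x Ux|]; first exact: is_derive_derivable (dfg v x Ux).
pose F x := \sum_i 'D_v (fun y => g y 0 i) x * 'D_('e_i) f (g x).
apply: (@Ck_on_ext _ _ _ _ F) => // [x Ux|].
  rewrite (is_deriveE (dfg v x Ux)) (Ck_on_derive_sum _ oW Cf); last exact: gUW.
  apply: eq_bigr => i _; rewrite derive_row//; exact: (Ck_on_derivable Cg).
apply: Ck_on_sum => // i.
apply: Ck_onM => //.
  by apply: Ck_on_derive; have /Ck_on_rowP := Cg; exact.
by apply: (IHk ('D_('e_i) f)); [exact: Ck_on_derive|exact: Ck_on_pred].
Qed.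

Lemma Ck_on_comp_row m p q k (U : set 'rV[R]_m) (W : set 'rV[R]_p)
    (f : 'rV[R]_p -> 'rV[R]_q) (g : 'rV[R]_m -> 'rV[R]_p) :
  open U -> open W -> (forall x, U x -> W (g x)) ->
  Ck_on k W f -> Ck_on k U g -> Ck_on k U (f \o g).
Proof.
move=> oU oW gUW Cf Cg; apply/Ck_on_rowP => // j.
exact: (@Ck_on_comp m p k U W (fun x => f x 0 j) g oU oW gUW ((Ck_on_rowP k f oW).1 Cf j) Cg).
Qed.

Lemma Ck_on_affine m p k (U : set 'rV[R]_m) (A : 'M[R]_(m, p)) (b : 'rV[R]_p) :
  Ck_on k U (fun x => x *m A + b).
Proof.
have cl j : continuous (fun x : 'rV[R]_m => (x *m A + b) 0 j).
  move=> x; have -> : (fun x : 'rV[R]_m => (x *m A + b) 0 j) = (fun x => \sum_i x 0 i * A i j + b 0 j).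
    by apply/funext => y; rewrite !mxE.
  apply: continuous_atD; last exact: cst_continuous.
  apply: continuous_at_sum => i.
  by apply: continuous_atM; [exact: coord_continuous|exact: cst_continuous].
have ca x : {for x, continuous (fun x : 'rV[R]_m => x *m A + b)}.
  by apply/continuous_rowP => j; exact: cl.
have da (x v : 'rV[R]_m) : is_derive x v (fun x : 'rV[R]_m => x *m A + b) (v *m A).
  apply/is_derive_epsP => e e0; exists 1 => // t _.
  by rewrite mulmxDl -scalemxAl opprD addrACA addrK subrr addr0 subrr normr0 mulr_ge0// ltW.
case: k => [|k]; split=> // v; split=> [x _|]; first exact: is_derive_derivable (da x v).
have -> : 'D_v (fun x : 'rV[R]_m => x *m A + b) = (fun=> v *m A).
  by apply/funext => x; exact: (is_deriveE (da x v)).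
exact: Ck_on_cst.
Qed.

Lemma Ck_onV m k (U : set 'rV[R]_m) (f : 'rV[R]_m -> R) :
  open U -> (forall x, U x -> f x != 0) -> Ck_on k U f -> Ck_on k U (fun x => (f x)^-1).
Proof.
move=> oU f0; elim: k => [|k IHk] Cf.
  by split=> // x Ux; apply: continuous_atV; [exact: f0|exact: (Ck_on_continuous Cf Ux)].
split=> [x Ux|v]; first by apply: continuous_atV; [exact: f0|exact: (Ck_on_continuous Cf Ux)].
split=> [x Ux|].
  by apply: derivableV; [exact: f0|exact: (Ck_on_derivable Cf)].
have C1 := IHk (Ck_on_pred Cf).
(* The derivative is arranged as f^-1 f^-1 f' (-1), so that the induction hypothesis covers both
   factors f^-1. *)
have := Ck_onM oU (Ck_onM oU (Ck_onM oU C1 C1) (Ck_on_derive v Cf)) (Ck_on_cst k U (- 1 : R)).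
apply: Ck_on_ext => // x Ux.
rewrite deriveV; [|exact: f0|exact: (Ck_on_derivable Cf)].
by rewrite /GRing.scale /= mulrN1 -mulNr -expr2 exprVn.
Qed.

End Ck.

(** * Invariant means on solvable groups *)

Section MinimalSublinear.
Variables (R : realType) (V : lmodType R) (S : set V).
Hypotheses (S0 : S 0) (SD : forall x y, S x -> S y -> S (x + y))
  (SZ : forall (a : R) x, S x -> S (a *: x)).

Definition sublinear_on (p : V -> R) : Prop :=
  (forall x y, S x -> S y -> p (x + y) <= p x + p y) /\
  (forall (a : R) x, 0 <= a -> S x -> p (a *: x) = a * p x).

Let SN x : S x -> S (- x). Proof. by rewrite -scaleN1r; exact: SZ. Qed.

Lemma sublinear0 p : sublinear_on p -> p 0 = 0.
Proof. by case=> _ /(_ 0 0 (lexx _) S0); rewrite scale0r mul0r. Qed.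

Lemma sublinear_ge_opp p x : sublinear_on p -> S x -> - p (- x) <= p x.
Proof.
move=> sp Sx; rewrite lerNl -subr_ge0 opprK addrC -(sublinear0 sp) -{1}(subrr x).
by have [+ _] := sp; apply => //; exact: SN.
Qed.

Let dominated (p q : V -> R) := forall x, S x -> q x <= p x.

Lemma minimal_sublinear_linear (q : V -> R) : sublinear_on q ->
  (forall q', sublinear_on q' -> dominated q q' -> dominated q' q) ->
  (forall x y, S x -> S y -> q (x + y) = q x + q y) /\
  (forall (a : R) x, S x -> q (a *: x) = a * q x).
Proof.
move=> sq qmin; have [qD qZ] := sq.
have qN v : S v -> q (- v) = - q v.
  (* x |-> inf_(t >= 0) (q (x + t v) - t q v) is sublinear, lies below q and is
     at most - q v at - v, so minimality of q forces q (- v) = - q v *)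
  move=> Sv; pose E x := [set q (x + t *: v) - t * q v | t in [set t : R | 0 <= t]].
  have Elb x : S x -> lbound (E x) (- q (- x)).
    move=> Sx _ [t /= t0 <-]; rewrite -qZ// lerBrDr addrC -lerBrDr opprK.
    have {1}-> : t *: v = x + t *: v - x by rewrite addrAC subrr add0r.
    by apply: qD; [apply: SD => //; exact: SZ|exact: SN].
  have Ehas x : S x -> has_inf (E x).
    move=> Sx; split; last by exists (- q (- x)); exact: Elb.
    by exists (q (x + 0 *: v) - 0 * q v); exists 0 => //=; exact: lexx.
  pose q' x := inf (E x).
  have qvle x (t : R) : S x -> 0 <= t -> q' x <= q (x + t *: v) - t * q v.
    by move=> Sx t0; apply: ge_inf; [exact: (Ehas x Sx).2|exists t].
  have qvge x (c : R) : S x -> (forall t : R, 0 <= t -> c <= q (x + t *: v) - t * q v) -> c <= q' x.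
    by move=> Sx H; apply: lb_le_inf; [exact: (Ehas x Sx).1|move=> _ [t /= t0 <-]; exact: H].
  have sq' : sublinear_on q'.
    split=> [x y Sx Sy|a x a0 Sx].
      rewrite -lerBlDr; refine (qvge x (q' (x + y) - q' y) Sx _) => t t0; rewrite lerBlDr -lerBlDl.
      apply: qvge => // s s0; rewrite lerBlDl.
      apply: le_trans (qvle (x + y) (t + s) (SD Sx Sy) (addr_ge0 t0 s0)) _.
      have -> : x + y + (t + s) *: v = (x + t *: v) + (y + s *: v).
        by rewrite scalerDl addrACA.
      have := qD _ _ (SD Sx (SZ t Sv)) (SD Sy (SZ s Sv)); lra.
    have le1 b y : 0 < b -> S y -> q' (b *: y) <= b * q' y.
      move=> b0 Sy; rewrite -ler_pdivrMl//; apply: qvge => // t t0.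
      have := qvle (b *: y) (b * t) (SZ b Sy) (mulr_ge0 (ltW b0) t0).
      rewrite -scalerA -scalerDr (qZ _ _ (ltW b0) (SD Sy (SZ t Sv))) => H.
      by rewrite ler_pdivrMl// mulrBr mulrA.
    have [->|an0] := eqVneq a 0.
      rewrite scale0r mul0r; apply/eqP; rewrite eq_le; apply/andP; split.
        by have := qvle 0 0 S0 (lexx _); rewrite add0r scale0r mul0r subr0 (sublinear0 sq).
      by apply: qvge => // t t0; rewrite add0r qZ// subrr.
    have a1 : 0 < a by rewrite lt_neqAle eq_sym an0.
    apply/eqP; rewrite eq_le le1//=; have := le1 a^-1 (a *: x).
    rewrite scalerA mulVf// scale1r invr_gt0 => /(_ a1 (SZ _ Sx)).
    by rewrite -ler_pdivlMl ?invr_gt0// invrK.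
  have /(qmin _ sq') H : dominated q q'.
    by move=> x Sx; have := qvle x 0 Sx (lexx _); rewrite scale0r addr0 mul0r subr0.
  apply/eqP; rewrite eq_le; apply/andP; split.
    have := qvle _ 1 (SN Sv) ler01; rewrite scale1r addNr mul1r (sublinear0 sq) sub0r.
    by apply: le_trans; apply: H; exact: SN.
  by rewrite lerNl; have := sublinear_ge_opp sq (SN Sv); rewrite opprK lerNl.
have qDe x y : S x -> S y -> q (x + y) = q x + q y.
  move=> Sx Sy; apply/eqP; rewrite eq_le qD//=.
  have := qD _ _ (SN Sx) (SN Sy); rewrite -opprD !qN//; last exact: SD.
  by rewrite -opprD lerN2.
split=> // a x Sx; have [a0|a0] := leP 0 a; first exact: qZ.
have -> : a *: x = - ((- a) *: x) by rewrite scaleNr opprK.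
rewrite qN; last exact: SZ.
by rewrite qZ// ?mulNr ?opprK// oppr_ge0 ltW.
Qed.

(** Hahn-Banach by Zorn's lemma among the sublinear functionals below p, a minimal one being linear.
    A chain is bounded by its pointwise infimum, which is finite because each member q satisfies - p
    (- x) <= - q (- x) <= q x. The order is only a preorder, since functionals are compared on S
    alone. *)
Lemma linear_below_sublinear (p : V -> R) : sublinear_on p ->
  exists2 l : V -> R,
    (forall x y, S x -> S y -> l (x + y) = l x + l y) /\
    (forall (a : R) x, S x -> l (a *: x) = a * l x)
  & dominated p l.
Proof.
move=> sp; pose T := {q : V -> R | sublinear_on q /\ dominated p q}.
pose t0 : T := exist _ p (conj sp (fun x _ => lexx (p x))).
pose r : rel T := fun a b => `[< dominated (sval a) (sval b) >].
have [||C Ctot|[q [sq qp]] qmax] := @ZL_preorder T t0 r.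
- by move=> a; apply/asboolP.
- by move=> a b c /asboolP H1 /asboolP H2; apply/asboolP => x Sx; exact: le_trans (H2 _ Sx) (H1 _ Sx).
- have [[c0 Cc0]|C0] := pselect (C !=set0); last first.
    by exists t0 => s Cs; exfalso; apply: C0; exists s.
  pose E x := [set sval c x | c in C].
  have Elb x : S x -> lbound (E x) (- p (- x)).
    move=> Sx _ [[q [sq qp]] _ <-] /=; apply: le_trans (sublinear_ge_opp sq Sx).
    by rewrite lerN2; apply: qp; exact: SN.
  have Ehas x : S x -> has_inf (E x).
    move=> Sx; split; last by exists (- p (- x)); exact: Elb.
    by exists (sval c0 x); exists c0.
  pose q x := inf (E x).
  have qle x c : S x -> C c -> q x <= sval c x.
    by move=> Sx Cc; apply: ge_inf; [exact: (Ehas x Sx).2|exists c].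
  have qge x (d : R) : S x -> (forall c, C c -> d <= sval c x) -> d <= q x.
    by move=> Sx H; apply: lb_le_inf; [exact: (Ehas x Sx).1|move=> _ [c Cc <-]; exact: H].
  have sq : sublinear_on q.
    split=> [x y Sx Sy|a x a0 Sx].
      rewrite -lerBlDr; refine (qge x (q (x + y) - q y) Sx _) => c Cc; rewrite lerBlDr -lerBlDl.
      apply: qge => // d Cd; rewrite lerBlDl.
      (* An infimum of sublinear functionals need not be subadditive; here c and d are comparable,
         and the smaller of them bounds the value at x + y. *)
      have [/asboolP H|/asboolP H] := Ctot c d Cc Cd.
        apply: le_trans (qle _ _ (SD Sx Sy) Cd) _.
        apply: le_trans ((svalP d).1.1 _ _ Sx Sy) _.
        by rewrite lerD2r; exact: H.
      apply: le_trans (qle _ _ (SD Sx Sy) Cc) _.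
      apply: le_trans ((svalP c).1.1 _ _ Sx Sy) _.
      by rewrite lerD2l; exact: H.
    have [->|an0] := eqVneq a 0.
      have -> : q (0 *: x) = q 0 by rewrite scale0r.
      rewrite mul0r; apply/eqP; rewrite eq_le; apply/andP; split.
        by have := qle 0 c0 S0 Cc0; rewrite (sublinear0 (svalP c0).1).
      by apply: qge => // c Cc; rewrite (sublinear0 (svalP c).1).
    have a1 : 0 < a by rewrite lt_neqAle eq_sym an0.
    apply/eqP; rewrite eq_le; apply/andP; split.
      rewrite -ler_pdivrMl//; apply: qge => // c Cc; rewrite ler_pdivrMl//.
      rewrite -((svalP c).1.2 _ _ a0 Sx); apply: qle => //; exact: SZ.
    apply: qge; first exact: SZ.
    by move=> c Cc; rewrite ((svalP c).1.2 _ _ a0 Sx) ler_pM2l//; exact: qle.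
  have qp : dominated p q.
    by move=> x Sx; apply: le_trans (qle _ _ Sx Cc0) _; exact: (svalP c0).2.
  by exists (exist _ q (conj sq qp)) => c Cc; apply/asboolP => x Sx; exact: qle.
exists q => //; apply: minimal_sublinear_linear => // q' sq' qq'.
have q'p : dominated p q' by move=> x Sx; exact: le_trans (qq' _ Sx) (qp _ Sx).
have /= := qmax (exist _ q' (conj sq' q'p)); rewrite /r /= => H.
by apply/asboolP/H/asboolP.
Qed.

End MinimalSublinear.

Section Means.
Variables (R : realType) (G : topGroupType).
Implicit Types (f g : G -> R) (H : set G).

Definition bounded_fun f : Prop := exists M : R, forall x, `|f x| <= M.

(** [mean_le] contains positivity (C = 0 applied to - f) and normalization (the constants 1 and
    -1). *)
Record is_mean (I : (G -> R) -> R) : Prop := IsMean {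
  meanD : forall f g, bounded_fun f -> bounded_fun g ->
    I (fun x => f x + g x) = I f + I g;
  meanZ : forall (a : R) f, bounded_fun f -> I (fun x => a * f x) = a * I f;
  mean_le : forall f (C : R), bounded_fun f -> (forall x, f x <= C) -> I f <= C }.

Definition right_invariant H (I : (G -> R) -> R) : Prop :=
  forall y f, H y -> bounded_fun f -> I (fun x => f (x * y)%g) = I f.

Lemma bounded_funD f g : bounded_fun f -> bounded_fun g ->
  bounded_fun (fun x => f x + g x).
Proof.
move=> [M fM] [N hN]; exists (M + N) => x.
by rewrite (le_trans (ler_normD _ _))// lerD.
Qed.

Lemma bounded_funZ (a : R) f : bounded_fun f -> bounded_fun (fun x => a * f x).
Proof.
by move=> [M fM]; exists (`|a| * M) => x; rewrite normrM ler_wpM2l.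
Qed.

Lemma bounded_fun_sum (I : Type) (s : seq I) (f : I -> G -> R) :
  (forall i, bounded_fun (f i)) -> bounded_fun (fun x => \sum_(i <- s) f i x).
Proof.
move=> bf; elim: s => [|i s IHs].
  by exists 0 => x; rewrite big_nil normr0.
by under eq_fun do rewrite big_cons; exact: bounded_funD.
Qed.

Lemma bounded_fun_comp f (u : G -> G) : bounded_fun f -> bounded_fun (f \o u).
Proof. by move=> [M fM]; exists M => x; exact: fM. Qed.

Lemma sum_const_seq (T : Type) (s : seq T) (c : R) :
  \sum_(i <- s) c = c * (size s)%:R.
Proof. by rewrite big_const_seq count_predT iter_addr_0 mulr_natr. Qed.

Lemma mean0 I : is_mean I -> I (fun=> 0) = 0.
Proof.
move=> mI; have b0 : bounded_fun (fun=> 0) by exists 0 => x; rewrite normr0.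
have := meanZ mI 0 b0; under eq_fun do rewrite mul0r.
by rewrite mul0r.
Qed.

Lemma mean_sum I (T : Type) (s : seq T) (f : T -> G -> R) : is_mean I ->
  (forall i, bounded_fun (f i)) ->
  I (fun x => \sum_(i <- s) f i x) = \sum_(i <- s) I (f i).
Proof.
move=> mI bf; elim: s => [|i s IHs].
  by rewrite big_nil; under eq_fun do rewrite big_nil; exact: mean0.
rewrite big_cons -IHs -(meanD mI)//; last exact: bounded_fun_sum.
by congr I; apply/funext => x; rewrite big_cons.
Qed.

Lemma mean_norm_le I f (M : R) : is_mean I -> (forall x, `|f x| <= M) -> `|I f| <= M.
Proof.
move=> mI fM; have bf : bounded_fun f by exists M.
rewrite ler_norml; apply/andP; split; last first.
  by apply: (mean_le mI) => // x; apply: le_trans (fM x); exact: ler_norm.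
rewrite lerNl -mulN1r -(meanZ mI)//; apply: (mean_le mI).
  exact: bounded_funZ.
by move=> x; rewrite mulN1r; apply: le_trans (fM x); rewrite -normrN; exact: ler_norm.
Qed.

Lemma mean_eval (a : G) : is_mean (fun f => f a).
Proof. by split. Qed.

Section Amenable.
Variables (H D : set G) (I : (G -> R) -> R).
Hypotheses (gH : subgroup H) (mI : is_mean I) (invI : right_invariant D I)
  (commD : forall x y, H x -> H y -> D [~ x, y]%g).

Let H1 : H 1%g. Proof. by case: gH. Qed.
Let HV x : H x -> H x^-1%g.
Proof. by move=> Hx; rewrite -div1g; apply: gH.2. Qed.
Let HM x y : H x -> H y -> H (x * y)%g.
Proof. by move=> Hx Hy; rewrite -[y]invgK; apply: gH.2 => //; exact: HV. Qed.

Let phi f (y : G) : R := I (fun x => f (x * y)%g).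

(* phi f is right invariant under D, which contains the commutators of H: this
   is why the infimum of the averages of phi f below is sublinear in f. *)
Let phi_comm f y h k : bounded_fun f -> H y -> H h -> H k ->
  phi f (y * h * k)%g = phi f (y * k * h)%g.
Proof.
move=> bf Hy Hh Hk.
pose a := (y * h * y^-1)%g; pose b := (y * k * y^-1)%g.
have Ha : H a by rewrite /a; apply: HM; [exact: HM|exact: HV].
have Hb : H b by rewrite /b; apply: HM; [exact: HM|exact: HV].
have E : (y * h * k = [~ a^-1, b^-1] * (y * k * h))%g.
  have -> : (y * h * k = a * b * y)%g by rewrite /a /b !mulgA !mulgVK.
  have -> : (y * k * h = b * a * y)%g by rewrite /a /b !mulgA !mulgVK.
  by rewrite [RHS]mulgA -commgCV.
rewrite E /phi.
rewrite -(invI (y := [~ a^-1, b^-1]%g) (f := fun x => f (x * (y * k * h))%g)).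
- by congr I; apply/funext => x; rewrite mulgA.
- by apply: commD; exact: HV.
- exact: (bounded_fun_comp (fun x => x * (y * k * h))%g bf).
Qed.

Let phi_norm f y (M : R) : (forall x, `|f x| <= M) -> `|phi f y| <= M.
Proof. by move=> fM; apply: mean_norm_le. Qed.

Let phiD f g y : bounded_fun f -> bounded_fun g ->
  phi (fun x => f x + g x) y = phi f y + phi g y.
Proof.
move=> bf bg; rewrite /phi (meanD mI)//.
  exact: (bounded_fun_comp (fun x => x * y)%g bf).
exact: (bounded_fun_comp (fun x => x * y)%g bg).
Qed.

Let phiZ (a : R) f y : bounded_fun f -> phi (fun x => a * f x) y = a * phi f y.
Proof.
by move=> bf; rewrite /phi (meanZ mI)//; exact: (bounded_fun_comp (fun x => x * y)%g bf).
Qed.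

(** The numbers that bound, throughout H, some finite average of phi f over right translations by
    elements of H. A list allows repetitions, hence rational weights. The infimum p of this set is
    at most any upper bound of f, so a linear functional below p is a mean. *)
Let E f := [set c : R | exists s : seq G, [/\ s != [::], (forall h, h \in s -> H h)
  & forall y, H y -> \sum_(h <- s) phi f (y * h)%g <= c * (size s)%:R]].

Let E_lb f (M c : R) : (forall x, `|f x| <= M) -> E f c -> - M <= c.
Proof.
move=> fM [s [s0 Hs sc]]; have sz : 0 < (size s)%:R :> R.
  by rewrite ltr0n lt0n size_eq0.
rewrite -(ler_pM2r sz); apply: le_trans (sc 1%g H1).
rewrite mulNr lerNl -sumrN -sum_const_seq.
apply: ler_sum => h _; rewrite lerNl.
by have := phi_norm (1 * h)%g fM; rewrite ler_norml => /andP[].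
Qed.

Let E_ub f (M : R) : (forall x, f x <= M) -> bounded_fun f -> E f M.
Proof.
move=> fM bf; exists [:: 1%g]; split=> //.
  by move=> h; rewrite inE => /eqP ->.
move=> y Hy; rewrite big_seq1 /= mulr1; apply: (mean_le mI) => //.
exact: (bounded_fun_comp (fun x => x * (y * 1))%g bf).
Qed.

Let E_inf f : bounded_fun f -> has_inf (E f).
Proof.
move=> bf; have [M fM] := bf; split.
  by exists M; apply: E_ub => // x; apply: le_trans (fM x); exact: ler_norm.
by exists (- M) => c; exact: E_lb.
Qed.

Let p f := inf (E f).

(** Averaging over all products of s and t keeps both bounds: for g the inner average runs over t as
    it stands, for f it runs over s once [phi_comm] has exchanged the two factors. *)
Let E_add f g c d : bounded_fun f -> bounded_fun g -> E f c -> E g d ->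
  E (fun x => f x + g x) (c + d).
Proof.
move=> bf bg [s [s0 Hs sc]] [t [t0 Ht td]].
exists [seq (x * y)%g | x <- s, y <- t]; split.
- by rewrite -size_eq0 size_allpairs muln_eq0 !size_eq0 negb_or s0.
- by move=> _ /allpairsP[[x y] /= [xs yt ->]]; apply: HM; [exact: Hs|exact: Ht].
move=> y Hy; rewrite big_allpairs_dep size_allpairs natrM mulrDl.
have -> : \sum_(x <- s) \sum_(k <- t) phi (fun x => f x + g x) (y * (x * k))%g =
  \sum_(k <- t) \sum_(x <- s) phi f (y * k * x)%g +
  \sum_(x <- s) \sum_(k <- t) phi g (y * x * k)%g.
  rewrite exchange_big [X in _ + X]exchange_big -big_split /=.
  rewrite !big_seq; apply: eq_bigr => k kt.
  rewrite -big_split /= !big_seq; apply: eq_bigr => x xs.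
  by rewrite phiD// mulgA (phi_comm bf Hy (Hs _ xs) (Ht _ kt)).
apply: lerD.
  rewrite mulrA -sum_const_seq big_seq [leRHS]big_seq.
  by apply: ler_sum => k kt; apply: sc; apply: HM => //; exact: Ht.
rewrite mulrCA mulrC -sum_const_seq big_seq [leRHS]big_seq.
by apply: ler_sum => k kt; apply: td; apply: HM => //; exact: Hs.
Qed.

Let p_le f c : bounded_fun f -> E f c -> p f <= c.
Proof. by move=> bf Ec; apply: ge_inf => //; exact: (E_inf bf).2. Qed.

Let p_ge f c : bounded_fun f -> (forall d, E f d -> c <= d) -> c <= p f.
Proof. by move=> bf Hc; apply: lb_le_inf => //; exact: (E_inf bf).1. Qed.

Let S : set (G -> R^o) := [set f | bounded_fun f].

Let S0 : S 0. Proof. by exists 0 => x; rewrite normr0. Qed.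
Let SD (f g : G -> R^o) : S f -> S g -> S (f + g). Proof. exact: bounded_funD. Qed.
Let SZ (a : R) (f : G -> R^o) : S f -> S (a *: f). Proof. exact: bounded_funZ. Qed.

Let p_sublinear : sublinear_on S p.
Proof.
have pZ (b : R) f : 0 < b -> bounded_fun f -> p (fun x => b * f x) <= b * p f.
  move=> b0 bf; rewrite -ler_pdivrMl//; apply: p_ge => // d [s [s0 Hs sd]].
  rewrite ler_pdivrMl//; apply: p_le; first exact: bounded_funZ.
  exists s; split=> // y Hy; rewrite -mulrA.
  under eq_bigr do rewrite phiZ//.
  by rewrite -mulr_sumr ler_pM2l//; exact: sd.
split=> [f g bf bg|a f a0 bf].
  rewrite -lerBlDr; apply: (p_ge bf) => c Ec; rewrite lerBlDr -lerBlDl.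
  apply: (p_ge bg) => d Ed; rewrite lerBlDl.
  by apply: p_le; [exact: bounded_funD|exact: E_add].
have [->|an0] := eqVneq a 0.
  have b0 : bounded_fun (fun=> 0) by exists 0 => x; rewrite normr0.
  have -> : 0 *: f = (fun=> 0) by apply/funext => x; exact: mul0r.
  rewrite mul0r; apply/eqP; rewrite eq_le; apply/andP; split.
    by apply: (p_le b0); apply: E_ub.
  apply: (p_ge b0) => d; have := @E_lb (fun=> 0) 0 d; rewrite oppr0; apply.
  by move=> x; rewrite normr0.
have a1 : 0 < a by rewrite lt_neqAle eq_sym an0.
apply/eqP; rewrite eq_le; apply/andP; split; first exact: pZ.
rewrite -ler_pdivlMl//; apply: le_trans (pZ a^-1 _ _ _); last 2 first.
- by rewrite invr_gt0.
- exact: bounded_funZ.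
by rewrite le_eqVlt; apply/orP; left; apply/eqP; congr p; apply/funext => x; rewrite /= mulKf.
Qed.

(** Commutators of H lie in D, so modulo the invariance already obtained H acts like an abelian
    group, and averaging over powers of one element suffices: the functional p is nonpositive on f -
    f (. k), and a linear J below p inherits this. *)
Lemma amenable_step : exists2 J, is_mean J & right_invariant H J.
Proof.
have [J [JD JZ] Jp] := linear_below_sublinear S0 SD SZ p_sublinear.
have mJ : is_mean J.
  split; [exact: JD|by move=> a f; exact: JZ|].
  move=> f C bf fC; apply: le_trans (Jp _ bf) _; apply: p_le => //; exact: E_ub.
exists J => // k f Hk bf.
have bfk : bounded_fun (fun x => f (x * k)%g).
  exact: (bounded_fun_comp (fun x => x * k)%g bf).
(* averaging over 1, k, ..., k^(N-1) telescopes *)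
have key f' : bounded_fun f' -> J (fun x => f' x + (-1) * f' (x * k)%g) <= 0.
  move=> bf'; have [M fM] := bf'.
  have bfk' : bounded_fun (fun x => f' (x * k)%g).
    exact: (bounded_fun_comp (fun x => x * k)%g bf').
  have bd : bounded_fun (fun x => f' x + (-1) * f' (x * k)%g).
    by apply: bounded_funD => //; exact: bounded_funZ.
  apply: le_trans (Jp _ bd) _; apply/ler_addgt0Pl => e e0; rewrite addr0.
  have M0 : 0 <= M by apply: le_trans (fM 1%g).
  (* The telescoped sum is at most 2 M, so N > 2 M / e makes the average at most e. *)
  pose N := (Num.trunc (2 * M / e)).+1.
  have NM : 2 * M / e < N%:R by exact: truncnS_gt.
  apply: p_le => //; exists [seq (k ^+ i)%g | i <- iota 0 N]; split=> //.
    move=> _ /mapP[i _ ->]; elim: i => [|i IHi]; first by rewrite expg0.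
    by rewrite expgS; exact: HM.
  move=> y Hy; rewrite big_map size_map size_iota.
  have -> : \sum_(i <- iota 0 N) phi (fun x => f' x + (-1) * f' (x * k)%g) (y * k ^+ i)%g =
      phi f' y - phi f' (y * k ^+ N)%g.
    have -> : iota 0 N = index_iota 0 N by rewrite /index_iota subn0.
    transitivity (\sum_(0 <= i < N) (phi f' (y * k ^+ i)%g - phi f' (y * k ^+ i.+1)%g)).
      apply: eq_bigr => i _; rewrite phiD//; last exact: bounded_funZ.
      rewrite phiZ// mulN1r; congr (_ - _); rewrite /phi; congr I.
      by apply/funext => x; rewrite expgSr !mulgA.
    rewrite -[LHS]opprK -sumrN; under eq_bigr do rewrite opprB.
    by rewrite telescope_sumr// opprB expg0 mulg1.
  apply: (@le_trans _ _ (2 * M)); last by rewrite -ler_pdivrMl// mulrC ltW.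
  rewrite mulr_natl mulr2n lerD//.
    by apply: le_trans (ler_norm _) _; exact: phi_norm.
  by apply: le_trans (ler_norm _) _; rewrite normrN; exact: phi_norm.
have Jsub f' : bounded_fun f' -> bounded_fun (fun x => f' (x * k)%g) ->
    J (fun x => f' x + (-1) * f' (x * k)%g) = J f' - J (fun x => f' (x * k)%g).
  by move=> b1 b2; rewrite (meanD mJ)// ?(meanZ mJ) ?mulN1r//; exact: bounded_funZ.
(* [key] is one-sided; used for f and for - f it yields both inequalities. *)
have bnf : bounded_fun (fun x => (-1) * f x) by exact: bounded_funZ.
have bnfk : bounded_fun (fun x => (-1) * f (x * k)%g) by exact: bounded_funZ.
have := key _ bf; have := key _ bnf.
rewrite Jsub// Jsub// (meanZ mJ)// (meanZ mJ)//.
by move=> A B; apply/eqP; rewrite eq_le; apply/andP; split; lra.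
Qed.

End Amenable.

Lemma generated_subgroup_subgroup (A : set G) : subgroup (generated_subgroup A).
Proof.
split=> [H [H1 _] _//|x y gx gy H gH AH].
by apply: gH.2; [exact: gx|exact: gy].
Qed.

(** The derived series is climbed from its last term, the trivial group, under which evaluation at 1
    is invariant. Each step applies [amenable_step] with D the derived subgroup of H. *)
Lemma solvable_amenable : solvable_group G ->
  exists2 I, is_mean I & right_invariant setT I.
Proof.
have gT : subgroup [set: G] by split.
move=> [k Hk].
suff H i : (i <= k)%N -> exists2 I, is_mean I & right_invariant (iter (k - i) (@derived_subgroup G) setT) I.
  by have := H k (leqnn k); rewrite subnn.
elim: i => [|i IHi] ik.
  exists (fun f => f 1%g); first exact: mean_eval.
  by rewrite subn0 Hk => y f -> _; rewrite mulg1.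
have [I mI invI] := IHi (ltnW ik).
have E : (k - i = (k - i.+1).+1)%N by rewrite subnS prednK// subn_gt0.
rewrite E iterS in invI; apply: (amenable_step _ mI invI).
  by case: (k - i.+1)%N => [|j] //=; exact: generated_subgroup_subgroup.
by move=> x y Hx Hy K gK; apply; exists x => //; exists y.
Qed.

End Means.

(** * Sums over a discrete subgroup *)

Lemma compact_subcover (T : topologicalType) (K : set T) (U : T -> set T) :
  compact K -> (forall a, K a -> open (U a) /\ U a a) ->
  exists s : seq T, forall x, K x -> exists2 a, a \in s & U a x.
Proof.
move=> cK HU; have [[x0 _]|K0] := pselect (K !=set0); last first.
  by exists [::] => x Kx; exfalso; apply: K0; exists x.
pose pT : ptopologicalType := HB.pack (Topological.sort T) (isPointed.Build (Topological.sort T) x0).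
have cK' : @compact pT K by [].
move: cK'; rewrite compact_cover => /(_ T K U) [].
- by move=> a /HU[].
- by move=> a Ka; exists a => //; have [] := HU a Ka.
by move=> D _ KD; exists (finmap.enum_fset D) => x /KD[a /= aD Uax]; exists a.
Qed.

Section GammaSum.
Variables (R : realType) (G : topGroupType) (Gamma : set G).
Hypotheses (mulg_cont : continuous (fun p : G * G => (p.1 * p.2)%g))
  (invg_cont : continuous (fun x : G => x^-1%g))
  (dGamma : discrete_subgroup Gamma).

Let Gamma1 : Gamma 1%g. Proof. by case: dGamma => -[]. Qed.
Let GammaV x : Gamma x -> Gamma x^-1%g.
Proof. by move=> Gx; rewrite -div1g; apply: dGamma.1.2. Qed.
Let GammaM x y : Gamma x -> Gamma y -> Gamma (x * y)%g.
Proof. by move=> Gx Gy; rewrite -[y]invgK; apply: dGamma.1.2 => //; exact: GammaV. Qed.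

Lemma mulg_continuous_at (T : topologicalType) (f h : T -> G) x :
  {for x, continuous f} -> {for x, continuous h} ->
  {for x, continuous (fun y => (f y * h y)%g)}.
Proof.
move=> cf ch.
apply: (@continuous_comp _ _ _ (fun y => (f y, h y)) (fun p : G * G => (p.1 * p.2)%g)).
  exact: cvg_pair.
exact: mulg_cont.
Qed.

Lemma mulg_continuousl (a : G) : continuous (fun x => (a * x)%g).
Proof. by move=> x; apply: mulg_continuous_at; [exact: cst_continuous|exact: cvg_id]. Qed.

Lemma mulg_continuousr (a : G) : continuous (fun x => (x * a)%g).
Proof. by move=> x; apply: mulg_continuous_at; [exact: cvg_id|exact: cst_continuous]. Qed.

Lemma separating_nbhs : exists V : set G, [/\ open V, V 1%g &
  forall v w y, V v -> V w -> Gamma y -> (v * w^-1)%g = y -> y = 1%g].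
Proof.
have [_ [U [oU U1 UG]]] := dGamma.
have : nbhs ((1%g, 1%g) : G * G) (fun p => U (p.1 * p.2^-1)%g).
  have c1 : {for ((1%g, 1%g) : G * G), continuous (fun p : G * G => (p.1 * p.2^-1)%g)}.
    apply: mulg_continuous_at; first exact: cvg_fst.
    by apply: continuous_comp; [exact: cvg_snd|exact: invg_cont].
  by apply: c1; apply: open_nbhs_nbhs; split=> //=; rewrite invg1 mulg1.
move=> [[A B] /= [A1 B1] AB].
exists (interior A `&` interior B); split.
- by apply: openI; exact: open_interior.
- by split.
move=> v w y [Av _] [_ Bw] Gy vwy.
have : (U `&` Gamma) y.
  by split=> //; rewrite -vwy; apply: (AB (v, w)); split; exact: interior_subset.
by rewrite UG.
Qed.

(** K is covered by finitely many translates V a of a separating neighbourhood V. A translate V a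
    contains at most one point y x with y in Gamma, because two of them would give a nontrivial
    element of Gamma in V V^-1. Hence the bound is the number of translates, whatever x is. *)
Lemma compact_count (K : set G) : compact K -> exists N : nat, forall x : G,
  exists s : seq G, [/\ uniq s, (size s <= N)%N, forall y, y \in s -> Gamma y
    & forall y, Gamma y -> K (y * x)%g -> y \in s].
Proof.
move=> cK; have [V [oV V1 VG]] := separating_nbhs.
have [a Ka|D KD] := @compact_subcover _ K (fun a => [set x | V (x * a^-1)%g]) cK.
  split; last by rewrite /= mulgV.
  by apply: (open_comp _ oV) => x _; exact: mulg_continuousr.
exists (size D) => x.
pose P a := [set y | Gamma y /\ V (y * x * a^-1)%g].
(* Where no element of Gamma x lies in V a the default 1 is chosen; it belongs to Gamma too, so the
   list stays inside Gamma. *)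
exists (undup [seq xget 1%g (P a) | a <- D]); split.
- exact: undup_uniq.
- by rewrite (leq_trans (size_undup _))// size_map.
- move=> y; rewrite mem_undup => /mapP[a aD ->].
  by case: xgetP => [z -> [] //|_]; exact: Gamma1.
move=> y Gy Kyx; rewrite mem_undup; have [a /= aD Va] := KD _ Kyx.
apply/mapP; exists a => //.
have [z zE Pz|] := xgetP; last by move=> /(_ y) []; split.
rewrite zE; have [Gz Vz] := Pz.
have H : (y * z^-1)%g = 1%g.
  apply: (VG _ _ _ Va Vz); first exact: dGamma.1.2.
  by rewrite !invgM invgK !mulgA mulgVK mulgK.
by rewrite -[y](mulgVK z) H mul1g.
Qed.

Definition supported (K : set G) (h : G -> R) : Prop := forall x, ~ K x -> h x = 0.

(** A finitely supported sum over the possibly infinite Gamma; [gamma_sumE] makes it an honest sum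
    over a list when the support of h lies in a set K that each orbit meets finitely often. *)
Definition gamma_sum (h : G -> R) (x : G) : R := \sum_(y \in Gamma) h (y * x)%g.

Lemma gamma_sumE (K : set G) h x (s : seq G) : uniq s ->
  (forall y, y \in s -> Gamma y) -> (forall y, Gamma y -> K (y * x)%g -> y \in s) ->
  supported K h -> gamma_sum h x = \sum_(y <- s) h (y * x)%g.
Proof.
move=> us sG Ks hK; rewrite /gamma_sum (fsbigE s)//; last first.
  by move=> y Gy ys; apply: hK => Ky; move: ys; rewrite Ks.
rewrite big_seq_cond [RHS]big_seq; apply: eq_bigl => y.
by case: (boolP (y \in s)) => //= ys; rewrite mem_set//; exact: sG.
Qed.

Variables (I : (G -> R) -> R).
Hypotheses (mI : is_mean I) (invI : right_invariant setT I).

(* Stands for the integral of h over G: right invariant, and also left invariant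
   under Gamma; no Haar measure is needed. *)
Definition gamma_mean (h : G -> R) : R := I (gamma_sum h).

Lemma gamma_sum_bound (K : set G) : compact K -> exists N : nat,
  forall h (M : R), supported K h -> (forall x, `|h x| <= M) ->
  forall x, `|gamma_sum h x| <= N%:R * M.
Proof.
move=> /compact_count [N HN]; exists N => h M hK hM x.
have [s [us sN sG Ks]] := HN x.
have M0 : 0 <= M by apply: le_trans (hM x).
rewrite (gamma_sumE us sG Ks hK) (le_trans (ler_norm_sum _ _ _))//.
apply: le_trans (_ : \sum_(y <- s) M <= _); first exact: ler_sum.
by rewrite sum_const_seq mulrC ler_wpM2r// ler_nat.
Qed.

Lemma gamma_sum_bounded (K : set G) h : compact K -> supported K h ->
  bounded_fun h -> bounded_fun (gamma_sum h).
Proof.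
by move=> /gamma_sum_bound[N HN] hK [M hM]; exists (N%:R * M); exact: HN.
Qed.

Lemma gamma_mean_bound (K : set G) : compact K -> exists N : nat,
  forall h (M : R), supported K h -> (forall x, `|h x| <= M) ->
  `|gamma_mean h| <= N%:R * M.
Proof.
move=> /gamma_sum_bound[N HN]; exists N => h M hK hM.
by apply: (mean_norm_le mI) => x; exact: (HN h M hK hM x).
Qed.

Lemma gamma_meanD (K : set G) h k : compact K -> supported K h -> supported K k ->
  bounded_fun h -> bounded_fun k ->
  gamma_mean (fun x => h x + k x) = gamma_mean h + gamma_mean k.
Proof.
move=> cK hK kK bh bk; rewrite -(meanD mI); [|exact: gamma_sum_bounded hK bh|exact: gamma_sum_bounded kK bk].
congr I; apply/funext => x; have [N /(_ x)[s [us _ sG Ks]]] := compact_count cK.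
rewrite !(gamma_sumE us sG Ks)// ?big_split//.
by move=> y nKy; rewrite hK// kK// addr0.
Qed.

Lemma gamma_meanZ (K : set G) a h : compact K -> supported K h -> bounded_fun h ->
  gamma_mean (fun x => a * h x) = a * gamma_mean h.
Proof.
move=> cK hK bh; rewrite -(meanZ mI); last exact: gamma_sum_bounded hK bh.
congr I; apply/funext => x; have [N /(_ x)[s [us _ sG Ks]]] := compact_count cK.
rewrite !(gamma_sumE us sG Ks)// ?mulr_sumr//.
by move=> y nKy; rewrite hK// mulr0.
Qed.

Lemma mean_ge f (C : R) : bounded_fun f -> (forall x, C <= f x) -> C <= I f.
Proof.
move=> bf fC; rewrite -lerN2; have := meanZ mI (-1) bf; rewrite mulN1r => <-.
apply: (mean_le mI) => [|x]; first exact: bounded_funZ.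
by rewrite mulN1r lerN2.
Qed.

Lemma gamma_mean_ge0 (K : set G) h : compact K -> supported K h -> bounded_fun h ->
  (forall x, 0 <= h x) -> 0 <= gamma_mean h.
Proof.
move=> cK hK bh h0; apply: mean_ge; first exact: gamma_sum_bounded hK bh.
by move=> x; exact: fsumr_ge0.
Qed.

Lemma gamma_mean_right (K : set G) h q : compact K -> supported K h -> bounded_fun h ->
  gamma_mean (fun y => h (y * q)%g) = gamma_mean h.
Proof.
move=> cK hK bh; rewrite [RHS]/gamma_mean -(invI (y := q) (f := gamma_sum h))//; last first.
  exact: gamma_sum_bounded hK bh.
congr I; apply/funext => x; apply: eq_fsbigr => y _.
by rewrite mulgA.
Qed.

Lemma gamma_mean_left h q : Gamma q -> gamma_mean (fun y => h (q * y)%g) = gamma_mean h.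
Proof.
move=> Gq; congr I; apply/funext => x.
rewrite /gamma_sum [RHS](reindex_fsbig (fun y => (q * y)%g) Gamma Gamma).
  by apply: eq_fsbigr => y _; rewrite mulgA.
split=> [y Gy|y z _ _|y Gy]; [exact: GammaM|exact: mulgI|].
by exists (q^-1 * y)%g; [apply: GammaM => //; exact: GammaV|rewrite mulgA mulgV mul1g].
Qed.

(** To bound a mean from below one needs a bound at every point x. The assumption supplies it at one
    point of each orbit Gamma x, and nonnegativity allows the remaining terms of the sum over Gamma
    to be dropped. *)
Lemma gamma_mean_sum_ge (T : Type) (s : seq T) (K : T -> set G) (h : T -> G -> R) (e : R) :
  (forall j, compact (K j)) -> (forall j, supported (K j) (h j)) ->
  (forall j, bounded_fun (h j)) -> (forall j x, 0 <= h j x) ->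
  (forall x, exists2 y, Gamma y & e <= \sum_(j <- s) h j (y * x)%g) ->
  e <= \sum_(j <- s) gamma_mean (h j).
Proof.
move=> cK hK bh h0 He; rewrite /gamma_mean -(mean_sum s mI); last first.
  by move=> j; exact: gamma_sum_bounded (hK j) (bh j).
apply: mean_ge => [|x].
  by apply: bounded_fun_sum => j; exact: gamma_sum_bounded (hK j) (bh j).
have [y Gy ey] := He x; apply: le_trans ey _; apply: ler_sum => j _.
have [N /(_ x)[r [ur _ rG Kr]]] := compact_count (cK j).
rewrite (gamma_sumE ur rG Kr)//.
have [Kyx|nK] := pselect (K j (y * x)%g); last by rewrite hK// sumr_ge0.
by rewrite (bigD1_seq y)//= ?Kr// lerDl sumr_ge0.
Qed.

End GammaSum.

(** * Invariant frames in coordinates *)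

Section AffineSlices.
Variables (R : realType).

Lemma is_derive_affine m p (W : normedModType R) (F : 'rV[R]_p -> W) (A : 'M[R]_(m, p))
    (b : 'rV[R]_p) (x v : 'rV[R]_m) (l : W) :
  is_derive (x *m A + b) (v *m A) F l -> is_derive x v (fun y => F (y *m A + b)) l.
Proof.
move=> /is_derive_epsP H; apply/is_derive_epsP => e /H[d d0 Hd]; exists d => // k kd.
have -> : (k *: v + x) *m A + b = k *: (v *m A) + (x *m A + b).
  by rewrite mulmxDl -scalemxAl addrA.
exact: Hd.
Qed.

Lemma row_mx_affinel m p (u : 'rV[R]_m) (v : 'rV[R]_p) :
  row_mx u v = u *m row_mx 1%:M 0 + row_mx 0 v.
Proof. by rewrite mul_mx_row mulmx1 mulmx0 add_row_mx addr0 add0r. Qed.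

Lemma row_mx_affiner m p (u : 'rV[R]_m) (v : 'rV[R]_p) :
  row_mx u v = v *m row_mx 0 1%:M + row_mx u 0.
Proof. by rewrite mul_mx_row mulmx1 mulmx0 add_row_mx addr0 add0r. Qed.

Lemma is_derive_slicel m p (W : normedModType R) (F : 'rV[R]_(m + p) -> W) u v (x : 'rV[R]_m) l :
  is_derive (row_mx u v) (row_mx x 0) F l -> is_derive u x (fun y => F (row_mx y v)) l.
Proof.
move=> H; have -> : (fun y => F (row_mx y v)) = (fun y => F (y *m row_mx 1%:M 0 + row_mx 0 v)).
  by apply/funext => y; rewrite -row_mx_affinel.
by apply: is_derive_affine; rewrite -row_mx_affinel mul_mx_row mulmx1 mulmx0.
Qed.

Lemma is_derive_slicer m p (W : normedModType R) (F : 'rV[R]_(m + p) -> W) u v (x : 'rV[R]_p) l :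
  is_derive (row_mx u v) (row_mx 0 x) F l -> is_derive v x (fun y => F (row_mx u y)) l.
Proof.
move=> H; have -> : (fun y => F (row_mx u y)) = (fun y => F (y *m row_mx 0 1%:M + row_mx u 0)).
  by apply/funext => y; rewrite -row_mx_affiner.
by apply: is_derive_affine; rewrite -row_mx_affiner mul_mx_row mulmx1 mulmx0.
Qed.

Lemma Ck_on_slicel m p (q : nat) k (U : set 'rV[R]_m) (W : set 'rV[R]_(m + p))
    (F : 'rV[R]_(m + p) -> 'rV[R]_q) (v : 'rV[R]_p) :
  open U -> open W -> (forall u, U u -> W (row_mx u v)) ->
  Ck_on k W F -> Ck_on k U (fun u => F (row_mx u v)).
Proof.
move=> oU oW UW CF; apply: (@Ck_on_comp_row _ _ _ _ _ U W F (fun u => row_mx u v)) => //.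
apply: Ck_on_ext (Ck_on_affine k U (row_mx 1%:M 0) (row_mx 0 v)) => // u _.
by rewrite -row_mx_affinel.
Qed.

Lemma Ck_on_slicer m p (q : nat) k (U : set 'rV[R]_p) (W : set 'rV[R]_(m + p))
    (F : 'rV[R]_(m + p) -> 'rV[R]_q) (u : 'rV[R]_m) :
  open U -> open W -> (forall v, U v -> W (row_mx u v)) ->
  Ck_on k W F -> Ck_on k U (fun v => F (row_mx u v)).
Proof.
move=> oU oW UW CF; apply: (@Ck_on_comp_row _ _ _ _ _ U W F (fun v => row_mx u v)) => //.
apply: Ck_on_ext (Ck_on_affine k U (row_mx 0 1%:M) (row_mx u 0)) => // v _.
by rewrite -row_mx_affiner.
Qed.

Lemma Ck_on_det m p k (U : set 'rV[R]_m) (M : 'rV[R]_m -> 'M[R]_p) :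
  open U -> (forall i j, Ck_on k U (fun x => M x i j)) -> Ck_on k U (fun x => \det (M x)).
Proof.
move=> oU CM; apply: Ck_on_sum => // s; apply: Ck_onM => //; first exact: Ck_on_cst.
by apply: Ck_on_prod.
Qed.

Lemma Ck_on_invmx m p k (U : set 'rV[R]_m) (M : 'rV[R]_m -> 'M[R]_p) i j :
  open U -> (forall i j, Ck_on k U (fun x => M x i j)) ->
  (forall x, U x -> \det (M x) != 0) -> Ck_on k U (fun x => invmx (M x) i j).
Proof.
move=> oU CM d0; apply: (@Ck_on_ext _ _ _ _ _ (fun x => (\det (M x))^-1 * ((-1) ^+ (j + i) *
   \det (row' j (col' i (M x)))))) => //.
  by move=> x Ux; rewrite /invmx unitmxE unitfE d0// !mxE.
apply: Ck_onM => //; first by apply: Ck_onV => //; exact: Ck_on_det.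
apply: Ck_onM => //; first exact: Ck_on_cst.
apply: Ck_on_det => // a b; apply: Ck_on_ext (CM (lift j a) (lift i b)) => //.
by move=> x _; rewrite !mxE.
Qed.

End AffineSlices.

(** * The group law near the identity and the divergence of a right invariant field *)

Section DivergenceField.
Variables (R : realType) (m : nat) (Mu : 'rV[R]_(m + m) -> 'rV[R]_m).
Variables (W : set 'rV[R]_(m + m)) (B : set 'rV[R]_m) (u0 w : 'rV[R]_m).
Hypotheses (oW : open W) (oB : open B) (Bu0 : B u0).
Hypotheses (BW : forall u v, B u -> B v -> W (row_mx u v)).
Hypotheses (CMu : Ck_on 2 W Mu).
Hypotheses (Mu1 : forall v, B v -> Mu (row_mx u0 v) = v)
           (Mu2 : forall u, B u -> Mu (row_mx u u0) = u).

(** [Mu] stands for the group law in a chart, u0 for the coordinates of 1. Differentiating in the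
    second argument at u0 gives the left invariant field with value x at u0; differentiating in the
    first argument gives the right invariant one. *)
Definition left_frame (u x : 'rV[R]_m) : 'rV[R]_m := 'D_(row_mx 0 x) Mu (row_mx u u0).
Definition right_frame (u x : 'rV[R]_m) : 'rV[R]_m := 'D_(row_mx x 0) Mu (row_mx u0 u).

Let WB1 u : B u -> W (row_mx u u0). Proof. by move=> Bu; exact: BW. Qed.
Let WB2 u : B u -> W (row_mx u0 u). Proof. by move=> Bu; exact: BW. Qed.

Lemma Ck_on_left_frame x : Ck_on 1 B (left_frame ^~ x).
Proof. exact: (@Ck_on_slicel _ _ _ _ _ B W ('D_(row_mx 0 x) Mu) u0 oB oW WB1 (Ck_on_derive _ CMu)). Qed.

Lemma Ck_on_right_frame x : Ck_on 1 B (right_frame ^~ x).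
Proof. exact: (@Ck_on_slicer _ _ _ _ _ B W ('D_(row_mx x 0) Mu) u0 oB oW WB2 (Ck_on_derive _ CMu)). Qed.

Let near_id (f : 'rV[R]_m -> 'rV[R]_m) (x l : 'rV[R]_m) :
  (forall v, B v -> f v = v) -> is_derive u0 x f l -> l = x.
Proof.
move=> fid /is_deriveE <-; rewrite -[RHS](derive_id u0 x).
by apply: near_eq_derive; exact: (open_near_eq oB fid Bu0).
Qed.

Lemma left_frame1 x : left_frame u0 x = x.
Proof.
apply: (near_id Mu1); apply: is_derive_slicer; apply: derivableP.
exact: (Ck_on_derivable CMu (WB1 Bu0)).
Qed.

Lemma right_frame1 x : right_frame u0 x = x.
Proof.
apply: (near_id Mu2); apply: is_derive_slicel; apply: derivableP.
exact: (Ck_on_derivable CMu (WB2 Bu0)).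
Qed.

Let Lm (u : 'rV[R]_m) : 'M[R]_m := \matrix_(i, j) (left_frame u 'e_i) 0 j.

Let CLm i j : Ck_on 1 B (fun u => Lm u i j).
Proof.
apply: Ck_on_ext ((Ck_on_rowP _ _ oB).1 (Ck_on_left_frame 'e_i) j) => // u _.
by rewrite mxE.
Qed.

(** [Lm] is the identity at u0, so the left frame is still a basis on this open neighbourhood of
    u0. *)
Let B' := [set u | B u /\ \det (Lm u) != 0].

Let Lm1 : Lm u0 = 1%:M.
Proof. by apply/matrixP => i j; rewrite !mxE left_frame1 !mxE eqxx eq_sym. Qed.

Let cdet u : B u -> {for u, continuous (fun u => \det (Lm u))}.
Proof. by move=> Bu; apply: (Ck_on_continuous (Ck_on_det oB CLm) Bu). Qed.

Let oB' : open B'.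
Proof.
rewrite openE => u [Bu du]; apply: filterI; first exact: open_nbhs_nbhs.
have : nbhs (\det (Lm u)) [set d : R | d != 0].
  by apply: open_nbhs_nbhs; split => //; exact: open_neq.
exact: (cdet Bu).
Qed.

Let B'u0 : B' u0.
Proof. by split=> //; rewrite Lm1 det1 oner_neq0. Qed.

Definition right_in_left (u : 'rV[R]_m) : 'rV[R]_m := right_frame u w *m invmx (Lm u).

Lemma Ck_on_right_in_left : Ck_on 1 B' right_in_left.
Proof.
have B'B : B' `<=` B by move=> u [].
apply/Ck_on_rowP => // j.
have -> : (fun u => right_in_left u 0 j) =
   (fun u => \sum_i right_frame u w 0 i * invmx (Lm u) i j).
  by apply/funext => u; rewrite mxE.
apply: Ck_on_sum => // i; apply: Ck_onM => //.
  by apply: (Ck_on_subset B'B); exact: (Ck_on_rowP _ _ oB).1 (Ck_on_right_frame w) i.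
apply: Ck_on_invmx => //; last by move=> x [].
by move=> a b; apply: (Ck_on_subset B'B).
Qed.

Lemma right_in_leftE u : B' u ->
  right_frame u w = \sum_i right_in_left u 0 i *: left_frame u 'e_i.
Proof.
move=> [Bu du]; have -> : right_frame u w = right_in_left u *m Lm u.
  by rewrite /right_in_left mulmxKV// unitmxE unitfE.
rewrite mulmx_sum_row; apply: eq_bigr => i _; congr (_ *: _).
by apply/rowP => j; rewrite !mxE.
Qed.

(* The right invariant field of w is written in the left invariant frame; the
   divergence of its coefficients with respect to this frame is tr (ad w) at u0. *)
Definition divergence (u : 'rV[R]_m) : R :=
  \sum_i 'D_(left_frame u 'e_i) (fun v => right_in_left v 0 i) u.

Let Cb i : Ck_on 1 B' (fun v => right_in_left v 0 i).
Proof. exact: (Ck_on_rowP _ _ oB').1 Ck_on_right_in_left i. Qed.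

Lemma divergence_continuous : {for u0, continuous divergence}.
Proof.
pose d u : R := \sum_i \sum_j left_frame u 'e_i 0 j * 'D_('e_j) (fun v => right_in_left v 0 i) u.
apply: (@near_eq_continuous_at _ _ d).
  apply: (open_near_eq oB') B'u0 => u Bu; apply: eq_bigr => i _.
  by rewrite (Ck_on_derive_sum _ oB' (Cb i)).
apply: continuous_at_sum => i; apply: continuous_at_sum => j; apply: continuous_atM.
  exact: (Ck_on_continuous ((Ck_on_rowP _ _ oB).1 (Ck_on_left_frame 'e_i) j) Bu0).
exact: (Ck_on_continuous (Ck_on_derive 'e_j (Cb i)) B'u0).
Qed.

Let D2 (x y : 'rV[R]_(m + m)) (i : 'I_m) := 'D_x ('D_y (fun z => Mu z 0 i)) (row_mx u0 u0).

Let CMui i : Ck_on 2 W (fun z => Mu z 0 i).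
Proof. exact: (Ck_on_rowP _ _ oW).1 CMu i. Qed.

Let W0 : W (row_mx u0 u0). Proof. exact: BW. Qed.

Lemma left_frame_coord u x i : B u ->
  left_frame u x 0 i = 'D_(row_mx 0 x) (fun z => Mu z 0 i) (row_mx u u0).
Proof. by move=> Bu; rewrite derive_row//; exact: (Ck_on_derivable CMu (WB1 Bu)). Qed.

Lemma right_frame_coord u x i : B u ->
  right_frame u x 0 i = 'D_(row_mx x 0) (fun z => Mu z 0 i) (row_mx u0 u).
Proof. by move=> Bu; rewrite derive_row//; exact: (Ck_on_derivable CMu (WB2 Bu)). Qed.

Lemma derive_left_frame x y i :
  is_derive u0 y (fun u => left_frame u x 0 i) (D2 (row_mx y 0) (row_mx 0 x) i).
Proof.
apply: (near_eq_is_derive (f := fun u => 'D_(row_mx 0 x) (fun z => Mu z 0 i) (row_mx u u0))).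
  by apply: (open_near_eq oB) Bu0 => u Bu; rewrite left_frame_coord.
apply: (@is_derive_slicel _ _ _ _ ('D_(row_mx 0 x) (fun z => Mu z 0 i))).
by apply: derivableP; exact: (Ck_on_derivable (Ck_on_derive _ (CMui i)) W0).
Qed.

Lemma derive_right_frame x y i :
  is_derive u0 y (fun u => right_frame u x 0 i) (D2 (row_mx 0 y) (row_mx x 0) i).
Proof.
apply: (near_eq_is_derive (f := fun u => 'D_(row_mx x 0) (fun z => Mu z 0 i) (row_mx u0 u))).
  by apply: (open_near_eq oB) Bu0 => u Bu; rewrite right_frame_coord.
apply: (@is_derive_slicer _ _ _ _ ('D_(row_mx x 0) (fun z => Mu z 0 i))).
by apply: derivableP; exact: (Ck_on_derivable (Ck_on_derive _ (CMui i)) W0).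
Qed.

(** Differentiate R_w = sum_j b_j L_j at u0 along e_i, where R_w is the right invariant field, L_j
    the left frame and b its coefficients: the derivative of b_i becomes a difference of second
    derivatives of [Mu], each with one direction in either argument. After exchanging the order of
    differentiation in one of them, the i-th summand is the i-th coordinate of the bracket of w and
    e_i, in the form given by [bracket_frame]. *)
Lemma divergence1 : divergence u0 =
  \sum_i (D2 (row_mx w 0) (row_mx 0 'e_i) i - D2 (row_mx 'e_i 0) (row_mx 0 w) i).
Proof.
apply: eq_bigr => i _; rewrite left_frame1.
have bw : right_in_left u0 = w.
  by rewrite /right_in_left Lm1 invmx1 mulmx1 right_frame1.
have db j : is_derive u0 'e_i (fun v => right_in_left v 0 j) ('D_('e_i) (fun v => right_in_left v 0 j) u0).
  by apply: derivableP; exact: (Ck_on_derivable (Cb j) B'u0).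
have E : is_derive u0 'e_i (fun u => \sum_j right_in_left u 0 j * left_frame u 'e_j 0 i)
   (\sum_j (w 0 j * D2 (row_mx 'e_i 0) (row_mx 0 'e_j) i +
            (j == i)%:R * 'D_('e_i) (fun v => right_in_left v 0 j) u0)).
  elim: (index_enum _) => [|j s IHs].
    rewrite big_nil; under eq_fun do rewrite big_nil; exact: is_derive_cst.
  rewrite big_cons; under eq_fun do rewrite big_cons.
  apply: is_deriveD => //.
  have := is_deriveM (db j) (derive_left_frame 'e_j 'e_i i).
  by rewrite bw left_frame1 mxE eqxx eq_sym.
(* The same function is a coordinate of the right invariant field, whose derivative is known
   directly; equating the two results isolates the derivative of b_i. *)
have E2 : is_derive u0 'e_i (fun u => \sum_j right_in_left u 0 j * left_frame u 'e_j 0 i)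
    (D2 (row_mx 0 'e_i) (row_mx w 0) i).
  apply: (near_eq_is_derive (f := fun u => right_frame u w 0 i)); last exact: derive_right_frame.
  apply: (open_near_eq oB') B'u0 => u Bu; rewrite (right_in_leftE Bu) summxE.
  by apply: eq_bigr => j _; rewrite mxE.
have := is_deriveE E; rewrite (is_deriveE E2) big_split /=.
rewrite [X in _ = _ + X](bigD1 i)//= eqxx mul1r [X in _ = _ + (_ + X)]big1 ?addr0; last first.
  by move=> j /negbTE ->; rewrite mul0r.
have -> : \sum_j w 0 j * D2 (row_mx 'e_i 0) (row_mx 0 'e_j) i = D2 (row_mx 'e_i 0) (row_mx 0 w) i.
  rewrite -(is_deriveE (derive_left_frame w 'e_i i)).
  apply/esym/is_deriveE.
  apply: (near_eq_is_derive (f := fun u => \sum_j w 0 j * left_frame u 'e_j 0 i)).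
    apply: (open_near_eq oB) Bu0 => u Bu; rewrite [RHS](left_frame_coord w i Bu).
    rewrite (Ck_on_derive_sum _ oW (CMui i) (WB1 Bu)) big_split_ord /= [X in _ = X + _]big1 ?add0r.
      apply: eq_bigr => j _; rewrite row_mxEr (left_frame_coord _ _ Bu); congr (_ * _).
      congr (derive _ _ _); apply/rowP => l.
      case: (split_ordP l) => a ->; rewrite ?row_mxEl ?row_mxEr !mxE ?eqxx.
        by rewrite eq_lrshift.
      by rewrite eq_rshift.
    by move=> j _; rewrite row_mxEl mxE mul0r.
  elim: (index_enum _) => [|j s IHs].
    rewrite big_nil; under eq_fun do rewrite big_nil; exact: is_derive_cst.
  rewrite big_cons; under eq_fun do rewrite big_cons.
  exact: (is_deriveD (is_deriveZ (w 0 j) (derive_left_frame 'e_j 'e_i i)) IHs).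
have -> : D2 (row_mx w 0) (row_mx 0 'e_i) i = D2 (row_mx 0 'e_i) (row_mx w 0) i.
  apply: (schwarz oW W0) => [y v Wy|y Wy|y Wy||].
  - exact: (Ck_on_derivable (CMui i) Wy).
  - exact: (Ck_on_derivable (Ck_on_derive _ (CMui i)) Wy).
  - exact: (Ck_on_derivable (Ck_on_derive _ (CMui i)) Wy).
  - exact: (Ck_on_continuous (Ck_on_derive _ (Ck_on_derive _ (CMui i))) W0).
  - exact: (Ck_on_continuous (Ck_on_derive _ (Ck_on_derive _ (CMui i))) W0).
by move=> ->; rewrite addrAC subrr add0r.
Qed.

Lemma right_in_left_nbhd : exists B1 : set 'rV[R]_m,
  [/\ open B1, B1 u0 & B1 `<=` B] /\
  [/\ Ck_on 1 B1 right_in_left,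
      forall u, B1 u -> right_frame u w = \sum_i right_in_left u 0 i *: left_frame u 'e_i
    & {for u0, continuous divergence}].
Proof.
exists B'; split; first by split=> // u [].
split; [exact: Ck_on_right_in_left|exact: right_in_leftE|exact: divergence_continuous].
Qed.

End DivergenceField.

Section Charts.
Variables (R : realType).

Section OneChart.
Variables (K : numFieldType) (m : nat) (X : topologicalType) (c : chart K m X).
Hypothesis hc : is_chart c.

Lemma crangeP u : crange c u -> cdom c (cinv c u) /\ cmap c (cinv c u) = u.
Proof. by move=> [x cx <-]; rewrite (chart_mapK hc). Qed.

Lemma cdom_crange x : cdom c x -> crange c (cmap c x).
Proof. by move=> cx; exists x. Qed.

Lemma chart_imageE (O : set X) :
  cmap c @` (cdom c `&` O) = crange c `&` cinv c @^-1` O.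
Proof.
apply/seteqP; split=> [_ [x [cx Ox] <-]|u [cu Ou]].
  by split; [exact: cdom_crange|rewrite /= (chart_mapK hc)].
by have [d e] := crangeP cu; exists (cinv c u).
Qed.

Lemma chart_image_open (O : set X) : open O -> open (cmap c @` (cdom c `&` O)).
Proof.
move=> oO; rewrite chart_imageE openE => u [cu Ou]; apply: filterI.
  by apply: open_nbhs_nbhs; split=> //; exact: chart_open_range.
by apply: (chart_inv_continuous hc cu); exact: open_nbhs_nbhs.
Qed.

Lemma chart_preimage_open (D : set 'rV[K]_m) :
  open D -> open (cdom c `&` cmap c @^-1` D).
Proof.
move=> oD; rewrite openE => x [cx Dx]; apply: filterI.
  by apply: open_nbhs_nbhs; split=> //; exact: chart_open.
by apply: (chart_map_continuous hc cx); exact: open_nbhs_nbhs.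
Qed.

End OneChart.

Lemma lsubmx_continuous (K : numFieldType) m k : continuous (@lsubmx K 1 m k).
Proof.
move=> /= w A /nbhs_ballP [e /= e0 eA]; apply/nbhs_ballP; exists e => //= w' [_ ww'].
by apply: eA; split=> // i j; rewrite !mxE; exact: ww'.
Qed.

Lemma rsubmx_continuous (K : numFieldType) m k : continuous (@rsubmx K 1 m k).
Proof.
move=> /= w A /nbhs_ballP [e /= e0 eA]; apply/nbhs_ballP; exists e => //= w' [_ ww'].
by apply: eA; split=> // i j; rewrite !mxE; exact: ww'.
Qed.

Lemma row_mx_continuous_at (K : numFieldType) m k (T : topologicalType)
    (f : T -> 'rV[K]_m) (h : T -> 'rV[K]_k) x :
  {for x, continuous f} -> {for x, continuous h} ->
  {for x, continuous (fun y => row_mx (f y) (h y))}.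
Proof.
move=> cf ch A /nbhs_ballP [e /= e0 eA].
have nf : nbhs x (fun y => ball (f x) e (f y)) by apply: cf; exact: nbhsx_ballx.
have nh : nbhs x (fun y => ball (h x) e (h y)) by apply: ch; exact: nbhsx_ballx.
apply: filterS2 nf nh => y [_ fy] [_ hy]; apply: eA; split=> // i j /=.
by case: (split_ordP j) => a ->; rewrite ?row_mxEl ?row_mxEr; [exact: fy|exact: hy].
Qed.

Lemma continuous_at_pair (T S S' : topologicalType) (f : T -> S) (h : T -> S') x :
  {for x, continuous f} -> {for x, continuous h} ->
  {for x, continuous (fun y => (f y, h y))}.
Proof. by move=> cf ch; apply: cvg_pair. Qed.

Section ProdChart.
Variables (K : numFieldType) (m k : nat) (X Y : topologicalType).
Variables (c : chart K m X) (d : chart K k Y).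
Hypotheses (hc : is_chart c) (hd : is_chart d).

Lemma prod_crangeE : crange (prod_chart c d) =
  [set w | crange c (lsubmx w) /\ crange d (rsubmx w)].
Proof.
apply/seteqP; split=> [_ [[x y] [/= cx dy] <-]|w [[x cx xw] [y dy yw]]].
  by split; rewrite /= ?row_mxKl ?row_mxKr; [exists x|exists y].
by exists (x, y) => //=; rewrite xw yw hsubmxK.
Qed.

Lemma prod_chart_is_chart : is_chart (prod_chart c d).
Proof.
split.
- rewrite openE => -[x y] [/= cx dy].
  exists (cdom c, cdom d) => //=.
  by split; apply: open_nbhs_nbhs; split=> //; exact: chart_open.
- rewrite prod_crangeE openE => w [cw dw]; apply: filterI.
    apply: (@lsubmx_continuous K m k w).
    by apply: open_nbhs_nbhs; split=> //; exact: chart_open_range.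
  apply: (@rsubmx_continuous K m k w).
  by apply: open_nbhs_nbhs; split=> //; exact: chart_open_range.
- by move=> [x y] [/= cx dy]; rewrite row_mxKl row_mxKr !chart_mapK.
- move=> [x y] [/= cx dy]; apply: row_mx_continuous_at.
    apply: continuous_comp; first exact: cvg_fst.
    exact: chart_map_continuous.
  apply: continuous_comp; first exact: cvg_snd.
  exact: chart_map_continuous.
- rewrite prod_crangeE => w [cw dw]; apply: continuous_at_pair.
    apply: (@continuous_comp _ _ _ (@lsubmx K 1 m k) (cinv c) w); first exact: lsubmx_continuous.
    exact: chart_inv_continuous.
  apply: (@continuous_comp _ _ _ (@rsubmx K 1 m k) (cinv d) w); first exact: rsubmx_continuous.
  exact: chart_inv_continuous.
Qed.

End ProdChart.

Lemma norm_row_mx_lt m k (a : 'rV[R]_m) (b : 'rV[R]_k) (e : R) :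
  0 < e -> `|a| < e -> `|b| < e -> `|row_mx a b| < e.
Proof.
move=> e0 ae be; rewrite [ltLHS]/Num.Def.normr/= mx_normrE.
apply: bigmax_lt => // -[i j] _ /=; rewrite ord1.
by case: (split_ordP j) => l ->; rewrite ?row_mxEl ?row_mxEr;
  [apply: le_lt_trans ae|apply: le_lt_trans be]; exact: coord_le_norm.
Qed.

End Charts.

Section UniformDerivative.
Variables (R : realType) (V : normedModType R) (W : set V) (H : V -> R) (a : V).
Hypotheses (oW : open W) (dH : forall z, W z -> derivable H z a)
  (cH : forall z, W z -> {for z, continuous ('D_a H)}).

Lemma uniform_derive z1 (e : R) : W z1 -> 0 < e -> exists2 d : R, 0 < d &
  forall z (t : R), `|z1 - z| < d -> `|t| < d ->
    `|H (z + t *: a) - H z - t * 'D_a H z| <= e * `|t|.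
Proof.
move=> Wz1 e0; have e2 : 0 < e / 2 by rewrite divr_gt0.
have : nbhs z1 (fun y => W y /\ `|'D_a H z1 - 'D_a H y| <= e / 2).
  apply: filterI; first exact: open_nbhs_nbhs.
  by have /cvgrPdist_le := cH Wz1; apply.
move=> /nbhs_ex_ball [d d0 Hd].
have N : 0 < `|a| + 1 by rewrite ltr_wpDl.
have d2 : 0 < d / 2 by rewrite divr_gt0.
exists (Num.min (d / 2) (d / 2 / (`|a| + 1))).
  by rewrite lt_min d2 divr_gt0.
move=> z t; rewrite !lt_min => /andP[z1z _] /andP[_ td].
have near k : 0 <= k <= 1 -> `|z1 - (z + k *: (t *: a))| < d.
  move=> /andP[k0 k1]; rewrite opprD addrA (le_lt_trans (ler_normB _ _))//.
  rewrite [d]splitr ltr_leD// !normrZ ger0_norm//.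
  apply: le_trans (_ : `|t| * (`|a| + 1) <= _); last by rewrite -ler_pdivlMr// ltW.
  rewrite (@le_trans _ _ (`|t| * `|a|))//; first by rewrite ler_piMl// mulr_ge0.
  by rewrite ler_wpM2l// lerDl.
have [k k01 E] := @MVT_along R V H z (t *: a)
  (fun k k01 => is_derive_derivable (is_deriveZv t (derivableP (dH (Hd _ (near k k01)).1)))).
have [Wk Dk] := Hd _ (near k k01).
have [Wz Dz] : W z /\ `|'D_a H z1 - 'D_a H z| <= e / 2.
  by apply: Hd; apply: (lt_trans z1z); rewrite ltr_pdivrMr// ltr_pMr// ltr1n.
rewrite E (is_deriveE (is_deriveZv t (derivableP (dH Wk)))) -mulrBr normrM mulrC.
rewrite ler_wpM2r// -(subrKA ('D_a H z1)) (le_trans (ler_normD _ _))//.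
by rewrite [e]splitr lerD// distrC.
Qed.

(** Near each point the mean value theorem gives one range of t; compactness makes it common to all
    of C. The map [emb] is there because C will be a ball in one factor of the product on which H is
    defined. *)
Lemma uniform_derive_compact (T : topologicalType) (C : set T) (emb : T -> V) (e : R) :
  compact C -> (forall u, C u -> {for u, continuous emb}) ->
  (forall u, C u -> W (emb u)) -> 0 < e ->
  \forall t \near (0 : R), forall u, C u ->
    `|H (emb u + t *: a) - H (emb u) - t * 'D_a H (emb u)| <= e * `|t|.
Proof.
move=> cC cemb Wemb e0; move: cC; rewrite compact_near_coveringP.
move=> /(_ R (nbhs (0 : R)) (fun t u => `|H (emb u + t *: a) - H (emb u) - t * 'D_a H (emb u)| <= e * `|t|) _).
apply=> u Cu; have [d d0 Hd] := uniform_derive (Wemb u Cu) e0.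
have n1 : \forall u' \near u, `|emb u - emb u'| < d.
  by have /cvgrPdist_lt := cemb u Cu; apply.
have n2 : \forall t \near (0 : R), `|t| < d.
  by apply/nbhs_ballP; exists d => // t; rewrite -ball_normE /= sub0r normrN.
by exists ([set u' | `|emb u - emb u'| < d], [set t | `|t| < d]) => // -[u' t] [/= A B]; exact: Hd.
Qed.

End UniformDerivative.

(** * Derivatives and integration by parts for the mean over Gamma-orbits *)

Section LocalFunctional.
Variables (R : realType) (m : nat) (G : topGroupType) (Gamma : set G) (c : chart R m G).
Hypotheses (mulg_cont : continuous (fun p : G * G => (p.1 * p.2)%g))
  (invg_cont : continuous (fun x : G => x^-1%g))
  (dGamma : discrete_subgroup Gamma).
Variables (I : (G -> R) -> R).
Hypotheses (mI : is_mean I) (invI : right_invariant setT I).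
Hypotheses (hc : is_chart c) (c1 : cdom c 1%g).

Let u0 := cmap c 1%g.

Definition local_mul (z : 'rV[R]_(m + m)) : 'rV[R]_m :=
  cmap c (cinv c (lsubmx z) * cinv c (rsubmx z))%g.

Variables (W : set 'rV[R]_(m + m)) (rho s r : R).
Hypotheses (oW : open W) (r0 : 0 < r) (rs : r < s) (srho : s < rho).
Hypotheses (BW : forall u v, `|u0 - u| < rho -> `|u0 - v| < rho -> W (row_mx u v)).
Hypotheses (Wmul : forall z, W z -> [/\ crange c (lsubmx z), crange c (rsubmx z)
  & cdom c (cinv c (lsubmx z) * cinv c (rsubmx z))%g]).
Hypothesis (CMu : Ck_on 2 W local_mul).

Let Mu := local_mul.
Definition coord_ball (t : R) : set 'rV[R]_m := [set u | `|u0 - u| < t].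

Lemma open_coord_ball t : open (coord_ball t).
Proof.
have -> : coord_ball t = ball_ Num.norm u0 t by [].
rewrite openE => u /= ut; apply/nbhs_ballP; exists (t - `|u0 - u|) => /=.
  by rewrite subr_gt0.
move=> v; rewrite -ball_normE /= => uv.
rewrite /ball_ /= -(subrKA u) (le_lt_trans (ler_normD _ _))//.
by rewrite -ltrBrDl.
Qed.

Let rho0 : 0 < rho. Proof. by rewrite (lt_trans r0)// (lt_trans rs). Qed.
Let s0 : 0 < s. Proof. by rewrite (lt_trans r0). Qed.

Let u0B t : 0 < t -> coord_ball t u0.
Proof. by move=> t0; rewrite /coord_ball /= subrr normr0. Qed.

Lemma coord_ball_crange u : coord_ball rho u -> crange c u.
Proof.
move=> Bu; have [+ _ _] := Wmul (BW Bu (u0B rho0)).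
by rewrite row_mxKl.
Qed.

Let cinv0 : cinv c u0 = 1%g. Proof. exact: chart_mapK. Qed.

Definition chart_ball (t : R) : set G := [set y | cdom c y /\ `|u0 - cmap c y| <= t].

Lemma chart_ballE t : t < rho ->
  chart_ball t = cinv c @` [set u | `|u0 - u| <= t].
Proof.
move=> tr; apply/seteqP; split=> [y [cy yt]|_ [u /= ut <-]].
  by exists (cmap c y) => //; exact: chart_mapK.
have [|d e] := crangeP hc (_ : crange c u).
  by apply: coord_ball_crange; exact: le_lt_trans tr.
by split=> //; rewrite e.
Qed.

Let compact_coords t : compact [set u : 'rV[R]_m | `|u0 - u| <= t].
Proof.
have -> : [set u : 'rV[R]_m | `|u0 - u| <= t] = closed_ball_ Num.norm u0 t by [].
apply: bounded_closed_compact; last exact: closed_closed_ball_.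
exists (`|u0| + t); split; first exact: num_real.
move=> M tM u /= ut; apply: le_trans (ltW tM).
rewrite -[u](subKr u0) (le_trans (ler_normB _ _))// lerD2l.
exact: ut.
Qed.

Lemma chart_ball_compact t : t < rho -> compact (chart_ball t).
Proof.
move=> tr; rewrite chart_ballE//; apply: continuous_compact => //.
rewrite continuous_subspace_in => u; rewrite inE /= => ut.
apply: continuous_subspaceT_for => //.
apply: chart_inv_continuous => //; apply: coord_ball_crange.
exact: le_lt_trans tr.
Qed.

Definition chart_interior (t : R) : set G := cdom c `&` cmap c @^-1` (coord_ball t).

Lemma open_chart_interior t : open (chart_interior t).
Proof. by apply: chart_preimage_open => //; exact: open_coord_ball. Qed.

(** The gap between r and s absorbs small translations: by compactness of the ball of radius r,
    functions supported there remain, after a small translation, supported in one fixed compact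
    ball. *)
Lemma chart_tube_left : \forall q \near (1%g : G), forall y, chart_ball r (q * y)%g -> chart_ball s y.
Proof.
have rr : r < rho by rewrite (lt_trans rs).
have := chart_ball_compact rr; rewrite compact_near_coveringP.
move=> /(_ G (nbhs (1%g : G)) (fun q k => chart_ball s (q^-1 * k)%g) _) H.
have {}H : \forall q \near (1%g : G), chart_ball r `<=` (fun k => chart_ball s (q^-1 * k)%g).
  apply: H => k [ck kr].
  have cont : {for (k, 1%g) : G * G, continuous (fun p : G * G => (p.2^-1 * p.1)%g)}.
    apply: mulg_continuous_at => //; last exact: cvg_fst.
    by apply: continuous_comp; [exact: cvg_snd|exact: invg_cont].
  have : nbhs (k, 1%g) (fun p : G * G => chart_interior s (p.2^-1 * p.1)%g).
    apply: cont; apply: open_nbhs_nbhs; split; first exact: open_chart_interior.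
    by rewrite /= invg1 mul1g; split=> //; exact: le_lt_trans rs.
  by apply: filterS => -[a b] /= [cab /ltW lab]; split.
by apply: filterS H => q H y /H; rewrite mulgA mulVg mul1g.
Qed.

Lemma chart_tube_right : \forall q \near (1%g : G), forall y, chart_ball r (y * q)%g -> chart_ball s y.
Proof.
have rr : r < rho by rewrite (lt_trans rs).
have := chart_ball_compact rr; rewrite compact_near_coveringP.
move=> /(_ G (nbhs (1%g : G)) (fun q k => chart_ball s (k * q^-1)%g) _) H.
have {}H : \forall q \near (1%g : G), chart_ball r `<=` (fun k => chart_ball s (k * q^-1)%g).
  apply: H => k [ck kr].
  have cont : {for (k, 1%g) : G * G, continuous (fun p : G * G => (p.1 * p.2^-1)%g)}.
    apply: mulg_continuous_at => //; first exact: cvg_fst.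
    by apply: continuous_comp; [exact: cvg_snd|exact: invg_cont].
  have : nbhs (k, 1%g) (fun p : G * G => chart_interior s (p.1 * p.2^-1)%g).
    apply: cont; apply: open_nbhs_nbhs; split; first exact: open_chart_interior.
    by rewrite /= invg1 mulg1; split=> //; exact: le_lt_trans rs.
  by apply: filterS => -[a b] /= [cab /ltW lab]; split.
by apply: filterS H => q H y /H; rewrite mulgK.
Qed.

(** The cut is at radius s, although the functions to be translated vanish beyond r < s: these
    functions, their derivatives and their small translates then share the compact support
    [chart_ball s]. *)
Definition chart_ext (phi : 'rV[R]_m -> R) (y : G) : R :=
  if `[< chart_ball s y >] then phi (cmap c y) else 0.

Lemma chart_ext_in phi y : chart_ball s y -> chart_ext phi y = phi (cmap c y).
Proof. by move=> Ky; rewrite /chart_ext asboolT. Qed.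

Lemma chart_ext_out phi y : ~ chart_ball s y -> chart_ext phi y = 0.
Proof. by move=> Ky; rewrite /chart_ext asboolF. Qed.

Lemma chart_ext_supported phi : supported (chart_ball s) (chart_ext phi).
Proof. by move=> y; exact: chart_ext_out. Qed.

Lemma chart_ext_bounded phi : Ck_on 0 (coord_ball rho) phi -> bounded_fun (chart_ext phi).
Proof.
move=> Cphi.
have : bounded_set (phi @` [set u : 'rV[R]_m | `|u0 - u| <= s]).
  apply: compact_bounded; apply: continuous_compact; last exact: compact_coords.
  rewrite continuous_subspace_in => u; rewrite inE /= => ut.
  apply: continuous_subspaceT_for => //.
  apply: (Ck_on_continuous Cphi); exact: le_lt_trans srho.
move=> /ex_strict_bound_gt0[M M0 HM]; exists M => y.
have [Ky|nK] := pselect (chart_ball s y); last by rewrite chart_ext_out// normr0 ltW.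
by rewrite chart_ext_in//; apply/ltW/HM; exists (cmap c y) => //; case: Ky.
Qed.

Definition translate_mean (p : G) (h : G -> R) : R :=
  gamma_mean Gamma I (fun y => h (p * y)%g).

Let Ks := chart_ball s.
Let cKs : compact Ks. Proof. exact: chart_ball_compact. Qed.

Let Kp (p : G) : set G := (fun y => (p^-1 * y)%g) @` Ks.
Let cKp p : compact (Kp p).
Proof.
apply: continuous_compact => //; apply: continuous_subspaceT.
exact: mulg_continuousl.
Qed.

Let suppKp p (h : G -> R) : supported Ks h -> supported (Kp p) (fun y => h (p * y)%g).
Proof.
move=> hK y nK; apply: hK => Ky; apply: nK; exists (p * y)%g => //.
by rewrite mulgA mulVg mul1g.
Qed.

Let bdp p (h : G -> R) : bounded_fun h -> bounded_fun (fun y => h (p * y)%g).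
Proof. exact: bounded_fun_comp. Qed.

Lemma translate_meanD p (h k : G -> R) : supported Ks h -> supported Ks k ->
  bounded_fun h -> bounded_fun k ->
  translate_mean p (fun y => h y + k y) = translate_mean p h + translate_mean p k.
Proof.
move=> hK kK bh bk.
rewrite /translate_mean; apply: (gamma_meanD mulg_cont invg_cont dGamma mI (@cKp p) (@suppKp p _ hK) (@suppKp p _ kK) (@bdp p _ bh) (@bdp p _ bk)).
Qed.

Lemma translate_meanZ p a (h : G -> R) : supported Ks h -> bounded_fun h ->
  translate_mean p (fun y => a * h y) = a * translate_mean p h.
Proof.
move=> hK bh.
rewrite /translate_mean; apply: (gamma_meanZ mulg_cont invg_cont dGamma mI a (@cKp p) (@suppKp p _ hK) (@bdp p _ bh)).
Qed.

Lemma translate_mean_bound p : exists N : nat, forall (h : G -> R) (M : R),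
  supported Ks h -> (forall x, `|h x| <= M) -> `|translate_mean p h| <= N%:R * M.
Proof.
have [N HN] := gamma_mean_bound mulg_cont invg_cont dGamma mI (@cKp p).
by exists N => h M hK hM; apply: HN => //; exact: suppKp.
Qed.

Lemma translate_mean_ge0 p (h : G -> R) : supported Ks h -> bounded_fun h ->
  (forall y, 0 <= h y) -> 0 <= translate_mean p h.
Proof.
move=> hK bh h0.
rewrite /translate_mean; by apply: (gamma_mean_ge0 mulg_cont invg_cont dGamma mI (@cKp p) (@suppKp p _ hK) (@bdp p _ bh)).
Qed.

Lemma translate_mean_right p (h : G -> R) q : supported Ks h -> bounded_fun h ->
  translate_mean p (fun y => h (y * q)%g) = translate_mean p h.
Proof.
move=> hK bh.
rewrite -[RHS](gamma_mean_right mulg_cont invg_cont dGamma invI q (@cKp p) (@suppKp p _ hK) (@bdp p _ bh)).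
by congr (gamma_mean _ _ _); apply/funext => y; rewrite mulgA.
Qed.

Lemma translate_mean_left p h q :
  translate_mean p (fun y => h (q * y)%g) = translate_mean (q * p)%g h.
Proof. by congr (gamma_mean _ _ _); apply/funext => y; rewrite mulgA. Qed.

Lemma translate_mean_sum p (T : Type) (l : seq T) (h : T -> G -> R) :
  (forall i, supported Ks (h i)) -> (forall i, bounded_fun (h i)) ->
  translate_mean p (fun y => \sum_(i <- l) h i y) = \sum_(i <- l) translate_mean p (h i).
Proof.
move=> hK bh; elim: l => [|i l IHl].
  rewrite big_nil; have b0 : bounded_fun (fun _ : G => 0 : R) by exists 0 => y; rewrite normr0.
  have K0 : supported Ks (fun _ : G => 0 : R) by [].
  have := translate_meanZ p 0 K0 b0; under eq_fun do rewrite mul0r.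
  rewrite mul0r => Z0; rewrite -[RHS]Z0.
  by congr (translate_mean _ _); apply/funext => y; rewrite big_nil.
rewrite big_cons -IHl -translate_meanD//.
- by congr (translate_mean _ _); apply/funext => y; rewrite big_cons.
- by move=> y nK; rewrite big1// => j _; exact: hK.
- exact: bounded_fun_sum.
Qed.

(** On a fixed compact support the functional is bounded by N times the supremum, so the remainder e
    / (N + 1) times |t| is carried to at most e times |t|. Finite additivity admits no dominated
    convergence, whence the uniform hypothesis. *)
Lemma translate_mean_derive p (F : R -> G -> R) (F' : G -> R) :
  (\forall t \near (0 : R), supported Ks (F t)) -> (forall t, bounded_fun (F t)) ->
  supported Ks F' -> bounded_fun F' ->
  (forall e : R, 0 < e -> \forall t \near (0 : R),
     forall y, `|F t y - F 0 y - t * F' y| <= e * `|t|) ->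
  is_derive (0 : R) (1 : R) (fun t => translate_mean p (F t)) (translate_mean p F').
Proof.
move=> FK Fb F'K F'b H; apply/is_derive_epsP => e e0.
have [N HN] := translate_mean_bound p.
have e1 : 0 < e / (N%:R + 1) by rewrite divr_gt0// ltr_wpDl.
have : \forall t \near (0 : R), supported Ks (F t) /\
  forall y, `|F t y - F 0 y - t * F' y| <= e / (N%:R + 1) * `|t|.
  by apply: filterI => //; exact: H.
move=> /nbhs_ex_ball [d d0 Hd]; exists d => // t td.
rewrite addr0 [t *: 1]mulr1 [t *: _]/(t * _).
have [FtK Ht] : supported Ks (F t) /\
  forall y, `|F t y - F 0 y - t * F' y| <= e / (N%:R + 1) * `|t|.
  by apply: Hd; rewrite sub0r normrN.
have F0K : supported Ks (F 0) by exact: nbhs_singleton FK.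
have -> : translate_mean p (F t) - translate_mean p (F 0) - t * translate_mean p F' =
   translate_mean p (fun y => F t y - F 0 y - t * F' y).
  have K1 : supported Ks (fun y => (-1) * F 0 y) by move=> y /F0K ->; rewrite mulr0.
  have K2 : supported Ks (fun y => (- t) * F' y) by move=> y /F'K ->; rewrite mulr0.
  have b1 : bounded_fun (fun y => (-1) * F 0 y) by exact: bounded_funZ.
  have b2 : bounded_fun (fun y => (- t) * F' y) by exact: bounded_funZ.
  transitivity (translate_mean p (fun y => F t y + (-1) * F 0 y + (- t) * F' y)).
    rewrite translate_meanD//; last exact: bounded_funD.
      by rewrite translate_meanD// !translate_meanZ// mulN1r mulNr.
    by move=> y nK; rewrite FtK// K1// addr0.
  by congr (translate_mean _ _); apply/funext => y; rewrite mulN1r mulNr.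
apply: le_trans (HN _ _ _ Ht) _.
  by move=> y nK; rewrite FtK// F0K// F'K// mulr0 !subr0.
rewrite mulrA ler_wpM2r// mulrCA ler_piMr// ?ltW//.
by rewrite ltr_pdivrMr ?ltr_wpDl// mul1r ltrDl.
Qed.

Let Mu1 v : coord_ball rho v -> Mu (row_mx u0 v) = v.
Proof.
move=> Bv; rewrite /Mu /local_mul row_mxKl row_mxKr cinv0 mul1g.
by have [] := crangeP hc (coord_ball_crange Bv).
Qed.

Let Mu2 v : coord_ball rho v -> Mu (row_mx v u0) = v.
Proof.
move=> Bv; rewrite /Mu /local_mul row_mxKl row_mxKr cinv0 mulg1.
by have [] := crangeP hc (coord_ball_crange Bv).
Qed.

(** Left and right translations are treated together: [sigma] t multiplies by a point of a curve
    through 1, [emb] places u in one argument of [Mu] and u0 in the other, and a moves that u0 along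
    the curve. *)
Lemma translate_mean_flow_derive p (phi : 'rV[R]_m -> R) (sigma : R -> G -> G)
    (emb : 'rV[R]_m -> 'rV[R]_(m + m)) (a : 'rV[R]_(m + m)) :
  Ck_on 1 (coord_ball rho) phi -> (forall u, r < `|u0 - u| -> phi u = 0) ->
  continuous emb -> (forall u, coord_ball rho u -> W (emb u) /\ Mu (emb u) = u) ->
  (forall y, sigma 0 y = y) ->
  (\forall t \near (0 : R), forall y, chart_ball r (sigma t y) -> chart_ball s y) ->
  (\forall t \near (0 : R), forall u, `|u0 - u| <= s ->
     cdom c (sigma t (cinv c u)) /\ cmap c (sigma t (cinv c u)) = Mu (emb u + t *: a)) ->
  is_derive (0 : R) (1 : R) (fun t => translate_mean p (fun y => chart_ext phi (sigma t y)))
    (translate_mean p (chart_ext (fun u => 'D_a (phi \o Mu) (emb u)))).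
Proof.
move=> Cphi phi0 cemb Wemb sigma0 S1 S2.
have oB := @open_coord_ball rho.
(* The product must also stay in the ball on which phi is C^1. *)
pose W' := W `&` Mu @^-1` (coord_ball rho).
have oW' : open W'.
  rewrite openE => z [Wz Bz]; apply: filterI; first exact: open_nbhs_nbhs.
  by apply: (Ck_on_continuous CMu Wz); exact: open_nbhs_nbhs.
have CH : Ck_on 1 W' (phi \o Mu).
  apply: (@Ck_on_comp _ _ _ _ W' (coord_ball rho)) => //; first by move=> z [].
  by apply: (@Ck_on_subset _ _ _ _ W) => [z []//|]; exact: Ck_on_pred.
have Wemb' u : coord_ball rho u -> W' (emb u).
  by move=> Bu; have [? e] := Wemb u Bu; split=> //=; rewrite e.
have cDH z : W' z -> {for z, continuous ('D_a (phi \o Mu))}.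
  exact: (Ck_on_continuous (Ck_on_derive a CH)).
have ext0 y : chart_ext phi y != 0 -> chart_ball r y.
  have [Ky|nK] := pselect (chart_ball s y); last by rewrite chart_ext_out// eqxx.
  rewrite chart_ext_in// => n0; split; first by case: Ky.
  by rewrite leNgt; apply/negP => /phi0 E; move: n0; rewrite E eqxx.
apply: translate_mean_derive.
- apply: filterS S1 => t S1 y nK; apply/eqP; apply: contrapT => /negP /ext0 /S1.
  exact: nK.
- move=> t; apply: bounded_fun_comp; apply: chart_ext_bounded.
  exact: Ck_on_pred.
- exact: chart_ext_supported.
- apply: chart_ext_bounded; split=> // u Bu.
  apply: (@continuous_comp _ _ _ emb ('D_a (phi \o Mu)) u); first exact: cemb.
  by apply: cDH; exact: Wemb'.
move=> e e0; have U := @uniform_derive_compact R _ W' (phi \o Mu) a oW'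
  (fun z Wz => Ck_on_derivable CH Wz) cDH _ _ emb e (@compact_coords s)
  (fun u _ => cemb u) (fun u us => Wemb' u (le_lt_trans us srho)) e0.
apply: filterS3 S1 S2 U => t S1 S2 U y.
have [Ky|nK] := pselect (chart_ball s y); last first.
  rewrite sigma0 !(chart_ext_out _ nK) mulr0 !subr0.
  have -> : chart_ext phi (sigma t y) = 0.
    by apply/eqP; apply: contrapT => /negP /ext0 /S1.
  by rewrite normr0 mulr_ge0// ltW.
rewrite sigma0 !(chart_ext_in _ Ky); have [cy ys] := Ky.
have [d E] := S2 _ ys; rewrite chart_mapK// in d E.
have Eu := Wemb _ (le_lt_trans ys srho).
have -> : chart_ext phi (sigma t y) = (phi \o Mu) (emb (cmap c y) + t *: a).
  rewrite /= -E; have [K|nK] := pselect (chart_ball s (sigma t y)).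
    by rewrite chart_ext_in.
  rewrite chart_ext_out//; apply/esym/phi0; rewrite ltNge; apply/negP => le.
  by apply: nK; split=> //; apply: le_trans le _; exact: ltW.
have -> : phi (cmap c y) = (phi \o Mu) (emb (cmap c y)) by rewrite /= Eu.2.
exact: U.
Qed.

Let curve (w : 'rV[R]_m) (t : R) : G := cinv c (u0 + t *: w).

Let curve_continuous w : {for (0 : R), continuous (curve w)}.
Proof.
apply: continuous_comp; last first.
  by apply: chart_inv_continuous => //; rewrite scale0r addr0; exact: cdom_crange.
apply: continuous_atD; first exact: cst_continuous.
exact: scalel_continuous.
Qed.

Let curve0 w : curve w 0 = 1%g.
Proof. by rewrite /curve scale0r addr0. Qed.

Let near_curve w (P : G -> Prop) :
  (\forall q \near (1%g : G), P q) -> \forall t \near (0 : R), P (curve w t).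
Proof. by move=> nP; apply: (@curve_continuous w P); rewrite curve0. Qed.

Let near_small w : \forall t \near (0 : R), coord_ball rho (u0 + t *: w).
Proof.
have cw : {for (0 : R), continuous (fun t : R => u0 + t *: w)}.
  by apply: continuous_atD; [exact: cst_continuous|exact: scalel_continuous].
apply: cw; apply: open_nbhs_nbhs; split; first exact: open_coord_ball.
by rewrite scale0r addr0; exact: u0B.
Qed.

Let chain_frame (phi : 'rV[R]_m -> R) z a (v : 'rV[R]_m) : Ck_on 1 (coord_ball rho) phi ->
  W z -> coord_ball rho (Mu z) -> 'D_a Mu z = v ->
  'D_a (phi \o Mu) z = 'D_v phi (Mu z).
Proof.
move=> Cphi Wz Bz <-; apply: is_deriveE; apply: is_derive_comp.
  by apply: (Ck_on_differentiable _ Cphi Bz); exact: open_coord_ball.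
by apply: derivableP; exact: (Ck_on_derivable CMu Wz).
Qed.

(** Left translations along a curve through 1 with velocity w generate the right invariant field of
    w. *)
Lemma left_translate_derive p (phi : 'rV[R]_m -> R) (w : 'rV[R]_m) :
  Ck_on 1 (coord_ball rho) phi -> (forall u, r < `|u0 - u| -> phi u = 0) ->
  is_derive (0 : R) (1 : R)
    (fun t => translate_mean p (fun y => chart_ext phi (cinv c (u0 + t *: w) * y)%g))
    (translate_mean p (chart_ext (fun u => 'D_(right_frame Mu u0 u w) phi u))).
Proof.
move=> Cphi phi0.
have := @translate_mean_flow_derive p phi (fun t y => (curve w t * y)%g) (fun u => row_mx u0 u)
  (row_mx w 0) Cphi phi0.
have -> : chart_ext (fun u => 'D_(row_mx w 0) (phi \o Mu) (row_mx u0 u)) =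
   chart_ext (fun u => 'D_(right_frame Mu u0 u w) phi u).
  apply/funext => y; have [Ky|nK] := pselect (chart_ball s y); last by rewrite !chart_ext_out.
  rewrite !chart_ext_in//; have [cy ys] := Ky.
  have By : coord_ball rho (cmap c y) by exact: le_lt_trans srho.
  have Wy := BW (u0B rho0) By.
  have /= -> := @chain_frame phi _ _ (right_frame Mu u0 (cmap c y) w) Cphi Wy.
  - by rewrite Mu1.
  - by rewrite Mu1.
  - by [].
apply.
- by move=> u; apply: (@row_mx_continuous_at R m m _ (fun=> u0) id u); [exact: cst_continuous|exact: cvg_id].
- by move=> u Bu; split; [apply: BW => //; exact: u0B|exact: Mu1].
- by move=> y; rewrite curve0 mul1g.
- exact: (near_curve _ chart_tube_left).
apply: filterS (near_small w) => t Bt u us.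
have Bu : coord_ball rho u by exact: le_lt_trans srho.
have E : row_mx u0 u + t *: row_mx w 0 = row_mx (u0 + t *: w) u.
  by rewrite scale_row_mx add_row_mx scaler0 addr0.
have [_ _ +] := Wmul (BW Bt Bu); rewrite E /Mu /local_mul row_mxKl row_mxKr.
by split.
Qed.

(** Right translations generate left invariant fields, and right invariance of the functional makes
    the mean of the translates constant in t. This is integration by parts with no boundary term. *)
Lemma right_translate_derive p (phi : 'rV[R]_m -> R) (w : 'rV[R]_m) :
  Ck_on 1 (coord_ball rho) phi -> (forall u, r < `|u0 - u| -> phi u = 0) ->
  translate_mean p (chart_ext (fun u => 'D_(left_frame Mu u0 u w) phi u)) = 0.
Proof.
move=> Cphi phi0.
have := @translate_mean_flow_derive p phi (fun t y => (y * curve w t)%g) (fun u => row_mx u u0)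
  (row_mx 0 w) Cphi phi0.
have -> : chart_ext (fun u => 'D_(row_mx 0 w) (phi \o Mu) (row_mx u u0)) =
   chart_ext (fun u => 'D_(left_frame Mu u0 u w) phi u).
  apply/funext => y; have [Ky|nK] := pselect (chart_ball s y); last by rewrite !chart_ext_out.
  rewrite !chart_ext_in//; have [cy ys] := Ky.
  have By : coord_ball rho (cmap c y) by exact: le_lt_trans srho.
  have Wy := BW By (u0B rho0).
  have /= -> := @chain_frame phi _ _ (left_frame Mu u0 (cmap c y) w) Cphi Wy.
  - by rewrite Mu2.
  - by rewrite Mu2.
  - by [].
have -> : (fun t => translate_mean p (fun y => chart_ext phi (y * curve w t)%g)) =
    (fun=> translate_mean p (chart_ext phi)).
  apply/funext => t; apply: translate_mean_right; first exact: chart_ext_supported.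
  by apply: chart_ext_bounded; exact: Ck_on_pred.
move=> H; rewrite -(is_deriveE (H _ _ _ _ _)) ?derive_cst//.
- by move=> u; apply: (@row_mx_continuous_at R m m _ id (fun=> u0) u); [exact: cvg_id|exact: cst_continuous].
- by move=> u Bu; split; [apply: BW => //; exact: u0B|exact: Mu2].
- by move=> y; rewrite curve0 mulg1.
- exact: (near_curve _ chart_tube_right).
apply: filterS (near_small w) => t Bt u us.
have Bu : coord_ball rho u by exact: le_lt_trans srho.
have E : row_mx u u0 + t *: row_mx 0 w = row_mx u (u0 + t *: w).
  by rewrite scale_row_mx add_row_mx scaler0 addr0.
have [_ _ +] := Wmul (BW Bu Bt); rewrite E /Mu /local_mul row_mxKl row_mxKr.
by split.
Qed.

Lemma Ck_on_frame_derive (X : 'rV[R]_m -> 'rV[R]_m) (psi : 'rV[R]_m -> R) :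
  Ck_on 0 (coord_ball rho) X -> Ck_on 1 (coord_ball rho) psi ->
  Ck_on 0 (coord_ball rho) (fun u => 'D_(X u) psi u).
Proof.
have oB := @open_coord_ball rho; move=> CX Cpsi.
apply: (@Ck_on_ext _ _ _ _ _ (fun u => \sum_j X u 0 j * 'D_('e_j) psi u)) => // [u Bu|].
  by rewrite (Ck_on_derive_sum _ oB Cpsi Bu).
apply: Ck_on_sum => // j; apply: Ck_onM => //; last exact: Ck_on_derive.
exact: (Ck_on_rowP _ _ oB).1 CX j.
Qed.

(** With b the coefficients of the right invariant field in the left frame, the functions L_i (phi
    b_i) have mean zero and add up to R_w phi + phi div b. Hence minus the mean of R_w phi is the
    mean of phi div b, and div b >= k with phi >= 0 finishes. *)
Lemma divergence_inequality p (phi : 'rV[R]_m -> R) (b : 'rV[R]_m -> 'rV[R]_m) (w : 'rV[R]_m) (k : R) :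
  Ck_on 1 (coord_ball rho) phi -> (forall u, r < `|u0 - u| -> phi u = 0) ->
  (forall u, 0 <= phi u) -> Ck_on 1 (coord_ball rho) b ->
  (forall u, coord_ball rho u ->
     right_frame Mu u0 u w = \sum_i b u 0 i *: left_frame Mu u0 u 'e_i) ->
  (forall u, coord_ball rho u ->
     k <= \sum_i 'D_(left_frame Mu u0 u 'e_i) (fun v => b v 0 i) u) ->
  k * translate_mean p (chart_ext phi) <=
    - translate_mean p (chart_ext (fun u => 'D_(right_frame Mu u0 u w) phi u)).
Proof.
move=> Cphi phi0 phige Cb Rb kdiv; have oB := @open_coord_ball rho.
have Cbi i : Ck_on 1 (coord_ball rho) (fun v => b v 0 i) by exact: (Ck_on_rowP _ _ oB).1 Cb i.
pose psi i u := phi u * b u 0 i.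
have Cpsi i : Ck_on 1 (coord_ball rho) (psi i) by exact: (Ck_onM oB Cphi (Cbi i)).
have psi0 i u : r < `|u0 - u| -> psi i u = 0 by move=> /phi0 e; rewrite /psi e mul0r.
pose h i := chart_ext (fun u => 'D_(left_frame Mu u0 u 'e_i) (psi i) u).
have BW' u v : coord_ball rho u -> coord_ball rho v -> W (row_mx u v) by exact: BW.
have CL x : Ck_on 0 (coord_ball rho) (fun u => left_frame Mu u0 u x).
  by apply: Ck_on_pred; apply: (Ck_on_left_frame oW oB (u0B rho0) BW' CMu).
have CR x : Ck_on 0 (coord_ball rho) (fun u => right_frame Mu u0 u x).
  by apply: Ck_on_pred; apply: (Ck_on_right_frame oW oB (u0B rho0) BW' CMu).
have bh i : bounded_fun (h i).
  by apply: chart_ext_bounded; exact: (Ck_on_frame_derive (CL 'e_i) (Cpsi i)).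
have hK i : supported Ks (h i) by exact: chart_ext_supported.
set DR := chart_ext (fun u => 'D_(right_frame Mu u0 u w) phi u).
have bDR : bounded_fun DR by apply: chart_ext_bounded; exact: (Ck_on_frame_derive (CR w) Cphi).
have KDR : supported Ks DR by exact: chart_ext_supported.
have bphi : bounded_fun (chart_ext phi) by apply: chart_ext_bounded; exact: Ck_on_pred.
have Kphi : supported Ks (chart_ext phi) by exact: chart_ext_supported.
have hsum0 : translate_mean p (fun y => \sum_i h i y) = 0.
  rewrite translate_mean_sum// big1// => i _; exact: (right_translate_derive p 'e_i (Cpsi i) (@psi0 i)).
pose rest y := \sum_i h i y + ((-1) * DR y + (- k) * chart_ext phi y).
have bsum : bounded_fun (fun y => \sum_i h i y) by exact: bounded_fun_sum.
have Ksum : supported Ks (fun y => \sum_i h i y).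
  by move=> y nK; rewrite big1// => i _; exact: hK.
have b1 : bounded_fun (fun y => (-1) * DR y) by exact: bounded_funZ.
have b2 : bounded_fun (fun y => (- k) * chart_ext phi y) by exact: bounded_funZ.
have K1 : supported Ks (fun y => (-1) * DR y) by move=> y /KDR ->; rewrite mulr0.
have K2 : supported Ks (fun y => (- k) * chart_ext phi y) by move=> y /Kphi ->; rewrite mulr0.
have b12 : bounded_fun (fun y => (-1) * DR y + (- k) * chart_ext phi y) by exact: bounded_funD.
have K12 : supported Ks (fun y => (-1) * DR y + (- k) * chart_ext phi y).
  by move=> y nK; rewrite K1// K2// addr0.
have : 0 <= translate_mean p rest.
  apply: translate_mean_ge0.
  - by move=> y nK; rewrite /rest Ksum// K12// addr0.
  - exact: bounded_funD.
  move=> y; rewrite /rest; have [Ky|nK] := pselect (chart_ball s y); last first.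
    by rewrite Ksum// K12// addr0.
  rewrite /DR /h; under eq_bigr do rewrite chart_ext_in//.
  rewrite !chart_ext_in//; have [_ ys] := Ky.
  set u := cmap c y in ys *; have Bu : coord_ball rho u by exact: le_lt_trans srho.
  have dphi : differentiable phi u by exact: (Ck_on_differentiable oB Cphi Bu).
  have -> : 'D_(right_frame Mu u0 u w) phi u = \sum_i b u 0 i * 'D_(left_frame Mu u0 u 'e_i) phi u.
    rewrite Rb// deriveE// linear_sum; apply: eq_bigr => i _.
    by rewrite linearZ deriveE.
  have -> : \sum_i 'D_(left_frame Mu u0 u 'e_i) (psi i) u =
     \sum_i b u 0 i * 'D_(left_frame Mu u0 u 'e_i) phi u +
     phi u * \sum_i 'D_(left_frame Mu u0 u 'e_i) (fun v => b v 0 i) u.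
    rewrite mulr_sumr -big_split; apply: eq_bigr => i _ /=.
    rewrite deriveM; [|exact: (Ck_on_derivable Cphi Bu)|exact: (Ck_on_derivable (Cbi i) Bu)].
    by rewrite addrC.
  have H := ler_wpM2l (phige u) (kdiv u Bu).
  by rewrite mulN1r mulNr addrACA subrr add0r subr_ge0 mulrC.
rewrite /rest translate_meanD// hsum0 add0r translate_meanD// !translate_meanZ//.
by rewrite mulN1r mulNr subr_ge0.
Qed.

Let chart_ext_continuous (phi : 'rV[R]_m -> R) y : Ck_on 0 (coord_ball rho) phi ->
  (forall u, r < `|u0 - u| -> phi u = 0) -> chart_interior rho y ->
  {for y, continuous (chart_ext phi)}.
Proof.
move=> Cphi phi0 Iy; apply: (@near_eq_continuous_at _ _ (phi \o cmap c)).
  apply: (open_near_eq (@open_chart_interior rho)) Iy => z [cz Bz] /=.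
  have [K|nK] := pselect (chart_ball s z); first by rewrite chart_ext_in.
  rewrite chart_ext_out//; apply: phi0; rewrite ltNge; apply/negP => le.
  by apply: nK; split=> //; apply: le_trans le _; exact: ltW.
have [cy By] := Iy.
by apply: continuous_comp; [exact: chart_map_continuous|exact: (Ck_on_continuous Cphi By)].
Qed.

(** Passing from p to p' translates the function by p' p^-1, which is near 1. A continuous function
    with compact support changes uniformly little under small left translations, and the bound of
    the functional on a fixed compact set turns this into continuity. *)
Lemma translate_mean_continuous (phi : 'rV[R]_m -> R) : Ck_on 0 (coord_ball rho) phi ->
  (forall u, r < `|u0 - u| -> phi u = 0) ->
  continuous (fun p => translate_mean p (chart_ext phi)).
Proof.
move=> Cphi phi0 p; set f := chart_ext phi.
have bf : bounded_fun f by exact: chart_ext_bounded.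
have Kf : supported Ks f by exact: chart_ext_supported.
have unif e : 0 < e -> \forall q \near (1%g : G), forall y, `|f (q * y)%g - f y| <= e.
  move=> e0; have e2 : 0 < e / 2 by rewrite divr_gt0.
  have := cKs; rewrite compact_near_coveringP.
  move=> /(_ G (nbhs (1%g : G)) (fun q y => `|f (q * y)%g - f y| <= e) _) H.
  have {}H : \forall q \near (1%g : G), Ks `<=` (fun y => `|f (q * y)%g - f y| <= e).
    apply: H => y1 [cy1 y1s].
    have Iy1 : chart_interior rho y1 by split=> //; exact: le_lt_trans srho.
    have cf := chart_ext_continuous Cphi phi0 Iy1.
    have cf2 : {for (y1, 1%g) : G * G, continuous (fun z : G * G => f (z.2 * z.1)%g)}.
      apply: continuous_comp.
        by apply: mulg_continuous_at => //; [exact: cvg_snd|exact: cvg_fst].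
      by rewrite /= mul1g.
    have n1 : nbhs ((y1, 1%g) : G * G) (fun z => `|f y1 - f (z.2 * z.1)%g| <= e / 2).
      by move/cvgrPdist_le : cf2 => /(_ _ e2); rewrite /= mul1g.
    have n2 : nbhs ((y1, 1%g) : G * G) (fun z => `|f y1 - f z.1| <= e / 2).
      have cf1 : {for (y1, 1%g) : G * G, continuous (fun z : G * G => f z.1)}.
        by apply: continuous_comp; [exact: cvg_fst|exact: cf].
      by move/cvgrPdist_le : cf1 => /(_ _ e2).
    apply: filterS2 n1 n2 => -[y q] /= n1 n2.
    rewrite -(subrKA (f y1)) (le_trans (ler_normD _ _))// [e]splitr lerD//.
    by rewrite distrC.
  apply: filterS2 H chart_tube_left => q H T y.
  have [K|nK] := pselect (Ks y); first exact: H.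
  rewrite (Kf y nK) subr0; have [Kq|nKq] := pselect (chart_ball s (q * y)%g); last first.
    by rewrite (Kf _ nKq) normr0 ltW.
  rewrite /f chart_ext_in// phi0 ?normr0 ?ltW//.
  rewrite ltNge; apply/negP => le; apply: nK; apply: T.
  by split=> //; case: Kq.
apply/cvgrPdist_le => e e0; have [N HN] := translate_mean_bound p.
have e1 : 0 < e / (N%:R + 1) by rewrite divr_gt0// ltr_wpDl.
have cq : {for p, continuous (fun p' => (p' * p^-1)%g)} by exact: mulg_continuousr.
have : \forall p' \near p, forall y, `|f (p' * p^-1 * y)%g - f y| <= e / (N%:R + 1).
  have := unif _ e1; rewrite -(mulgV p) => /cq; exact.
have cq1 : (fun p' => (p' * p^-1)%g) @ p --> (1%g : G) by rewrite -[X in _ --> X](mulgV p); exact: cq.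
have T : \forall p' \near p, forall y, chart_ball r (p' * p^-1 * y)%g -> chart_ball s y.
  exact: (cq1 _ chart_tube_left).
apply: filterS2 T => p' T' H.
have Kf' : supported Ks (fun y => f (p' * p^-1 * y)%g).
  move=> y nK; have [Kq|nKq] := pselect (chart_ball s (p' * p^-1 * y)%g); last exact: Kf.
  rewrite /f chart_ext_in//; apply: phi0; rewrite ltNge; apply/negP => le; apply: nK.
  by apply: T'; split=> //; case: Kq.
have -> : translate_mean p' f = translate_mean p (fun y => f (p' * p^-1 * y)%g).
  by rewrite translate_mean_left mulgVK.
have bf' : bounded_fun (fun y => f (p' * p^-1 * y)%g) by exact: (bounded_fun_comp (fun y => p' * p^-1 * y)%g bf).
have bn : bounded_fun (fun y => (-1) * f y) by exact: bounded_funZ.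
have Kn : supported Ks (fun y => (-1) * f y) by move=> y /Kf ->; rewrite mulr0.
rewrite distrC; have -> : translate_mean p (fun y => f (p' * p^-1 * y)%g) - translate_mean p f =
   translate_mean p (fun y => f (p' * p^-1 * y)%g + (-1) * f y).
  by rewrite translate_meanD// translate_meanZ// mulN1r.
apply: le_trans (HN _ (e / (N%:R + 1)) _ _) _.
- by move=> y nK; rewrite Kf'// Kn// addr0.
- by move=> y; rewrite mulN1r; exact: H.
rewrite mulrCA ler_piMr// ?ltW//.
by rewrite ltr_pdivrMr ?ltr_wpDl// mul1r ltrDl.
Qed.

(** Positivity alone gives only a nonnegative value. Since the translates indexed by l reach, on
    every orbit of Gamma, a point where phi is at least e, the corresponding means add up to at
    least e, so one of them is positive. *)
Lemma translate_mean_gt0 (phi : 'rV[R]_m -> R) (l : seq G) (e : R) :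
  Ck_on 0 (coord_ball rho) phi -> (forall u, 0 <= phi u) -> 0 < e ->
  (forall x, exists2 y, Gamma y & exists2 a, a \in l &
     chart_ball s (a * (y * x))%g /\ e <= phi (cmap c (a * (y * x))%g)) ->
  exists p, 0 < translate_mean p (chart_ext phi).
Proof.
move=> Cphi phige e0 Hl; set f := chart_ext phi.
have bf : bounded_fun f by exact: chart_ext_bounded.
have Kf : supported Ks f by exact: chart_ext_supported.
have fge y : 0 <= f y.
  by have [K|nK] := pselect (chart_ball s y); [rewrite /f chart_ext_in|rewrite Kf].
have S : e <= \sum_(a <- l) translate_mean a f.
  apply: (gamma_mean_sum_ge mulg_cont invg_cont dGamma mI (K := Kp)).
  - exact: cKp.
  - by move=> a; exact: suppKp.
  - by move=> a; exact: bdp.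
  - by [].
  move=> x; have [y Gy [a al [Ka ea]]] := Hl x; exists y => //.
  have Ea : e <= f (a * (y * x))%g by rewrite /f chart_ext_in.
  apply: le_trans Ea _.
  by rewrite (big_rem a)//= lerDl sumr_ge0.
apply: contrapT => nex; move: S; rewrite leNgt => /negP; apply.
apply: le_lt_trans e0; rewrite big_seq; apply: sumr_le0 => a _.
by rewrite leNgt; apply/negP => pos; apply: nex; exists a.
Qed.

End LocalFunctional.

Section LinearTrace.
Variables (R : realType) (g : vectType R).

(** Cyclicity of the trace: P and Q pass between coordinates in the basis [vbasis] and in 'rV_m.
    They are rectangular matrices, as m is not assumed to be the dimension of g, and Q P = 1 is what
    the computation uses. *)
Lemma lfun_trace_bijection (m : nat) (th : {linear g -> 'rV[R]_m}) (th' : 'rV[R]_m -> g)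
    (f : 'End(g)) : cancel th th' -> cancel th' th ->
  lfun_trace f = \sum_i th (f (th' 'e_i)) 0 i.
Proof.
move=> thK th'K.
have th'l : linear th'.
  by move=> a u v; apply: (can_inj thK); rewrite linearP !th'K.
set b := vbasis {:g}; pose d := \dim {:g}.
have bb : basis_of {:g} b by exact: vbasisP.
have Pl : linear (fun u : 'rV[R]_d => th (passmx.vecof b u)).
  by move=> a u v; rewrite passmx.vecof_linear linearP.
have Ql : linear (fun u : 'rV[R]_m => passmx.rVof b (th' u)).
  by move=> a u v; rewrite th'l passmx.rVof_linear.
have Nl : linear (fun u : 'rV[R]_m => th (f (th' u))).
  by move=> a u v; rewrite th'l !linearP.
pose PL : {linear 'rV[R]_d -> 'rV[R]_m} := HB.pack (fun u : 'rV[R]_d => th (passmx.vecof b u))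
  (GRing.isLinear.Build _ _ _ _ _ Pl).
pose QL : {linear 'rV[R]_m -> 'rV[R]_d} := HB.pack (fun u : 'rV[R]_m => passmx.rVof b (th' u))
  (GRing.isLinear.Build _ _ _ _ _ Ql).
pose NL : {linear 'rV[R]_m -> 'rV[R]_m} := HB.pack (fun u : 'rV[R]_m => th (f (th' u)))
  (GRing.isLinear.Build _ _ _ _ _ Nl).
pose P := lin1_mx PL; pose Q := lin1_mx QL; pose N := lin1_mx NL.
have EP u : u *m P = th (passmx.vecof b u) by exact: (mul_rV_lin1 PL).
have EQ u : u *m Q = passmx.rVof b (th' u) by exact: (mul_rV_lin1 QL).
have EN u : u *m N = th (f (th' u)) by exact: (mul_rV_lin1 NL).
have QP : Q *m P = 1%:M.
  by apply/row_matrixP => i; rewrite !rowE mulmxA EQ EP passmx.rVofK// th'K mulmx1.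
have -> : lfun_trace f = \tr (P *m (N *m Q)).
  rewrite /lfun_trace; congr mxtrace; apply/row_matrixP => i; rewrite !rowE.
  by rewrite passmx.mul_mxof !mulmxA EP EN EQ !thK.
rewrite mxtrace_mulC -mulmxA QP mulmx1 /mxtrace; apply: eq_bigr => i _.
by rewrite -EN -rowE [RHS]mxE.
Qed.

End LinearTrace.

Section Bump.
Variables (R : realType).

Let pospart2 (x : R) : R := (Num.max 0 x) ^+ 2.

Let pospart2_ineq (x k : R) :
  `|pospart2 (k + x) - pospart2 x - k * (2 * Num.max 0 x)| <= `|k| ^+ 2.
Proof.
rewrite real_normK ?num_real// /pospart2 ler_norml.
by apply/andP; split; case: (leP 0 (k + x)); case: (leP 0 x) => A B;
  rewrite ?expr0n /=; nra.
Qed.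

Let pospart2_derive x : is_derive x (1 : R) pospart2 (2 * Num.max 0 x).
Proof.
apply/is_derive_epsP => e e0; exists e => // k ke; rewrite [k *: 1]mulr1.
apply: le_trans (pospart2_ineq x k) _.
by rewrite expr2 ler_wpM2r// ltW.
Qed.

Variables (m : nat) (u0 : 'rV[R]_m) (r : R).

Let sqnorm (u : 'rV[R]_m) : R := \sum_j (u 0 j - u0 0 j) * (u 0 j - u0 0 j).

(** The square of the positive part is C^1, the regularity that integration by parts asks for. The
    Euclidean square norm is used because it is smooth; the norm of 'rV is the maximum norm, which
    it dominates, so the support lies in the ball of radius r of that norm. *)
Definition bump_fun (u : 'rV[R]_m) : R := pospart2 (r ^+ 2 - sqnorm u).

Lemma bump_ge0 u : 0 <= bump_fun u.
Proof. exact: sqr_ge0. Qed.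

Lemma bump_gt0 : 0 < r -> 0 < bump_fun u0.
Proof.
move=> r0; rewrite /bump_fun /sqnorm big1 ?subr0 => [|j _]; last by rewrite subrr mulr0.
by rewrite /pospart2 exprn_gt0// lt_max exprn_gt0// orbT.
Qed.

Lemma bump_out u : 0 < r -> r < `|u0 - u| -> bump_fun u = 0.
Proof.
move=> r0 ru; rewrite /bump_fun /pospart2.
have [le|lt] := leP (r ^+ 2) (sqnorm u).
  by rewrite max_l ?expr0n// subr_le0.
exfalso; move: ru; rewrite ltNge => /negP; apply.
rewrite [leLHS]/Num.Def.normr/= mx_normrE; apply: bigmax_le => [|[i j] _]; first exact: ltW.
rewrite !mxE ord1 /= leNgt; apply/negP => rlt.
have le : (u0 0 j - u 0 j) ^+ 2 <= sqnorm u.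
  rewrite /sqnorm (bigD1 j)//= -expr2 -sqrrN opprB ler_wpDr//.
  by apply: sumr_ge0 => k _; rewrite -expr2 sqr_ge0.
move: le; rewrite -(real_normK (num_real (u0 0 j - u 0 j))) => le; nra.
Qed.

Lemma Ck_on_bump U : open U -> Ck_on 1 U bump_fun.
Proof.
move=> oU; have Cs k : Ck_on k U (fun u => r ^+ 2 + (-1) * sqnorm u).
  apply: Ck_onD => //; first exact: Ck_on_cst.
  apply: Ck_onM => //; first exact: Ck_on_cst.
  have Cj j : Ck_on k U (fun u => u 0 j - u0 0 j).
    have := (Ck_on_rowP k _ oU).1 (Ck_on_affine k U 1%:M (- u0)) j.
    by apply: Ck_on_ext => // u _; rewrite mulmx1 !mxE.
  by apply: Ck_on_sum => // j; apply: Ck_onM.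
have bE : bump_fun = pospart2 \o (fun u => r ^+ 2 + (-1) * sqnorm u).
  by apply/funext => u; rewrite /bump_fun /= mulN1r.
have dP x : differentiable pospart2 x.
  by apply/derivable1_diffP; exact: is_derive_derivable (pospart2_derive x).
have cP : continuous (fun x : R => Num.max 0 x : R).
  by move=> x; apply: (@continuous_max _ _ (fun=> 0) id); [exact: cst_continuous|exact: cvg_id].
have db v u : U u -> is_derive u v bump_fun
    ('D_v (fun u => r ^+ 2 + (-1) * sqnorm u) u * (2 * Num.max 0 (r ^+ 2 + (-1) * sqnorm u))).
  move=> Uu; rewrite bE; apply: is_derive_eq.
    apply: is_derive_comp; first exact: dP.
    by apply: derivableP; exact: (Ck_on_derivable (Cs 1) Uu).
  have := is_deriveZv ('D_v (fun u => r ^+ 2 + (-1) * sqnorm u) u) (pospart2_derive (r ^+ 2 + (-1) * sqnorm u)).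
  by move=> /is_deriveE; rewrite [_ *: (1 : R)]mulr1.
split=> [u Uu|v].
  rewrite bE; apply: continuous_comp; first exact: (Ck_on_continuous (Cs 0) Uu).
  exact: differentiable_continuous.
split=> [u Uu|]; first exact: is_derive_derivable (db v u Uu).
apply: (@Ck_on_ext _ _ _ _ _ (fun u => 'D_v (fun u => r ^+ 2 + (-1) * sqnorm u) u *
   (2 * Num.max 0 (r ^+ 2 + (-1) * sqnorm u)))) => //.
  by move=> u Uu; rewrite (is_deriveE (db v u Uu)).
apply: Ck_onM => //; first exact: Ck_on_derive.
apply: Ck_onM => //; first exact: Ck_on_cst.
split=> // u Uu; apply: (@continuous_comp _ _ _ (fun u => r ^+ 2 + (-1) * sqnorm u) (fun x : R => Num.max 0 x)).
  exact: (Ck_on_continuous (Cs 0) Uu).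
exact: cP.
Qed.

End Bump.

Lemma max_derive0 (R : realType) (f : R -> R) (l : R) :
  (forall t, f t <= f 0) -> is_derive (0 : R) (1 : R) f l -> l = 0.
Proof.
move=> fmax /is_derive_epsP H; apply/eqP; rewrite -normr_le0; apply/ler_addgt0Pl => e e0.
rewrite addr0; have [d d0 Hd] := H e e0; have d2 : 0 < d / 2 by rewrite divr_gt0.
have dd : `|d / 2| < d by rewrite ger0_norm ?ltW// ltr_pdivrMr// ltr_pMr// ltr1n.
have := Hd _ dd; have := Hd (- (d / 2)); rewrite normrN => /(_ dd).
have scE (a b : R) : a *: b = a * b by [].
rewrite !addr0 !scE !mulr1 (ger0_norm (ltW d2)).
have := fmax (d / 2); have := fmax (- (d / 2)).
move: (f _) (f _) (f _) => a b f0 A B.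
rewrite !ler_norml => /andP[C _] /andP[D _]; apply/andP; split; nra.
Qed.

Section LieGroupLocal.
Variables (R : realType) (m : nat) (G : topGroupType) (A : set (chart R m G)).
Variables (c : chart R m G).
Hypotheses (lg : lie_group A) (Ac : A c) (c1 : cdom c 1%g).

Let u0 := cmap c 1%g.

Lemma lie_group_mul_continuous : continuous (fun p : G * G => (p.1 * p.2)%g).
Proof. by move=> p; have [_ [H _] _] := lg; exact: H. Qed.

Lemma lie_group_inv_continuous : continuous (fun x : G => x^-1%g).
Proof. by move=> p; have [_ _ [H _]] := lg; exact: H. Qed.

Lemma lie_group_chart d : A d -> is_chart d.
Proof. by move=> Ad; have [[_ _ /atlas_chart H] _ _] := lg; exact: H. Qed.

Lemma mul_coord_domain d1 d2 e p q : A d1 -> A d2 -> A e ->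
  cdom d1 p -> cdom d2 q -> cdom e (p * q)%g ->
  exists W : set 'rV[R]_(m + m),
  [/\ open W, W (row_mx (cmap d1 p) (cmap d2 q)),
    smooth_on W (fun z => cmap e (cinv d1 (lsubmx z) * cinv d2 (rsubmx z))%g) &
    forall z, W z -> [/\ crange d1 (lsubmx z), crange d2 (rsubmx z)
      & cdom e (cinv d1 (lsubmx z) * cinv d2 (rsubmx z))%g]].
Proof.
move=> Ad1 Ad2 Ae dp dq epq.
have h1 := lie_group_chart Ad1; have h2 := lie_group_chart Ad2.
have he := lie_group_chart Ae.
have hcc := prod_chart_is_chart h1 h2.
pose O := (fun p : G * G => (p.1 * p.2)%g) @^-1` cdom e.
have oO : open O by apply: open_comp (chart_open he) => x _; exact: lie_group_mul_continuous.
exists (cmap (prod_chart d1 d2) @` (cdom (prod_chart d1 d2) `&` O)); split.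
- exact: chart_image_open.
- by exists (p, q).
- have [_ [_ H] _] := lg; have := H (prod_chart d1 d2) e; rewrite setIT; apply => //.
  by exists d1 => //; exists d2.
- move=> _ [[x y] [[/= cx cy] Oxy] <-] /=; rewrite row_mxKl row_mxKr !chart_mapK//.
  by split=> //; [exists x|exists y].
Qed.

Lemma local_mul_domain : exists W : set 'rV[R]_(m + m),
  [/\ open W, smooth_on W (local_mul c), W (row_mx u0 u0) &
    forall z, W z -> [/\ crange c (lsubmx z), crange c (rsubmx z)
      & cdom c (cinv c (lsubmx z) * cinv c (rsubmx z))%g]].
Proof.
have [|W [oW W0 sW HW]] := @mul_coord_domain c c c 1%g 1%g Ac Ac Ac c1 c1; first by rewrite mulg1.
by exists W.
Qed.

Lemma left_fieldE v (f : G -> R) p l :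
  is_derive u0 v (fun u => f (p * cinv c u)%g) l -> left_field c v f p = l.
Proof.
move=> /is_derive_line H; rewrite /left_field derive1E; apply: is_deriveE.
have -> : (fun t : R => f (p * cinv c (cmap c 1 + t *: v))%g) =
   (fun t : R => f (p * cinv c (t *: v + u0))%g); last exact: H.
by apply/funext => t; rewrite addrC.
Qed.

Variables (W : set 'rV[R]_(m + m)) (rho : R).
Hypotheses (oW : open W) (CMu : Ck_on 2 W (local_mul c)) (rho0 : 0 < rho).
Hypotheses (BW : forall u v, coord_ball c rho u -> coord_ball c rho v -> W (row_mx u v)).
Hypotheses (Wmul : forall z, W z -> [/\ crange c (lsubmx z), crange c (rsubmx z)
  & cdom c (cinv c (lsubmx z) * cinv c (rsubmx z))%g]).

Let Mu := local_mul c.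
Let Bu0 : coord_ball c rho u0.
Proof. by rewrite /coord_ball /= subrr normr0. Qed.

Let frame u x := left_frame Mu u0 u x.

Lemma left_field_coord u v j : coord_ball c rho u ->
  left_field c v (fun q => cmap c q 0 j) (cinv c u) = frame u v 0 j.
Proof.
move=> Bu; apply: left_fieldE.
have -> : (fun u1 => cmap c (cinv c u * cinv c u1)%g 0 j) = (fun u1 => Mu (row_mx u u1) 0 j).
  by apply/funext => u1; rewrite /Mu /local_mul row_mxKl row_mxKr.
have Wu : W (row_mx u u0) by exact: BW.
rewrite /frame (left_frame_coord Bu0 BW CMu) //.
apply: (@is_derive_slicer _ _ _ _ (fun z => Mu z 0 j)); apply: derivableP.
exact: (Ck_on_derivable ((Ck_on_rowP _ _ oW).1 CMu j) Wu).
Qed.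

Variables (g : vectType R) (br : g -> g -> g) (theta : g -> 'rV[R]_m).
Hypothesis lag : lie_algebra_of_group A br c theta.

Lemma smooth_chart_coord d j : A d -> smooth_fun_on A (cdom d) (fun q => cmap d q 0 j).
Proof.
move=> Ad e Ae k.
have [[_ _ /atlas_transition H] _ _] := lg.
have oU : open (cmap e @` (cdom e `&` cdom d)).
  by apply: chart_image_open; [exact: lie_group_chart|exact: chart_open (lie_group_chart Ad)].
exact: (Ck_on_rowP k _ oU).1 (H e d Ae Ad k) j.
Qed.

(** [lag_bracket] is tested on the coordinate functions at 1, where the left frame is the identity.
    A second field differentiates the left frame in its base point, that is, [Mu] in its first
    argument. *)
Lemma bracket_frame x y j : theta (br x y) 0 j =
  'D_(row_mx (theta x) 0) ('D_(row_mx 0 (theta y)) (fun z => Mu z 0 j)) (row_mx u0 u0) -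
  'D_(row_mx (theta y) 0) ('D_(row_mx 0 (theta x)) (fun z => Mu z 0 j)) (row_mx u0 u0).
Proof.
have hc := lie_group_chart Ac; have oB := open_coord_ball (c := c) (t := rho).
have := lag_bracket lag (chart_open hc) (smooth_chart_coord j Ac) x y c1.
have -> : left_field c (theta (br x y)) (fun q => cmap c q 0 j) 1%g = theta (br x y) 0 j.
  have E := left_field_coord (theta (br x y)) j Bu0; rewrite chart_mapK// in E.
  rewrite E /frame (left_frame1 oB Bu0 BW CMu)//.
  move=> v Bv; rewrite /Mu /local_mul row_mxKl row_mxKr chart_mapK// mul1g.
  have [_ + _] := Wmul (BW Bu0 Bv); rewrite row_mxKr => cv.
  by have [] := crangeP hc cv.
have second x' y' : left_field c (theta x') (left_field c (theta y') (fun q => cmap c q 0 j)) 1%g =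
    'D_(row_mx (theta x') 0) ('D_(row_mx 0 (theta y')) (fun z => Mu z 0 j)) (row_mx u0 u0).
  apply: left_fieldE.
  apply: (near_eq_is_derive (f := fun u => frame u (theta y') 0 j)).
    apply: (open_near_eq oB) Bu0 => u Bu.
    by rewrite mul1g left_field_coord.
  exact: (derive_left_frame oW oB Bu0 BW CMu).
by rewrite !second.
Qed.

End LieGroupLocal.

(** * Unimodularity of solvmanifolds *)

Section Quotient.
Variables (R : realType) (G M : topologicalType) (proj : G -> M).
Hypotheses (cM : compact [set: M]) (surj : forall p, exists a, proj a = p).
Hypothesis sections : forall a, exists (U : set M) (s : M -> G),
  [/\ open U, U (proj a), s (proj a) = a &
      forall p, U p -> proj (s p) = p /\ {for p, continuous s}].

(** Each N a is pulled back to M along a local section through a; these open sets cover M, and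
    compactness selects finitely many points a. *)
Lemma quotient_cover (N : G -> set G) : (forall a, open (N a) /\ N a a) ->
  exists l : seq G, forall x, exists2 a, a \in l & exists2 y, proj y = proj x & N a y.
Proof.
move=> oN; pose a p := sval (cid (surj p)).
have pa p : proj (a p) = p by rewrite /a; case: cid.
have sec p : exists h : set M * (M -> G), [/\ open h.1, h.1 p, h.2 p = a p &
    forall q, h.1 q -> proj (h.2 q) = q /\ {for q, continuous h.2}].
  by have [U [s H]] := sections (a p); rewrite pa in H; exists (U, s).
have [h Us] := choice sec.
pose U p := (h p).1; pose s p := (h p).2.
have [p _|D HD] := @compact_subcover M setT (fun p => U p `&` s p @^-1` N (a p)) cM.
  have [oU Up sp Hs] := Us p; have [oNa Na] := oN (a p); split.
    rewrite openE => q [Uq Nq]; apply: filterI; first exact: open_nbhs_nbhs.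
    by apply: (Hs q Uq).2; exact: open_nbhs_nbhs.
  by split=> //; rewrite /preimage /s /= sp.
exists [seq a p | p <- D] => x; have [p pD [Ux Nx]] := HD (proj x) I.
exists (a p); first exact: map_f.
by exists (s p (proj x)) => //; have [_ _ _ /(_ _ Ux)[]] := Us p.
Qed.

(** Composing f with an arbitrary choice of representatives gives a continuous function on M: near
    each point the choice may be replaced by a continuous local section without changing the values,
    as f is constant on fibres. *)
Lemma quotient_max (f : G -> R) (a0 : G) : continuous f ->
  (forall x y, proj x = proj y -> f x = f y) ->
  exists x0, forall x, f x <= f x0.
Proof.
move=> cf finv; pose a p := sval (cid (surj p)).
have pa p : proj (a p) = p by rewrite /a; case: cid.
have ch : continuous (f \o a).
  move=> p; have [U [s [oU Up _ Hs]]] := sections (a p).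
  rewrite pa in Up.
  apply: (@near_eq_continuous_at _ _ (f \o s)).
    apply: (open_near_eq oU) Up => q Uq /=; apply: finv.
    by rewrite pa (Hs q Uq).1.
  by apply: continuous_comp; [exact: (Hs p Up).2|exact: cf].
have [||p _ Hp] := @compact_EVT_max M R (f \o a) setT _ cM.
- by exists (proj a0).
- exact: continuous_subspaceT.
exists (a p) => x; have := Hp (proj x); rewrite inE => /(_ I).
by rewrite /= (finv (a (proj x)) x)// pa.
Qed.

End Quotient.

Section SolvmanifoldUnimodular.
Variables (R : realType) (n : nat) (g : vectType R) (br : g -> g -> g) (J : 'End(g)).
Variables (G : topGroupType) (A : set (chart R (n + n) G)) (c : chart R (n + n) G).
Variables (theta : g -> 'rV[R]_(n + n)) (Gamma : set G).
Variables (M : topologicalType) (B : set (chart R[i] n M)) (proj : G -> M).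
Hypotheses (brL : lie_bracket br) (csm : complex_solvmanifold br J A c theta Gamma B proj).

Let m := (n + n)%N.

Lemma solvmanifold_sections a : exists (U : set M) (s : M -> G),
  [/\ open U, U (proj a), s (proj a) = a &
      forall p, U p -> proj (s p) = p /\ {for p, continuous s}].
Proof.
have ld : local_diffeomorphism A (real_atlas B) proj by case: csm.
have [U [s [[oU Ua oV] [sK _ sm]]]] := ld a.
have cs : forall p, (proj @` U) p -> {for p, continuous s} by case: sm.
exists (proj @` U), s; split; [exact: oV|by exists a|exact: sK|].
move=> p Vp; split; last exact: cs.
by have [q Uq <-] := Vp; rewrite sK.
Qed.

Let lg := csm_lie_group csm.
Let lag := csm_lie_algebra csm.
Let Ac := lag_chart lag.
Let c1 := lag_dom1 lag.
Let hc := lie_group_chart lg Ac.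
Let u0 := cmap c 1%g.
Let Mu := local_mul c.

Let Mu1l v : crange c v -> Mu (row_mx u0 v) = v.
Proof.
move=> /(crangeP hc)[_ e].
by rewrite /Mu /local_mul row_mxKl row_mxKr chart_mapK// mul1g.
Qed.

Let Mu1r v : crange c v -> Mu (row_mx v u0) = v.
Proof.
move=> /(crangeP hc)[_ e].
by rewrite /Mu /local_mul row_mxKl row_mxKr chart_mapK// mulg1.
Qed.

Lemma trace_ad_frame x (W : set 'rV[R]_(m + m)) (rho : R) :
  open W -> Ck_on 2 W Mu -> 0 < rho ->
  (forall u v, coord_ball c rho u -> coord_ball c rho v -> W (row_mx u v)) ->
  (forall z, W z -> [/\ crange c (lsubmx z), crange c (rsubmx z)
      & cdom c (cinv c (lsubmx z) * cinv c (rsubmx z))%g]) ->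
  lfun_trace (linfun (br x)) = divergence Mu u0 (theta x) u0.
Proof.
move=> oW CMu rho0 BW Wmul.
have oB := @open_coord_ball _ _ _ c rho.
have Bu0 : coord_ball c rho u0 by rewrite /coord_ball /= subrr normr0.
have Mu1 v : coord_ball c rho v -> Mu (row_mx u0 v) = v.
  move=> Bv; apply: Mu1l; have [_ + _] := Wmul _ (BW _ _ Bu0 Bv).
  by rewrite row_mxKr.
have Mu2 v : coord_ball c rho v -> Mu (row_mx v u0) = v.
  move=> Bv; apply: Mu1r; have [+ _ _] := Wmul _ (BW _ _ Bv Bu0).
  by rewrite row_mxKl.
rewrite (divergence1 (theta x) oW oB Bu0 BW CMu Mu1 Mu2).
pose th : {linear g -> 'rV[R]_m} := HB.pack theta (GRing.isLinear.Build _ _ _ _ _ (lag_linear lag)).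
have [th' thK th'K] := lag_bijective lag.
rewrite (@lfun_trace_bijection _ _ _ th th')//; apply: eq_bigr => i _.
have brl : linear (br x) by move=> a y z; rewrite lie_linearr.
pose brL' : {linear g -> g} := HB.pack (br x) (GRing.isLinear.Build _ _ _ _ _ brl).
have -> : linfun (br x) (th' 'e_i) = br x (th' 'e_i) by exact: (lfunE brL').
by rewrite /= (bracket_frame lg Ac c1 oW CMu rho0 BW Wmul lag) th'K.
Qed.

Lemma solvmanifold_trace_le0 x : lfun_trace (linfun (br x)) <= 0.
Proof.
rewrite leNgt; apply/negP => tr0.
have mulc := lie_group_mul_continuous lg; have invc := lie_group_inv_continuous lg.
have dG := csm_discrete csm.
have [I mI invI] := solvable_amenable R (csm_solvable csm).
have [W [oW sW W0 Wmul]] := local_mul_domain lg Ac c1.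
have CMu : Ck_on 2 W Mu by exact: sW.
have : nbhs (row_mx u0 u0) W by exact: open_nbhs_nbhs.
move=> /nbhs_ex_ball [d d0 Hd].
have BW0 u v : coord_ball c d u -> coord_ball c d v -> W (row_mx u v).
  move=> Bu Bv; apply: Hd; rewrite opp_row_mx add_row_mx.
  exact: norm_row_mx_lt.
have oB := @open_coord_ball _ _ _ c d.
have Bu0 : coord_ball c d u0 by rewrite /coord_ball /= subrr normr0.
have trE := trace_ad_frame x oW CMu d0 BW0 Wmul.
have Mu1 v : coord_ball c d v -> Mu (row_mx u0 v) = v.
  move=> Bv; apply: Mu1l; have [_ + _] := Wmul _ (BW0 _ _ Bu0 Bv).
  by rewrite row_mxKr.
have [B1 [[oB1 B1u0 B1B] [Cb Rb cdiv]]] := right_in_left_nbhd (theta x) oW oB Bu0 BW0 CMu Mu1.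
(* The divergence equals the trace at u0 and is continuous there, so it is at least half the trace
   on a whole ball. *)
set k := lfun_trace (linfun (br x)) / 2.
have k0 : 0 < k by rewrite divr_gt0.
have : nbhs u0 (fun u => B1 u /\ k <= divergence Mu u0 (theta x) u).
  apply: filterI; first exact: open_nbhs_nbhs.
  have /cvgrPdist_le /(_ k k0) := cdiv; apply: filterS => u.
  rewrite -trE [X in `|X - _|](splitr _) -/k ler_norml => /andP[_].
  by rewrite lerBlDr lerD2l.
move=> /nbhs_ex_ball [rho rho0 Hrho].
have rB1 u : coord_ball c rho u -> B1 u by move=> /Hrho[].
have BW u v : `|u0 - u| < rho -> `|u0 - v| < rho -> W (row_mx u v).
  by move=> /rB1/B1B Bu /rB1/B1B Bv; exact: BW0.
pose s := rho / 2; pose r := rho / 4.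
have r0 : 0 < r by rewrite divr_gt0.
have rs : r < s by rewrite /r /s; lra.
have srho : s < rho by rewrite /s; lra.
have oBr := @open_coord_ball _ _ _ c rho.
pose phi := bump_fun u0 r.
have Cphi : Ck_on 1 (coord_ball c rho) phi by exact: Ck_on_bump.
have C0phi : Ck_on 0 (coord_ball c rho) phi by exact: Ck_on_pred.
have phi0 u : r < `|u0 - u| -> phi u = 0 by exact: bump_out.
have phige u : 0 <= phi u by exact: bump_ge0.
pose Phi p := translate_mean Gamma I p (chart_ext c s phi).
have cPhi : continuous Phi.
  by apply: (translate_mean_continuous mulc invc dG mI hc r0 rs srho BW Wmul C0phi phi0).
have PhiG p y : Gamma y -> Phi (p * y)%g = Phi p.
  move=> Gy; rewrite /Phi /translate_mean -(gamma_mean_left dG I (fun z => chart_ext c s phi (p * z)%g) Gy).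
  by congr (gamma_mean _ _ _); apply/funext => z; rewrite mulgA.
(* [Phi] is invariant under right multiplication by Gamma, whereas the fibres of [proj] are the sets
   Gamma a; inversion exchanges the two sides. *)
have [q0 Hq0] : exists q0, forall q, (Phi \o monoid.inv) q <= (Phi \o monoid.inv) q0.
  apply: (@quotient_max R G M proj (csm_compact csm) (csm_surjective csm) solvmanifold_sections) => [||a b].
  - exact: 1%g.
  - by move=> q; apply: continuous_comp; [exact: invc|exact: cPhi].
  - move=> /(csm_fibers csm)[y Gy ->] /=; rewrite invgM PhiG//.
    by rewrite -div1g; apply: dG.1.2 => //; case: dG => -[].
have Hp0 p : Phi p <= Phi (q0^-1)%g by have := Hq0 (p^-1)%g; rewrite /= invgK.
set p0 := (q0^-1)%g in Hp0.
have Dmax := max_derive0 _ (left_translate_derive mulc invc dG mI hc c1 oW r0 rs srho BW Wmul CMu p0 (theta x) Cphi phi0).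
have tm0 : translate_mean Gamma I p0 (chart_ext c s (fun u => 'D_(right_frame Mu u0 u (theta x)) phi u)) = 0.
  apply: Dmax => t; rewrite !translate_mean_left scale0r addr0 chart_mapK// mul1g.
  exact: Hp0.
have Ineq := @divergence_inequality _ _ _ _ c mulc invc dG I mI invI hc c1 W rho s r oW r0 rs srho BW Wmul CMu
   p0 phi (right_in_left Mu u0 (theta x)) (theta x) k Cphi phi0 phige
   (Ck_on_subset rB1 Cb) (fun u Bu => Rb u (rB1 u Bu)) (fun u Bu => (Hrho u Bu).2).
(* As k > 0, the maximum of [Phi] is at most 0; it remains to find a point where [Phi] is
   positive. *)
rewrite tm0 oppr0 pmulr_rle0// in Ineq.
pose e := phi u0 / 2.
have phi1 : 0 < phi u0 by exact: bump_gt0.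
have e0 : 0 < e by rewrite divr_gt0.
pose O := chart_interior c s `&` (cdom c `&` cmap c @^-1` (coord_ball c rho `&` phi @^-1` [set t | e < t])).
have oO : open O.
  apply: openI; first exact: open_chart_interior.
  apply: chart_preimage_open => //; rewrite openE => u [Bu eu]; apply: filterI.
    exact: open_nbhs_nbhs.
  apply: (Ck_on_continuous C0phi Bu); apply: open_nbhs_nbhs; split=> //.
have O1 : O 1%g.
  have s0 : 0 < s by exact: lt_trans rs.
  split; first by split=> //=; rewrite /coord_ball /= subrr normr0.
  split=> //; split; first by rewrite /coord_ball /= subrr normr0.
  by rewrite /= /e ltr_pdivrMr// ltr_pMr// ltr1n.
(* Finitely many translates a O meet every fibre, and on O the bump exceeds half of its central
   value; this is the input of [translate_mean_gt0], with the inverses a^-1 as translations. *)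
have [a|l Hl] := @quotient_cover _ _ proj (csm_compact csm) (csm_surjective csm) solvmanifold_sections
   (fun a => (fun y => (a^-1 * y)%g) @^-1` O).
  split; last by rewrite /= mulVg.
  by apply: (open_comp _ oO) => y _; exact: (mulg_continuousl mulc).
have [p Pp] : exists p, 0 < Phi p.
  apply: (translate_mean_gt0 mulc invc dG mI hc r0 rs srho BW Wmul (l := [seq (a^-1)%g | a <- l]) C0phi phige e0).
  move=> z; have [a al [y /esym /(csm_fibers csm)[y' Gy' ->] [[_ /ltW Iy] [cy [_ /ltW ey]]]]] := Hl z.
  by exists y' => //; exists (a^-1)%g; [exact: map_f|].
by have := lt_le_trans Pp (le_trans (Hp0 p) Ineq); rewrite ltxx.
Qed.

(** The maximum argument excludes one sign only; the other follows from - x, since the trace is odd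
    in x. *)
Theorem solvmanifold_unimodular : unimodular br.
Proof.
move=> x; apply/eqP; rewrite eq_le solvmanifold_trace_le0 /=.
have := solvmanifold_trace_le0 (- x).
have -> : linfun (br (- x)) = - linfun (br x).
  have brl y : linear (br y) by move=> a u v; rewrite lie_linearr.
  pose brL' y : {linear g -> g} := HB.pack (br y) (GRing.isLinear.Build _ _ _ _ _ (brl y)).
  apply/lfunP => y; rewrite opp_lfunE; rewrite (lfunE (brL' (- x))) (lfunE (brL' x)) /=.
  have := lie_linearl brL (-1) x 0 y; rewrite scaleN1r addr0 => ->.
  have := lie_linearl brL 1 0 0 y; rewrite scale1r addr0 scale1r => /eqP.
  by rewrite -subr_eq subrr => /eqP <-; rewrite addr0 scaleN1r.
set f := linfun (br x); rewrite /lfun_trace; set b := vbasis _.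
pose ML : {linear 'End(g) -> 'M[R]_(\dim {:g})} := HB.pack (passmx.mxof b b)
  (GRing.isLinear.Build _ _ _ _ _ (passmx.mxof_linear b b)).
have -> : passmx.mxof b b (- f) = - passmx.mxof b b f by exact: (linearN ML).
have -> : \tr (- passmx.mxof b b f) = - \tr (passmx.mxof b b f).
  by rewrite /mxtrace -sumrN; apply: eq_bigr => i _; rewrite mxE.
by rewrite oppr_le0.
Qed.

End SolvmanifoldUnimodular.

(** * Closed (n, 0)-forms *)

Section AdaptedBasis.
Variables (R : realType) (g : vectType R) (br : g -> g -> g) (J : 'End(g)).
Hypotheses (brL : lie_bracket br) (acs : abelian_complex_structure br J).

Let JJ x : J (J x) = - x. Proof. exact: acs_square acs x. Qed.

(** The span U of the vectors chosen so far is stable under J. For x outside U, a relation x = a J x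
    + u with u in U implies, after applying J once more, that (1 + a^2) x lies in U, and 1 + a^2 is
    nonzero over the reals. *)
Lemma adapted_free (n : nat) : \dim {:g} = (2 * n)%N -> forall k, (k <= n)%N ->
  exists s : seq g, size s = k /\ free (s ++ map J s).
Proof.
move=> dimg; elim=> [|k IHk] kn.
  by exists [::]; split=> //; exact: nil_free.
have [s [sk fs]] := IHk (ltnW kn).
set L := s ++ map J s in fs; pose U := <<L>>%VS.
have dU : \dim U = (2 * k)%N by rewrite (eqP fs) size_cat size_map sk mul2n addnn.
have [x xU] : exists x, x \notin U.
  have /subvPn[x _ xU] : ~~ ({:g} <= U)%VS; last by exists x.
  apply/negP => /dimvS; rewrite dU dimg leq_mul2l /= leqNgt => /negP; exact.
have JU y : y \in U -> J y \in U.
  move=> yU; rewrite /U; have := memv_img J yU; rewrite limg_span.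
  apply/subvP; apply/span_subvP => z /mapP[w + ->].
  rewrite mem_cat => /orP[ws|/mapP[v vs ->]]; first by apply/memv_span; rewrite mem_cat map_f ?orbT.
  by rewrite JJ rpredN memv_span// mem_cat vs.
exists (x :: s); split; first by rewrite /= sk.
have Jx : J x \notin U.
  by apply: contra xU => /JU; rewrite JJ rpredN.
have P : perm_eq (x :: s ++ J x :: map J s) [:: x, J x & L].
  by rewrite perm_cons -cat1s perm_catCA.
rewrite /= (perm_free P) free_cons free_cons fs Jx !andbT.
rewrite span_cons; apply/negP => /memv_addP[_ /vlineP[a ->] [u uU xE]].
have E : (1 + a ^+ 2) *: x \in U.
  have Jx2 : J x = - (a *: x) + J u by rewrite {1}xE linearD linearZ /= JJ scalerN.
  have x2 : x = - (a ^+ 2 *: x) + (a *: J u + u).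
    by rewrite {1}xE Jx2 scalerDr scalerN scalerA -expr2 addrA.
  have -> : (1 + a ^+ 2) *: x = a *: J u + u.
    by rewrite scalerDl scale1r {1}x2 addrAC addNr add0r.
  by apply: rpredD => //; apply: rpredZ; exact: JU.
have a0 : 1 + a ^+ 2 != 0 by rewrite gt_eqF// ltr_wpDr// sqr_ge0.
by move: E; rewrite rpredZeq (negPf a0) (negPf xU).
Qed.

Record adapted_coframe (n : nat) (X : 'I_n -> g) (gam : 'I_n -> g -> R[i]) : Prop := AdaptedCoframe {
  coframe_form : forall k, form10 J (gam k);
  coframe_dual : forall k l, gam k (X l) = (k == l)%:R;
  coframe_basis : forall x, x = \sum_k (complex.Re (gam k x) *: X k + complex.Im (gam k x) *: J (X k)) }.

Lemma adapted_coframe_exists (n : nat) : \dim {:g} = (2 * n)%N ->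
  exists X gam, @adapted_coframe n X gam.
Proof.
move=> dimg; have [s [sn fs]] := adapted_free dimg (leqnn n).
have szb : size (s ++ map J s) == (n + n)%N by rewrite size_cat size_map sn.
pose b : (n + n).-tuple g := Tuple szb.
have fb : free b by [].
have bb : basis_of {:g} b.
  by rewrite basisEfree fb subvf dimg size_tuple mul2n addnn leqnn.
pose X (k : 'I_n) := s`_k.
have bl k : b`_(lshift n k) = X k.
  by rewrite /= nth_cat sn ltn_ord.
have brr k : b`_(rshift n k) = J (X k).
  by rewrite /= nth_cat sn ltnNge leq_addr /= addKn (nth_map 0) ?sn.
pose gam (k : 'I_n) x : R[i] := (coord b (lshift n k) x +i* coord b (rshift n k) x)%C.
have gD k x y : gam k (x + y) = gam k x + gam k y by rewrite /gam !linearD.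
have gZ k (a : R) x : gam k (a *: x) = a%:C%C * gam k x.
  by rewrite /gam !linearZ /=; apply/eqP; rewrite eq_complex /= !mul0r subr0 addr0 !eqxx.
have basis x : x = \sum_k (complex.Re (gam k x) *: X k + complex.Im (gam k x) *: J (X k)).
  have := coord_basis bb (memvf x); rewrite big_split_ord /= => {1}->.
  by rewrite big_split /=; congr (_ + _); apply: eq_bigr => k _; rewrite ?bl ?brr.
have gX k l : gam k (X l) = (k == l)%:R.
  rewrite /gam -bl !coord_free// eq_lshift eq_lrshift eq_sym.
  by apply/eqP; rewrite eq_complex; case: (k == l); rewrite /= !eqxx.
have gJX k l : gam k (J (X l)) = 'i%C * (k == l)%:R.
  rewrite /gam -brr !coord_free// eq_rshift eq_rlshift eq_sym.
  by case: (k == l); apply/eqP; rewrite eq_complex /=; apply/andP; split; apply/eqP; ring.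
have g0 k : gam k 0 = 0 by have := gZ k 0 0; rewrite scale0r mul0r.
have gsum k (F : 'I_n -> g) : gam k (\sum_l F l) = \sum_l gam k (F l).
  exact: (big_morph _ (gD k) (g0 k)).
exists X, gam; split=> // k; split=> // x.
rewrite [in LHS](basis x) linear_sum gsum [in RHS](basis x) gsum mulr_sumr.
apply: eq_bigr => l _; rewrite linearD !linearZ /= JJ scalerN -scaleNr !gD !gZ gX gJX.
rewrite mulrDr; case: (k == l); last by rewrite !mulr0 !addr0.
by apply/eqP; rewrite eq_complex /=; apply/andP; split; apply/eqP; ring.
Qed.

Section Coframe.
Variables (n : nat) (X : 'I_n -> g) (gam : 'I_n -> g -> R[i]).
Hypothesis cof : adapted_coframe X gam.

Lemma form10_0 (f : g -> R[i]) : form10 J f -> f 0 = 0.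
Proof. by move=> [_ fZ _]; have := fZ 0 0; rewrite scale0r mul0r. Qed.

Lemma form10N (f : g -> R[i]) x : form10 J f -> f (- x) = - f x.
Proof. by move=> [_ fZ _]; rewrite -scaleN1r fZ rmorphN1 mulN1r. Qed.

Lemma form10_expand (f : g -> R[i]) x : form10 J f -> f x = \sum_k f (X k) * gam k x.
Proof.
move=> hf; have [fD fZ fJ] := hf; rewrite {1}(coframe_basis cof x).
rewrite (big_morph f fD (form10_0 hf)); apply: eq_bigr => k _.
rewrite fD !fZ fJ mulrA -mulrDl mulrC; congr (_ * _).
by case: (gam k x) => a b; apply/eqP; rewrite eq_complex /=; apply/andP; split; apply/eqP; ring.
Qed.

Lemma lie_brNr x y : br x (- y) = - br x y.
Proof.
have br0 : br x 0 = 0.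
  have := lie_linearr brL 1 x 0 0; rewrite !scale1r addr0 => /eqP.
  by rewrite eq_sym -subr_eq0 addrK => /eqP.
by have := lie_linearr brL (-1) x y 0; rewrite br0 !addr0 !scaleN1r.
Qed.

Lemma abelian_brJl x y : br (J x) y = - br x (J y).
Proof. by rewrite -lie_brNr -(acs_abelian acs x (- J y)) linearN /= JJ opprK. Qed.

(** Twice the complex trace of the C-linear part y |-> ([x, y] - J [x, J y]) / 2 of ad x. This
    explains why its real part is the real trace of ad x: the antilinear part of an endomorphism has
    real trace zero. *)
Definition antilinear_trace (x : g) : R[i] :=
  \sum_k (gam k (br x (X k)) - 'i%C * gam k (br x (J (X k)))).

Lemma antilinear_traceJ x :
  antilinear_trace (J x) = \sum_k (gam k (br (J x) (X k)) - 'i%C * gam k (br x (X k))).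
Proof. by apply: eq_bigr => k _; rewrite acs_abelian. Qed.

Lemma antilinear_trace_anti x : antilinear_trace (J x) = - 'i%C * antilinear_trace x.
Proof.
rewrite antilinear_traceJ mulr_sumr; apply: eq_bigr => k _.
rewrite abelian_brJl form10N; last exact: coframe_form cof k.
have ii : 'i%C * 'i%C = -1 :> R[i].
  by apply/eqP; rewrite eq_complex /=; apply/andP; split; apply/eqP; ring.
set q := gam k (br x (J (X k))); set p := gam k (br x (X k)).
have -> : - 'i%C * (p - 'i%C * q) = - ('i%C * p) + ('i%C * 'i%C) * q by ring.
by rewrite ii mulN1r addrC.
Qed.

Let to_row (x : g) : 'rV[R]_(n + n) :=
  row_mx (\row_k complex.Re (gam k x)) (\row_k complex.Im (gam k x)).

Let of_row (u : 'rV[R]_(n + n)) : g :=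
  \sum_k (u 0 (lshift n k) *: X k + u 0 (rshift n k) *: J (X k)).

Let gamD k x y : gam k (x + y) = gam k x + gam k y.
Proof. by have [H _ _] := coframe_form cof k. Qed.
Let gamZ k (a : R) x : gam k (a *: x) = a%:C%C * gam k x.
Proof. by have [_ H _] := coframe_form cof k. Qed.
Let gamJ k x : gam k (J x) = 'i%C * gam k x.
Proof. by have [_ _ H] := coframe_form cof k. Qed.
Let gam0 k : gam k 0 = 0. Proof. exact: form10_0 (coframe_form cof k). Qed.

Let to_row_linear : linear to_row.
Proof.
move=> a x y; rewrite /to_row scale_row_mx add_row_mx; congr row_mx;
  apply/rowP => k; rewrite !mxE gamD gamZ; case: (gam k x) => p q;
  case: (gam k y) => p' q' /=; ring.
Qed.

Let gam_of_row k u : gam k (of_row u) = (u 0 (lshift n k) +i* u 0 (rshift n k))%C.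
Proof.
rewrite /of_row (big_morph _ (gamD k) (gam0 k)) (bigD1 k)//= big1 ?addr0 => [|l lk].
  rewrite gamD !gamZ gamJ (coframe_dual cof) eqxx.
  by apply/eqP; rewrite eq_complex /=; apply/andP; split; apply/eqP; ring.
by rewrite gamD !gamZ gamJ (coframe_dual cof) eq_sym (negPf lk) !mulr0 addr0.
Qed.

Lemma Re_antilinear_trace x : complex.Re (antilinear_trace x) = lfun_trace (linfun (br x)).
Proof.
pose th : {linear g -> 'rV[R]_(n + n)} := HB.pack to_row (GRing.isLinear.Build _ _ _ _ _ to_row_linear).
have thK : cancel th of_row.
  move=> y; rewrite [RHS](coframe_basis cof); apply: eq_bigr => k _.
  by rewrite /= /to_row row_mxEl row_mxEr !mxE.
have of_rowK : cancel of_row th.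
  move=> u; apply/rowP => j; rewrite /= /to_row.
  by case: (split_ordP j) => k ->; rewrite ?row_mxEl ?row_mxEr mxE gam_of_row.
rewrite (lfun_trace_bijection _ thK of_rowK) big_split_ord /=.
have brl : linear (br x) by move=> a y z; rewrite lie_linearr.
pose brL' : {linear g -> g} := HB.pack (br x) (GRing.isLinear.Build _ _ _ _ _ brl).
have lE y : linfun (br x) y = br x y by exact: (lfunE brL').
have oX k : of_row 'e_(lshift n k) = X k.
  apply: (can_inj thK); rewrite of_rowK; apply/rowP => j; rewrite /= /to_row.
  case: (split_ordP j) => l ->; rewrite ?row_mxEl ?row_mxEr !mxE (coframe_dual cof) ?eq_lshift ?eq_rlshift.
    by case: (l == k).
  by case: (l == k).
have oJX k : of_row 'e_(rshift n k) = J (X k).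
  apply: (can_inj thK); rewrite of_rowK; apply/rowP => j; rewrite /= /to_row.
  case: (split_ordP j) => l ->; rewrite ?row_mxEl ?row_mxEr !mxE gamJ (coframe_dual cof) ?eq_lrshift ?eq_rshift.
    by case: (l == k) => /=; ring.
  by case: (l == k) => /=; ring.
rewrite /antilinear_trace raddf_sum -big_split /=; apply: eq_bigr => k _.
rewrite !lE oX oJX /to_row row_mxEl row_mxEr !mxE.
by case: (gam k _) => p q; case: (gam k _) => p' q' /=; ring.
Qed.

(** T (J x) = - i T x has the imaginary part of T x as its real part, so the traces of ad x and of
    ad (J x) together determine T x. *)
Lemma unimodular_antilinear_trace : unimodular br <-> forall x, antilinear_trace x = 0.
Proof.
split=> [um x|T0 x]; last by rewrite -Re_antilinear_trace T0.
have := antilinear_trace_anti x; have := um x; have := um (J x).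
rewrite -!Re_antilinear_trace; case: (antilinear_trace x) => p q /= + ->.
move=> + E; rewrite E /= => H; apply/eqP; rewrite eq_complex /= eqxx /=.
by apply/eqP; rewrite -H; ring.
Qed.

End Coframe.
End AdaptedBasis.

(** * Determinants of families with two members omitted *)

Section DeterminantFamilies.
Variables (K : comNzRingType) (n : nat).
Implicit Types (i j : 'I_n.+2).

Lemma lift_lift_val i j (i' j' : 'I_n.+1) (l : 'I_n) : (i < j)%N ->
  i' = i :> nat -> j = j'.+1 :> nat -> lift i (lift j' l) = lift j (lift i' l).
Proof.
by move=> ij ii jj; apply/val_inj; rewrite /= /bump; lia.
Qed.

Lemma filter_enum_lift i j (i' : 'I_n.+1) : (i < j)%N -> i' = i :> nat ->
  [seq l <- enum 'I_n.+2 | (l != i) && (l != j)] = [seq lift j (lift i' k) | k <- enum 'I_n].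
Proof.
move=> ij ii; pose lt (m : nat) := relpre (@nat_of_ord m) ltn.
have enumS m : sorted (lt m) (enum 'I_m) by rewrite -sorted_map val_enum_ord iota_ltn_sorted.
have ltT m : transitive (lt m) by move=> a b c; exact: ltn_trans.
apply: (irr_sorted_eq (ltT n.+2)) => [a||| l]; first exact: ltnn.
- exact: (sorted_filter (@ltT _)) (enumS _).
- rewrite sorted_map; apply: sub_sorted (enumS n) => a b; rewrite /lt /= /bump; lia.
rewrite mem_filter mem_enum andbT; apply/idP/mapP => [/andP[li lj]|[k _ ->]].
  case: (unliftP j l) lj li => [l1 ->|->]; last by rewrite eqxx.
  move=> _ li; case: (unliftP i' l1) li => [k ->|-> /eqP[]]; first by exists k; rewrite ?mem_enum.
  by apply/val_inj; rewrite /= /bump; lia.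
by rewrite -!val_eqE /= /bump; lia.
Qed.

(** Deleting column i after j, or column j after i, leaves the same columns. Once i < j is gone, j
    has index j' = j - 1, while i keeps its index when j goes first; this accounts for the two
    signs. *)
Lemma cofactor_delete (V : 'M[K]_(n.+1, n.+2)) (N : 'M[K]_n.+1) i j (i' j' : 'I_n.+1) k :
  (i < j)%N -> i' = i :> nat -> j = j'.+1 :> nat ->
  (forall r l, N r (lift ord0 l) = V r (lift j (lift i' l))) ->
  cofactor N k ord0 = (-1) ^+ i' * cofactor (col' j V) k i' /\
  cofactor N k ord0 = (-1) ^+ j' * cofactor (col' i V) k j'.
Proof.
move=> ij ii jj NV; rewrite /cofactor addn0 !mulrA -!exprD.
have sg (a : nat) : (-1) ^+ (a + (k + a)) = (-1) ^+ k :> K.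
  by rewrite addnCA exprD addnn -mul2n exprM sqrrN expr1n expr1n mulr1.
rewrite !sg; split; congr (_ * \det _); apply/matrixP => r l; rewrite !mxE NV//.
by rewrite (lift_lift_val _ ij ii jj).
Qed.

End DeterminantFamilies.

Section FamilyDeterminant.
Variables (K : comNzRingType).

Lemma size_filter_pair n (i j : 'I_n.+1) (i' : 'I_n) : (i < j)%N -> i' = i :> nat ->
  size [seq l <- enum 'I_n.+1 | (l != i) && (l != j)] = n.-1.
Proof.
case: n i j i' => [|n] i j i' ij ii; first by have := ltn_ord i'.
by rewrite (filter_enum_lift ij ii) size_map size_enum_ord.
Qed.

(** A bracket in column 0 will be split into two terms, one attached to i and one to j. The same
    cofactors along that column are therefore expressed both through V without column j and through
    V without column i. *)
Lemma det_family n (V : 'M[K]_(n, n.+1)) (N : 'M[K]_n) (b : 'I_n -> K)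
    (i j : 'I_n.+1) (i' j' : 'I_n) :
  (i < j)%N -> i' = i :> nat -> j = j'.+1 :> nat ->
  (forall k (l : 'I_n), l = 0%N :> nat -> N k l = b k) ->
  (forall k (l : 'I_n), (0 < l)%N ->
     N k l = V k (nth i [seq l <- enum 'I_n.+1 | (l != i) && (l != j)] l.-1)) ->
  exists c : 'I_n -> K, [/\ \det N = \sum_k b k * c k,
    forall k, c k = (-1) ^+ i' * cofactor (col' j V) k i'
    & forall k, c k = (-1) ^+ j' * cofactor (col' i V) k j'].
Proof.
case: n V N b i j i' j' => [|n] V N b i j i' j' ij ii jj N0 NS.
  by have := ltn_ord i'.
have H k := @cofactor_delete K n V N i j i' j' k ij ii jj _.
have NV r l : N r (lift ord0 l) = V r (lift j (lift i' l)).
  rewrite NS// (filter_enum_lift ij ii).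
  have -> : (lift ord0 l).-1 = l :> nat by [].
  by rewrite (nth_map l) ?size_enum_ord// nth_ord_enum.
have E : \det N = \sum_k N k ord0 * cofactor N k ord0 := expand_det_col N ord0.
exists (fun k => cofactor N k ord0); split=> [|k|k].
- by rewrite E; apply: eq_bigr => k _; rewrite N0.
- by rewrite (H NV k).1.
- by rewrite (H NV k).2.
Qed.

End FamilyDeterminant.

Section PairSums.
Variables (K : zmodType) (n : nat).

Lemma sum_ordered_pairs (F : 'I_n -> 'I_n -> K) :
  \sum_(i < n) \sum_(j < n | (i < j)%N) (F i j + F j i) =
  \sum_(i < n) \sum_(j < n | j != i) F i j.
Proof.
under eq_bigr do rewrite big_split /=.
rewrite big_split /= [X in _ + X](exchange_big_dep xpredT)//= -big_split /=.
apply: eq_bigr => i _; rewrite (bigID (fun j : 'I_n => (i < j)%N) (fun j => j != i)) /=.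
congr (_ + _); apply: eq_bigl => j; rewrite -val_eqE /=; lia.
Qed.

End PairSums.

Section ReplacedColumns.
Variables (K : comNzRingType) (n : nat).

(** The left side replaces the columns of N by those of M N one at a time: it is the derivative at t
    = 0 of det ((1 + t M) N). Algebraically it is the trace of M N adj N, and N adj N is the scalar
    det N. *)
Lemma sum_replaced_columns (M N : 'M[K]_n) :
  \sum_j \sum_k (M *m N) k j * cofactor N k j = \tr M * \det N.
Proof.
have -> : \sum_j \sum_k (M *m N) k j * cofactor N k j = \tr ((M *m N) *m \adj N).
  rewrite exchange_big; apply: eq_bigr => k _; rewrite mxE; apply: eq_bigr => j _.
  by rewrite [\adj N]lock mxE -lock mxE || rewrite !mxE.
by rewrite -mulmxA mul_mx_adj mul_mx_scalar mxtraceZ mulrC.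
Qed.

End ReplacedColumns.

(** * The differential of the form gam_1 /\ ... /\ gam_n *)

Section Differential.
Variables (R : realType) (g : vectType R) (br : g -> g -> g) (J : 'End(g)).
Hypotheses (brL : lie_bracket br) (acs : abelian_complex_structure br J).
Variables (n : nat) (X : 'I_n -> g) (gam : 'I_n -> g -> R[i]).
Hypothesis cof : adapted_coframe J X gam.

Definition coframe_det (x : 'I_n -> g) : R[i] := \det (\matrix_(i < n, j < n) gam i (x j)).

Lemma lie_brC x y : br x y = - br y x.
Proof.
have H u v w : br (u + v) w = br u w + br v w.
  by have := lie_linearl brL 1 u v w; rewrite !scale1r.
have H' u v w : br w (u + v) = br w u + br w v.
  by have := lie_linearr brL 1 w u v; rewrite !scale1r.
have := lie_alternating brL (x + y); rewrite H !H' !(lie_alternating brL) add0r addr0.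
by move/eqP; rewrite addr_eq0 => /eqP.
Qed.

(* The part of gam k [x, y] that is C-linear in y and antilinear in x; gam k [x, y]
   is its alternation. *)
Definition anti_part (x y : g) (k : 'I_n) : R[i] :=
  2^-1 * (gam k (br x y) - 'i%C * gam k (br x (J y))).

Lemma anti_part_form x k : form10 J (fun y => anti_part x y k).
Proof.
have [gD gZ gJ] := coframe_form cof k.
have brD u v : br x (u + v) = br x u + br x v.
  by have := lie_linearr brL 1 x u v; rewrite !scale1r.
have brZ (a : R) u : br x (a *: u) = a *: br x u.
  have := lie_linearr brL a x u 0; rewrite addr0 => ->.
  by have := lie_brNr brL x 0; rewrite oppr0 => /eqP; rewrite -addr_eq0 -mulr2n -scaler_nat scaler_eq0 pnatr_eq0 /= => /eqP ->; rewrite addr0.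
split=> [u v|a u|u]; rewrite /anti_part.
- by rewrite linearD !brD !gD; ring.
- have -> : J (a *: u) = a *: J u by exact: linearZ.
  by rewrite !brZ !gZ; move: (gam k _) (gam k _) (a%:C)%C => p q r; ring.
rewrite (acs_square acs) lie_brNr// (form10N _ (coframe_form cof k)).
have ii : 'i%C * 'i%C = -1 :> R[i].
  by apply/eqP; rewrite eq_complex /=; apply/andP; split; apply/eqP; ring.
set p := gam k _; set q := gam k _.
have -> : 'i%C * (2^-1 * (q - 'i%C * p)) = 2^-1 * ('i%C * q - ('i%C * 'i%C) * p) by ring.
by rewrite ii; ring.
Qed.

Lemma anti_part_decomposition x y k : gam k (br x y) = anti_part x y k - anti_part y x k.
Proof.
rewrite /anti_part -(opprK (br y (J x))) -(lie_brC (J x) y) (abelian_brJl brL acs).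
rewrite opprK (lie_brC y x) (form10N _ (coframe_form cof k)).
by field.
Qed.

Let M (x : g) : 'M[R[i]]_n := \matrix_(k, l) anti_part x (X l) k.

Let M_mul x (y : g) k : anti_part x y k = \sum_l M x k l * gam l y.
Proof.
rewrite (form10_expand cof y (anti_part_form x k)); apply: eq_bigr => l _.
by rewrite mxE.
Qed.

Let trM x : \tr (M x) = 2^-1 * antilinear_trace br J X gam x.
Proof. by rewrite /antilinear_trace mulr_sumr; apply: eq_bigr => k _; rewrite mxE. Qed.

(** By [anti_part_decomposition] each pair i < j contributes one term to i and one to j, so the sum
    becomes one over all ordered pairs of distinct indices. For fixed i, letting j run replaces the
    columns of the family without x i one by one by their images under the matrix of [anti_part] (x
    i), and [sum_replaced_columns] produces its trace, half of the antilinear trace. *)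
Lemma ce_differential_coframe_det (x : 'I_n.+1 -> g) :
  ce_differential br coframe_det x =
  - \sum_(i < n.+1) (-1) ^+ i * (2^-1 * antilinear_trace br J X gam (x i) *
      \det (col' i (\matrix_(k < n, l < n.+1) gam k (x l)))).
Proof.
pose V := \matrix_(k < n, l < n.+1) gam k (x l).
pose al i j k := anti_part (x i) (x j) k.
have alE i (j' : 'I_n) k : al i (lift i j') k = (M (x i) *m col' i V) k j'.
  by rewrite /al M_mul mxE; apply: eq_bigr => l _; congr (_ * _); rewrite !mxE.
have [n0|n0] := posnP n.
  rewrite /ce_differential big1 => [|i _]; last first.
    apply: big_pred0 => j; have := ltn_ord j; have := ltn_ord i; lia.
  rewrite big1 ?oppr0// => i _; rewrite -trM /mxtrace big1 ?mul0r ?mulr0// => k _.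
  by have := ltn_ord k; lia.
(* The contribution of [anti_part] (x i) (x j), put in place of column j in the family without x i;
   the value 0 on the diagonal is a default. *)
pose F (i j : 'I_n.+1) : R[i] := if unlift i j is Some j' then
   (-1) ^+ i * \sum_k al i j k * cofactor (col' i V) k j' else 0.
have -> : ce_differential br coframe_det x = - \sum_(i < n.+1) \sum_(j < n.+1 | (i < j)%N) (F i j + F j i).
  rewrite -sumrN; apply: eq_bigr => i _; rewrite -sumrN; apply: eq_bigr => j ij.
  rewrite /coframe_det; set N := \matrix_(_, _) _.
  have ji : i != j by rewrite -val_eqE /=; lia.
  have [/= j' jE uj] := unlift_some ji.
  have ij' : j != i by rewrite eq_sym.
  have [/= i' iE ui] := unlift_some ij'.
  rewrite /F uj ui.
  have i'i : i' = i :> nat by move: (congr1 val iE); rewrite /= /bump; lia.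
  have jj' : j = j'.+1 :> nat by move: (congr1 val jE); rewrite /= /bump; lia.
  have bE k : gam k (br (x i) (x j)) = al i j k - al j i k by exact: anti_part_decomposition.
  have [co [-> c1 c2]] : exists co : 'I_n -> R[i], [/\ \det N = \sum_k gam k (br (x i) (x j)) * co k,
      forall k, co k = (-1) ^+ i' * cofactor (col' j V) k i'
    & forall k, co k = (-1) ^+ j' * cofactor (col' i V) k j'].
    apply: det_family => // k l l0; rewrite mxE /bracket_family; first by rewrite l0.
    rewrite [V k _]mxE; congr (gam k _).
    case: (nat_of_ord l) (ltn_ord l) l0 => [//|l'] ln _.
    by rewrite /= (nth_map i)// (size_filter_pair ij i'i); lia.
  rewrite !mulr_sumr -big_split /= -sumrN; apply: eq_bigr => k _.
  rewrite bE mulrBl mulrBr {1}c2 c1.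
  have sq (a : nat) : (-1) ^+ a * (-1) ^+ a = 1 :> R[i] by rewrite -exprD addnn -mul2n exprM sqrrN !expr1n.
  have key (e1 e2 C1 C2 a1 a2 : R[i]) : e1 * e1 = 1 -> e2 * e2 = 1 ->
      e1 * (-1 * e2) * (a1 * (e2 * C2)) - e1 * (-1 * e2) * (a2 * (e1 * C1)) =
      - (e1 * (a1 * C2) + -1 * e2 * (a2 * C1)).
    move=> h1 h2; have -> : e1 * (-1 * e2) * (a1 * (e2 * C2)) - e1 * (-1 * e2) * (a2 * (e1 * C1)) =
      - (e1 * (a1 * C2)) * (e2 * e2) + (e2 * (a2 * C1)) * (e1 * e1) by ring.
    by rewrite h1 h2; ring.
  by rewrite exprD jj' exprS -i'i; exact: key.
rewrite sum_ordered_pairs; congr (- _); apply: eq_bigr => i _.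
rewrite -trM mulrA -[(-1) ^+ i * \tr _ * _]mulrA -sum_replaced_columns mulr_sumr.
have -> : \sum_(j < n.+1 | j != i) F i j = \sum_j F i (lift i j).
  have E1 : \sum_j F i j = F i i + \sum_(j < n.+1 | j != i) F i j by rewrite (bigD1 i).
  have E2 : \sum_j F i j = F i i + \sum_j F i (lift i j) by rewrite (bigD1_ord i).
  by apply: (addrI (F i i)); rewrite -E1 E2.
apply: eq_bigr => j' _; rewrite /F liftK; congr (_ * _).
by apply: eq_bigr => k _; rewrite alE.
Qed.

End Differential.

Section ClosedForms.
Variables (R : realType) (g : vectType R) (br : g -> g -> g) (J : 'End(g)).
Hypotheses (brL : lie_bracket br) (acs : abelian_complex_structure br J).
Variables (n : nat) (X : 'I_n -> g) (gam : 'I_n -> g -> R[i]).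
Hypothesis cof : adapted_coframe J X gam.

Lemma coframe_detX : coframe_det gam X = 1.
Proof.
rewrite /coframe_det -(det1 R[i] n); congr (\det _); apply/matrixP => k l.
by rewrite !mxE (coframe_dual cof).
Qed.

(** Each factor is a combination of the gam_l with coefficients its values on X, so every
    determinant splits off [coframe_det] by multiplicativity. *)
Lemma formn0_coframe_det omega : formn0 J omega ->
  exists a : R[i], forall x, omega x = a * coframe_det gam x.
Proof.
move=> [N [a [gamma [hg om]]]].
exists (\sum_k a k * \det (\matrix_(i < n, l < n) gamma k i (X l))) => x.
rewrite om mulr_suml; apply: eq_bigr => k _.
rewrite -mulrA -det_mulmx; congr (_ * \det _); apply/matrixP => i j.
rewrite !mxE (form10_expand cof _ (hg k i)); apply: eq_bigr => l _.
by rewrite !mxE.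
Qed.

Let x_ (y : g) (i : 'I_n.+1) : g := if unlift ord0 i is Some k then X k else y.
Let V (y : g) : 'M[R[i]]_(n, n.+1) := \matrix_(k < n, l < n.+1) gam k (x_ y l).

(** Column 0, which carries y, survives the deletion of a later column; replacing y by J y
    multiplies this column alone by i. *)
Let det_colJ y (i : 'I_n) :
  \det (col' (lift ord0 i) (V (J y))) = 'i%C * \det (col' (lift ord0 i) (V y)).
Proof.
pose d : 'rV[R[i]]_n := \row_l (if l == 0%N :> nat then 'i%C else 1).
have n0 : (0 < n)%N by apply: leq_trans (ltn_ord i).
have -> : col' (lift ord0 i) (V (J y)) = col' (lift ord0 i) (V y) *m diag_mx d.
  rewrite mul_mx_diag; apply/matrixP => k l; rewrite !mxE /x_.
  case: unliftP => [l'|] lE.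
    have -> : (l == 0%N :> nat) = false.
      by move: (congr1 val lE); rewrite /= /bump; lia.
    by rewrite mulr1.
  have -> : (l == 0%N :> nat).
    by move: (congr1 val lE); rewrite /= /bump; lia.
  by have [_ _ ->] := coframe_form cof k; rewrite mulrC.
rewrite det_mulmx det_diag mulrC; congr (_ * _).
rewrite (bigD1 (Ordinal n0))//= mxE eqxx big1 ?mulr1// => k kn.
by rewrite mxE; case: eqP => // k0; case/eqP: kn; apply: val_inj.
Qed.

(* Evaluated at (y, X_1, ..., X_n), closedness equates T y, antilinear in y, with
   an expression that is C-linear in y. *)
Lemma closed_antilinear_trace0 : closed_form br (coframe_det gam) ->
  forall y, antilinear_trace br J X gam y = 0.
Proof.
move=> cl; pose T := antilinear_trace br J X gam.
pose S y := \sum_(i < n) (-1) ^+ (lift ord0 i) *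
  (2^-1 * T (X i) * \det (col' (lift ord0 i) (V y))).
have TS y : 2^-1 * T y = - S y.
  have := cl (x_ y); rewrite (ce_differential_coframe_det brL acs cof).
  rewrite big_ord_recl expr0 mul1r.
  have -> : \det (col' ord0 (\matrix_(k < n, l < n.+1) gam k (x_ y l))) = 1.
    rewrite -[RHS]coframe_detX; congr (\det _); apply/matrixP => k l.
    by rewrite !mxE /x_ liftK.
  rewrite mulr1 {1}/x_ unlift_none => /eqP; rewrite oppr_eq0 addr_eq0 => /eqP ->.
  by congr (- _); apply: eq_bigr => i _; rewrite {1}/x_ liftK.
have SJ y : S (J y) = 'i%C * S y.
  rewrite mulr_sumr; apply: eq_bigr => i _; rewrite det_colJ.
  move: ((-1) ^+ _) (2^-1 * _) (\det _) => e t D.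
  by rewrite !mulrA; congr (_ * _); rewrite mulrC mulrA.
move=> y; have := TS (J y); rewrite SJ -mulrN -TS.
have -> : T (J y) = - 'i%C * T y by exact: antilinear_trace_anti.
have ii : 'i%C * 'i%C = -1 :> R[i].
  by apply/eqP; rewrite eq_complex /=; apply/andP; split; apply/eqP; ring.
rewrite -/(T y); move: ('i%C) ii (T y) => I ii t E.
have : (I * I) * t = 0.
  have -> : (I * I) * t = I * (I * (2^-1 * t)) - I * (2^-1 * (- I * t)) by field.
  by rewrite E subrr.
by rewrite ii mulN1r => /eqP; rewrite oppr_eq0 => /eqP.
Qed.

Theorem closed_formn0_unimodular :
  (exists omega : ('I_n -> g) -> R[i],
      [/\ formn0 J omega, exists x, omega x <> 0 & closed_form br omega])
  <-> unimodular br.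
Proof.
rewrite (unimodular_antilinear_trace brL acs cof); split=> [|T0].
  move=> [omega [/formn0_coframe_det[a om] [x0 nz] cl]].
  have a0 : a != 0 by apply/eqP => a0; apply: nz; rewrite om a0 mul0r.
  apply: closed_antilinear_trace0 => x; apply: (mulfI a0); rewrite mulr0 -(cl x).
  rewrite /ce_differential mulr_sumr; apply: eq_bigr => i _.
  by rewrite mulr_sumr; apply: eq_bigr => j _; rewrite om mulrCA.
exists (coframe_det gam); split.
- exists 1%N, (fun=> 1), (fun=> gam); split=> [_ k|x]; first exact: coframe_form cof k.
  by rewrite big_ord1 mul1r.
- by exists X; rewrite coframe_detX; apply/eqP; exact: oner_neq0.
move=> x; rewrite (ce_differential_coframe_det brL acs cof) big1 ?oppr0// => i _.
by rewrite T0 mulr0 mul0r mulr0.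
Qed.

End ClosedForms.

(** * Smooth functions on a Lie group *)

Section SmoothFunctions.
Variables (R : realType) (m : nat) (G : topGroupType) (A : set (chart R m G)).
Variables (c : chart R m G).
Hypotheses (lg : lie_group A) (Ac : A c) (c1 : cdom c 1%g).

Let u0 := cmap c 1%g.
Let mulc := lie_group_mul_continuous lg.

Lemma derive_line (V : normedModType R) (f : 'rV[R]_m -> V) (x v : 'rV[R]_m) :
  derive1 (fun t : R => f (x + t *: v)) 0 = 'D_v f x.
Proof.
rewrite /derive1 /derive.
have -> : (fun h : R => h^-1 *: (f (x + (h + 0) *: v) - f (x + 0 *: v))) =
  (fun h : R => h^-1 *: ((f \o shift x) (h *: v) - f x)); last by [].
by apply/funext => h /=; rewrite addr0 scale0r addr0 [h *: v + x]addrC.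
Qed.

Lemma left_field_derive v (f : G -> R) p :
  left_field c v f p = 'D_v (fun u => f (p * cinv c u)%g) u0.
Proof. by rewrite /left_field (derive_line (fun u => f (p * cinv c u)%g)). Qed.

Lemma Ck_on_slice_at p q k (W : set 'rV[R]_(p + q)) (F : 'rV[R]_(p + q) -> R) (u : 'rV[R]_p) (v : 'rV[R]_q) :
  open W -> Ck_on k W F -> W (row_mx u v) ->
  (exists U, [/\ open U, U u, forall x, U x -> W (row_mx x v) & Ck_on k U (fun x => F (row_mx x v))]) /\
  (exists U, [/\ open U, U v, forall y, U y -> W (row_mx u y) & Ck_on k U (fun y => F (row_mx u y))]).
Proof.
move=> oW CF Wuv; split.
  pose emb (x : 'rV[R]_p) := row_mx x v.
  have oU : open (emb @^-1` W).
    by apply: open_comp oW => x _; apply: row_mx_continuous_at => //; exact: cst_continuous.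
  exists (emb @^-1` W); split=> //.
  apply: (@Ck_on_comp _ _ _ _ _ W F emb) => //.
  apply: Ck_on_ext (Ck_on_affine k _ (row_mx 1%:M 0) (row_mx 0 v)) => // x _.
  by rewrite -row_mx_affinel.
pose emb (y : 'rV[R]_q) := row_mx u y.
have oU : open (emb @^-1` W).
  by apply: open_comp oW => x _; apply: row_mx_continuous_at => //; exact: cst_continuous.
exists (emb @^-1` W); split=> //.
apply: (@Ck_on_comp _ _ _ _ _ W F emb) => //.
apply: Ck_on_ext (Ck_on_affine k _ (row_mx 0 1%:M) (row_mx u 0)) => // y _.
by rewrite -row_mx_affiner.
Qed.

(** Two charts are needed because p may be anywhere in G while the second factor will stay near
    1. *)
Lemma smooth_fun_mul (U : set G) (f : G -> R) d1 d2 p q k : open U ->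
  smooth_fun_on A U f -> A d1 -> A d2 -> cdom d1 p -> cdom d2 q -> U (p * q)%g ->
  exists W : set 'rV[R]_(m + m),
  [/\ open W, W (row_mx (cmap d1 p) (cmap d2 q)),
    Ck_on k W (fun z => f (cinv d1 (lsubmx z) * cinv d2 (rsubmx z))%g) &
    forall z, W z -> [/\ crange d1 (lsubmx z), crange d2 (rsubmx z)
      & U (cinv d1 (lsubmx z) * cinv d2 (rsubmx z))%g]].
Proof.
move=> oU sf Ad1 Ad2 dp dq Upq.
have [[_ _ /atlas_cover cov] _ _] := lg; have [e Ae epq] := cov (p * q)%g.
have h1 := lie_group_chart lg Ad1; have h2 := lie_group_chart lg Ad2.
have he := lie_group_chart lg Ae.
have [W [oW Wpq sW HW]] := mul_coord_domain lg Ad1 Ad2 Ae dp dq epq.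
pose mu (z : 'rV[R]_(m + m)) := cmap e (cinv d1 (lsubmx z) * cinv d2 (rsubmx z))%g.
have oE : open (cmap e @` (cdom e `&` U)) by exact: chart_image_open.
have cmu z : W z -> {for z, continuous mu} by move=> Wz; exact: Ck_on_continuous (sW 0%N) Wz.
pose W' := W `&` mu @^-1` (cmap e @` (cdom e `&` U)).
have oW' : open W'.
  rewrite openE => z [Wz Ez]; apply: filterI; first exact: open_nbhs_nbhs.
  by apply: cmu => //; exact: open_nbhs_nbhs.
have UW' z : W' z -> U (cinv d1 (lsubmx z) * cinv d2 (rsubmx z))%g.
  move=> [Wz [y [ey Uy] E]]; have [_ _ ez] := HW z Wz.
  by rewrite -(chart_mapK he ez) -/(mu z) -E (chart_mapK he ey).
exists W'; split=> //.
- split=> //; exists (p * q)%g => //.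
  by rewrite /mu row_mxKl row_mxKr (chart_mapK h1 dp) (chart_mapK h2 dq).
- apply: (@Ck_on_ext _ _ _ _ _ ((f \o cinv e) \o mu)) => //.
    by move=> z [Wz _] /=; rewrite /mu (chart_mapK he)//; have [] := HW z Wz.
  apply: (@Ck_on_comp _ _ _ _ _ (cmap e @` (cdom e `&` U))) => //.
  - by move=> z [].
  - exact: sf.
  - by apply: Ck_on_subset (sW k) => z [].
- by move=> z W'z; have [Wz _] := W'z; have [] := HW z Wz; split=> //; exact: UW'.
Qed.

Lemma smooth_fun_curve (U : set G) (f : G -> R) p k : open U -> smooth_fun_on A U f -> U p ->
  exists V, [/\ open V, V u0, forall u, V u -> U (p * cinv c u)%g &
    Ck_on k V (fun u => f (p * cinv c u)%g)].
Proof.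
move=> oU sf Up; have [[_ _ /atlas_cover cov] _ _] := lg; have [d Ad dp] := cov p.
have hd := lie_group_chart lg Ad.
have [|W [oW Wp CW HW]] := @smooth_fun_mul U f d c p 1%g k oU sf Ad Ac dp c1; first by rewrite mulg1.
have [_ [V [oV Vu VW CV]]] := Ck_on_slice_at oW CW Wp.
exists V; split=> //.
  by move=> u /VW/HW; rewrite row_mxKl row_mxKr (chart_mapK hd dp) => -[].
apply: Ck_on_ext CV => // u _.
by rewrite row_mxKl row_mxKr (chart_mapK hd dp).
Qed.

Lemma smooth_fun_curve_diff (U : set G) (f : G -> R) p : open U -> smooth_fun_on A U f -> U p ->
  differentiable (fun u => f (p * cinv c u)%g) u0.
Proof.
move=> oU sf Up; have [V [oV Vu _ CV]] := smooth_fun_curve 1 oU sf Up.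
exact: Ck_on_differentiable oV CV Vu.
Qed.

(** Locally (p, q) |-> f (p q) is of class C^(k+1) in both variables together, so its derivative in
    q at q = 1 is of class C^k in p. *)
Lemma left_field_smooth (U : set G) (f : G -> R) v : open U -> smooth_fun_on A U f ->
  smooth_fun_on A U (left_field c v f).
Proof.
move=> oU sf d Ad k; have hd := lie_group_chart lg Ad.
apply: Ck_on_local => _ [p [dp Up] <-].
have [|W [oW Wp CW HW]] := @smooth_fun_mul U f d c p 1%g k.+1 oU sf Ad Ac dp c1; first by rewrite mulg1.
have CD := Ck_on_derive (row_mx 0 v) CW.
have [[V [oV Vu VW CV]] _] := Ck_on_slice_at oW CD Wp.
exists V => //; apply: Ck_on_ext CV => // u Vu' /=.
rewrite left_field_derive; apply/esym/is_deriveE.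
have -> : (fun v0 => f (cinv d u * cinv c v0)%g) =
    (fun v0 => f (cinv d (lsubmx (row_mx u v0)) * cinv c (rsubmx (row_mx u v0)))%g).
  by apply/funext => v0; rewrite row_mxKl row_mxKr.
apply: (@is_derive_slicer _ _ _ _ (fun z => f (cinv d (lsubmx z) * cinv c (rsubmx z))%g)).
by apply: derivableP; exact: (Ck_on_derivable CW (VW _ Vu')).
Qed.

Lemma left_field_ext (U : set G) (f h : G -> R) v p : open U -> U p ->
  (forall q, U q -> f q = h q) -> left_field c v f p = left_field c v h p.
Proof.
move=> oU Up fh; rewrite !left_field_derive; apply: near_eq_derive.
have hc := lie_group_chart lg Ac.
pose O := crange c `&` (fun u => (p * cinv c u)%g) @^-1` U.
have : nbhs u0 O.
  apply: filterI.
    by apply: open_nbhs_nbhs; split; [exact: chart_open_range|exact: cdom_crange].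
  have cc : {for u0, continuous (fun u => (p * cinv c u)%g)}.
    apply: (@continuous_comp _ _ _ (cinv c) (fun y => p * y)%g u0).
      by apply: (chart_inv_continuous hc); exact: cdom_crange.
    exact: (mulg_continuousl mulc).
  by apply: cc; apply: open_nbhs_nbhs; split=> //; rewrite (chart_mapK hc c1) mulg1.
by apply: filterS => u [_ Uu]; exact: fh.
Qed.

Lemma left_field_linear (U : set G) (f : G -> R) p : open U -> smooth_fun_on A U f -> U p ->
  linear (fun v => left_field c v f p : R).
Proof.
move=> oU sf Up a v w; rewrite !left_field_derive.
by rewrite !deriveE ?linearP//; exact: (smooth_fun_curve_diff oU sf Up).
Qed.

Lemma smooth_funD (U : set G) (f h : G -> R) : open U -> smooth_fun_on A U f -> smooth_fun_on A U h ->
  smooth_fun_on A U (fun q => f q + h q).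
Proof.
move=> oU sf sh d Ad k; have oE := chart_image_open (lie_group_chart lg Ad) oU.
exact: (Ck_onD oE (sf d Ad k) (sh d Ad k)).
Qed.

Lemma smooth_funM (U : set G) (f h : G -> R) : open U -> smooth_fun_on A U f -> smooth_fun_on A U h ->
  smooth_fun_on A U (fun q => f q * h q).
Proof.
move=> oU sf sh d Ad k; have oE := chart_image_open (lie_group_chart lg Ad) oU.
exact: (Ck_onM oE (sf d Ad k) (sh d Ad k)).
Qed.

Lemma smooth_fun_cst (U : set G) (a : R) : smooth_fun_on A U (fun=> a).
Proof. by move=> d Ad k; exact: (Ck_on_cst k _ a). Qed.

Lemma left_fieldD (U : set G) (f h : G -> R) v p : open U -> U p ->
  smooth_fun_on A U f -> smooth_fun_on A U h ->
  left_field c v (fun q => f q + h q) p = left_field c v f p + left_field c v h p.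
Proof.
move=> oU Up sf sh; rewrite !left_field_derive; apply: is_deriveE.
by apply: is_deriveD; apply: derivableP; apply: diff_derivable;
  [exact: (smooth_fun_curve_diff oU sf Up)|exact: (smooth_fun_curve_diff oU sh Up)].
Qed.

Lemma left_fieldM (U : set G) (f h : G -> R) v p : open U -> U p ->
  smooth_fun_on A U f -> smooth_fun_on A U h ->
  left_field c v (fun q => f q * h q) p = f p * left_field c v h p + h p * left_field c v f p.
Proof.
move=> oU Up sf sh; rewrite !left_field_derive.
have E : (p * cinv c u0)%g = p by rewrite (chart_mapK (lie_group_chart lg Ac) c1) mulg1.
have df := smooth_fun_curve_diff oU sf Up; have dh := smooth_fun_curve_diff oU sh Up.
have -> : 'D_v (fun u => f (p * cinv c u)%g * h (p * cinv c u)%g) u0 =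
    f (p * cinv c u0)%g *: 'D_v (fun u => h (p * cinv c u)%g) u0 +
    h (p * cinv c u0)%g *: 'D_v (fun u => f (p * cinv c u)%g) u0.
  by rewrite -deriveM //; exact: diff_derivable.
by rewrite E.
Qed.

Lemma left_field_cst v (a : R) p : left_field c v (fun=> a) p = 0.
Proof. by rewrite left_field_derive; apply: is_deriveE; exact: is_derive_cst. Qed.

End SmoothFunctions.

Section DeterminantRow.
Variables (K : comNzRingType).

Lemma det_row_replaced n (M D : 'M[K]_n) k :
  \det (\matrix_(i, j) (if i == k then D i j else M i j)) = \sum_j D k j * cofactor M k j.
Proof.
rewrite (expand_det_row _ k); apply: eq_bigr => j _; rewrite mxE eqxx; congr (_ * _).
rewrite /cofactor; congr (_ * \det _); apply/matrixP => a b; rewrite !mxE.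
by rewrite eq_sym (negPf (neq_lift _ _)).
Qed.

End DeterminantRow.

(** * Invariant fields acting on complex-valued functions *)

Section ComplexSmoothFunctions.
Variables (R : realType) (m : nat) (G : topGroupType) (A : set (chart R m G)).
Variables (c : chart R m G).
Hypotheses (lg : lie_group A) (Ac : A c) (c1 : cdom c 1%g).
Variable U : set G.
Hypothesis oU : open U.
Implicit Types (f h : G -> R[i]) (v : 'rV[R]_m).

Definition csmooth (V : set G) f :=
  smooth_fun_on A V (fun q => complex.Re (f q)) /\ smooth_fun_on A V (fun q => complex.Im (f q)).

Lemma csmooth_cst (a : R[i]) : csmooth U (fun=> a).
Proof. by split; apply: smooth_fun_cst. Qed.

Lemma ReD (x y : R[i]) : complex.Re (x + y) = complex.Re x + complex.Re y.
Proof. by case: x; case: y. Qed.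
Lemma ImD (x y : R[i]) : complex.Im (x + y) = complex.Im x + complex.Im y.
Proof. by case: x; case: y. Qed.
Lemma ReM (x y : R[i]) : complex.Re (x * y) =
  complex.Re x * complex.Re y + (-1) * (complex.Im x * complex.Im y).
Proof. by case: x => a b; case: y => a' b' /=; rewrite mulN1r. Qed.
Lemma ImM (x y : R[i]) : complex.Im (x * y) =
  complex.Re x * complex.Im y + complex.Im x * complex.Re y.
Proof. by case: x => a b; case: y => a' b' /=. Qed.

Lemma csmoothD f h : csmooth U f -> csmooth U h -> csmooth U (fun q => f q + h q).
Proof.
move=> [fr fi] [hr hi]; split.
  rewrite (_ : (fun q => _) = (fun q => complex.Re (f q) + complex.Re (h q))).
    exact: (smooth_funD lg).
  by apply/funext => q; rewrite ReD.
rewrite (_ : (fun q => _) = (fun q => complex.Im (f q) + complex.Im (h q))).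
  exact: (smooth_funD lg).
by apply/funext => q; rewrite ImD.
Qed.

Lemma csmoothM f h : csmooth U f -> csmooth U h -> csmooth U (fun q => f q * h q).
Proof.
move=> [fr fi] [hr hi]; split.
  rewrite (_ : (fun q => _) = (fun q => complex.Re (f q) * complex.Re (h q) +
      (-1) * (complex.Im (f q) * complex.Im (h q)))).
    apply: (smooth_funD lg oU); first exact: (smooth_funM lg).
    apply: (smooth_funM lg oU); first exact: smooth_fun_cst.
    exact: (smooth_funM lg).
  by apply/funext => q; rewrite ReM.
rewrite (_ : (fun q => _) = (fun q => complex.Re (f q) * complex.Im (h q) +
      complex.Im (f q) * complex.Re (h q))).
  by apply: (smooth_funD lg oU); exact: (smooth_funM lg).
by apply/funext => q; rewrite ImM.
Qed.

Lemma csmooth_sum I (s : seq I) (f : I -> G -> R[i]) :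
  (forall i, csmooth U (f i)) -> csmooth U (fun q => \sum_(i <- s) f i q).
Proof.
move=> sf; elim: s => [|i s IHs].
  by rewrite (_ : (fun q => _) = (fun=> 0)); [exact: csmooth_cst|apply/funext => q; rewrite big_nil].
rewrite (_ : (fun q => _) = (fun q => f i q + \sum_(i <- s) f i q)).
  exact: csmoothD.
by apply/funext => q; rewrite big_cons.
Qed.

Lemma csmooth_prod I (s : seq I) (f : I -> G -> R[i]) :
  (forall i, csmooth U (f i)) -> csmooth U (fun q => \prod_(i <- s) f i q).
Proof.
move=> sf; elim: s => [|i s IHs].
  by rewrite (_ : (fun q => _) = (fun=> 1)); [exact: csmooth_cst|apply/funext => q; rewrite big_nil].
rewrite (_ : (fun q => _) = (fun q => f i q * \prod_(i <- s) f i q)).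
  exact: csmoothM.
by apply/funext => q; rewrite big_cons.
Qed.

Lemma csmooth_left_fieldC f v : csmooth U f -> csmooth U (left_fieldC c v f).
Proof. by move=> [fr fi]; split; exact: (left_field_smooth lg Ac c1). Qed.

Variable p : G.
Hypothesis Up : U p.

Lemma left_fieldC_ext f h v : (forall q, U q -> f q = h q) ->
  left_fieldC c v f p = left_fieldC c v h p.
Proof.
move=> fh; rewrite /left_fieldC; congr (_ +i* _)%C;
  by apply: (left_field_ext lg Ac c1 v oU Up) => q Uq; rewrite fh.
Qed.

Lemma left_fieldCD f h v : csmooth U f -> csmooth U h ->
  left_fieldC c v (fun q => f q + h q) p = left_fieldC c v f p + left_fieldC c v h p.
Proof.
move=> [fr fi] [hr hi]; rewrite /left_fieldC.
rewrite (_ : (fun q => complex.Re _) = (fun q => complex.Re (f q) + complex.Re (h q))); last first.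
  by apply/funext => q; rewrite ReD.
rewrite (_ : (fun q => complex.Im _) = (fun q => complex.Im (f q) + complex.Im (h q))); last first.
  by apply/funext => q; rewrite ImD.
by rewrite !(left_fieldD lg Ac c1 v oU Up).
Qed.

Lemma left_fieldC_cst v (a : R[i]) : left_fieldC c v (fun=> a) p = 0.
Proof. by rewrite /left_fieldC !left_field_cst. Qed.

Lemma left_fieldCM f h v : csmooth U f -> csmooth U h ->
  left_fieldC c v (fun q => f q * h q) p =
  f p * left_fieldC c v h p + h p * left_fieldC c v f p.
Proof.
move=> [fr fi] [hr hi]; rewrite /left_fieldC.
rewrite (_ : (fun q => complex.Re _) = (fun q => complex.Re (f q) * complex.Re (h q) +
      (-1) * (complex.Im (f q) * complex.Im (h q)))); last first.
  by apply/funext => q; rewrite ReM.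
rewrite (_ : (fun q => complex.Im _) = (fun q => complex.Re (f q) * complex.Im (h q) +
      complex.Im (f q) * complex.Re (h q))); last first.
  by apply/funext => q; rewrite ImM.
have s1 := smooth_funM lg oU fr hr; have s2 := smooth_funM lg oU fi hi.
have s3 := smooth_funM lg oU fr hi; have s4 := smooth_funM lg oU fi hr.
have s0 := @smooth_fun_cst R m G A U (-1); have s5 := smooth_funM lg oU s0 s2.
rewrite (left_fieldD lg Ac c1 v oU Up s1 s5) (left_fieldD lg Ac c1 v oU Up s3 s4).
rewrite (left_fieldM lg Ac c1 v oU Up s0 s2) (left_fieldM lg Ac c1 v oU Up fr hr).
rewrite (left_fieldM lg Ac c1 v oU Up fi hi) (left_fieldM lg Ac c1 v oU Up fr hi).
rewrite (left_fieldM lg Ac c1 v oU Up fi hr) left_field_cst.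
set F1 := left_field _ _ _ _; set F2 := left_field _ _ _ _.
set F3 := left_field _ _ _ _; set F4 := left_field _ _ _ _.
move: F1 F2 F3 F4; case: (f p) => a b; case: (h p) => a' b' F1 F2 F3 F4 /=.
by apply/eqP; rewrite eq_complex /=; apply/andP; split; apply/eqP; ring.
Qed.

Lemma left_fieldC_sum I (s : seq I) (f : I -> G -> R[i]) v : (forall i, csmooth U (f i)) ->
  left_fieldC c v (fun q => \sum_(i <- s) f i q) p = \sum_(i <- s) left_fieldC c v (f i) p.
Proof.
move=> sf; elim: s => [|i s IHs].
  rewrite big_nil (_ : (fun q => _) = (fun=> 0)) ?left_fieldC_cst//.
  by apply/funext => q; rewrite big_nil.
rewrite big_cons (_ : (fun q => _) = (fun q => f i q + \sum_(i <- s) f i q)).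
  by rewrite left_fieldCD ?IHs//; exact: csmooth_sum.
by apply/funext => q; rewrite big_cons.
Qed.

Lemma left_fieldC_prod n (f : 'I_n -> G -> R[i]) v : (forall i, csmooth U (f i)) ->
  left_fieldC c v (fun q => \prod_i f i q) p =
  \sum_k \prod_i (if i == k then left_fieldC c v (f i) p else f i p).
Proof.
elim: n f => [|n IHn] f sf.
  rewrite big_ord0 (_ : (fun q => _) = (fun=> 1)) ?left_fieldC_cst//.
  by apply/funext => q; rewrite big_ord0.
rewrite (_ : (fun q => _) = (fun q => f ord0 q * \prod_i f (lift ord0 i) q)); last first.
  by apply/funext => q; rewrite big_ord_recl.
rewrite left_fieldCM//; last exact: csmooth_prod.
rewrite IHn// big_ord_recl addrC; congr (_ + _).
  by rewrite big_ord_recl eqxx mulrC.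
by rewrite mulr_sumr; apply: eq_bigr => k _; rewrite big_ord_recl; congr (_ * _).
Qed.

Lemma csmooth_det n (f : 'I_n -> 'I_n -> G -> R[i]) : (forall i j, csmooth U (f i j)) ->
  csmooth U (fun q => \det (\matrix_(i, j) f i j q)).
Proof.
move=> sf; rewrite (_ : (fun q => _) = (fun q => \sum_(s : 'S_n) (-1) ^+ s * \prod_i f i (s i) q)).
  apply: csmooth_sum => s; apply: csmoothM; first exact: csmooth_cst.
  exact: csmooth_prod.
by apply/funext => q; apply: eq_bigr => s _; congr (_ * _); apply: eq_bigr => i _; rewrite mxE.
Qed.

Lemma left_fieldC_det n (f : 'I_n -> 'I_n -> G -> R[i]) v : (forall i j, csmooth U (f i j)) ->
  left_fieldC c v (fun q => \det (\matrix_(i, j) f i j q)) p =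
  \sum_k \sum_j left_fieldC c v (f k j) p * cofactor (\matrix_(i, j) f i j p) k j.
Proof.
move=> sf; rewrite (_ : (fun q => _) = (fun q => \sum_(s : 'S_n) (-1) ^+ s * \prod_i f i (s i) q)); last first.
  by apply/funext => q; apply: eq_bigr => s _; congr (_ * _); apply: eq_bigr => i _; rewrite mxE.
have sp (s : 'S_n) : csmooth U (fun q => \prod_i f i (s i) q) by exact: csmooth_prod.
rewrite left_fieldC_sum => [|s]; last by apply: csmoothM => //; exact: csmooth_cst.
transitivity (\sum_k \det (\matrix_(i, j) (if i == k then
    (\matrix_(a, b) left_fieldC c v (f a b) p) i j else (\matrix_(i, j) f i j p) i j))); last first.
  by apply: eq_bigr => k _; rewrite det_row_replaced; apply: eq_bigr => j _; rewrite mxE.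
rewrite [RHS]exchange_big /=; apply: eq_bigr => s _.
rewrite left_fieldCM//; last exact: csmooth_cst.
rewrite left_fieldC_cst mulr0 addr0 left_fieldC_prod// mulr_sumr; apply: eq_bigr => k _.
by congr (_ * _); apply: eq_bigr => i _; rewrite !mxE.
Qed.

Lemma left_fieldC_add f v w : csmooth U f ->
  left_fieldC c (v + w) f p = left_fieldC c v f p + left_fieldC c w f p.
Proof.
move=> [fr fi]; rewrite /left_fieldC.
have Lr := left_field_linear lg Ac c1 oU fr Up; have Li := left_field_linear lg Ac c1 oU fi Up.
by have := Lr 1 v w; have := Li 1 v w; rewrite !scale1r => -> ->.
Qed.

Lemma left_fieldC_scale f (a : R) v : csmooth U f ->
  left_fieldC c (a *: v) f p = (a%:C)%C * left_fieldC c v f p.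
Proof.
move=> [fr fi]; rewrite /left_fieldC.
have Lr := left_field_linear lg Ac c1 oU fr Up; have Li := left_field_linear lg Ac c1 oU fi Up.
have := Lr 1 0 0; have := Li 1 0 0; rewrite !scale1r addr0 => /eqP.
rewrite -subr_eq subrr => /eqP /esym i0 /eqP; rewrite -subr_eq subrr => /eqP /esym r0.
have := Lr a v 0; have := Li a v 0; rewrite addr0 i0 r0 !addr0 => -> ->.
by apply/eqP; rewrite eq_complex /=; apply/andP; split; apply/eqP; rewrite ?mul0r ?subr0 ?addr0.
Qed.

End ComplexSmoothFunctions.

(** * Holomorphic coordinates and the invariant frame *)

Section HolomorphicFrame.
Variables (R : realType) (n : nat) (g : vectType R) (br : g -> g -> g) (J : 'End(g)).
Variables (G : topGroupType) (A : set (chart R (n + n) G)) (c : chart R (n + n) G).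
Variables (theta : g -> 'rV[R]_(n + n)) (Gamma : set G).
Variables (M : topologicalType) (B : set (chart R[i] n M)) (proj : G -> M).
Hypothesis acs : abelian_complex_structure br J.
Hypothesis csm : complex_solvmanifold br J A c theta Gamma B proj.
Variables (X : 'I_n -> g) (gam : 'I_n -> g -> R[i]).
Hypothesis cof : adapted_coframe J X gam.

Let lg := csm_lie_group csm.
Let lag := csm_lie_algebra csm.
Let Ac := lag_chart lag.
Let c1 := lag_dom1 lag.

Lemma proj_continuous : continuous proj.
Proof.
move=> a; have ld : local_diffeomorphism A (real_atlas B) proj by case: csm.
by have [U [s [[oU Ua _] [_ [H _] _]]]] := ld a; exact: H.
Qed.

Lemma complex_chart d : B d -> is_chart d.
Proof. by move=> Bd; have [_ _ /atlas_chart] := csm_complex_manifold csm; exact. Qed.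

Definition chart_coord (d : chart R[i] n M) (j : 'I_n) (q : G) : R[i] := cmap d (proj q) 0 j.

Lemma open_proj_dom d : B d -> open (proj @^-1` cdom d).
Proof.
move=> Bd; apply: open_comp (chart_open (complex_chart Bd)) => a _.
exact: proj_continuous.
Qed.

(** [proj] is known to be smooth only near each point, as a local diffeomorphism; the pieces are
    glued by [Ck_on_local]. Real and imaginary parts are the two halves of the real chart. *)
Lemma csmooth_chart_coord d j : B d -> csmooth A (proj @^-1` cdom d) (chart_coord d j).
Proof.
move=> Bd; have ld : local_diffeomorphism A (real_atlas B) proj by case: csm.
have loc e k : A e -> forall u, (cmap e @` (cdom e `&` proj @^-1` cdom d)) u ->
    exists2 W, W u & open W /\ Ck_on k W (cmap (real_chart d) \o proj \o cinv e).
  move=> Ae _ [q [eq dq] <-]; have [U [s [[oU Uq _] [_ [_ H] _]]]] := ld q.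
  have oW : open (cmap e @` (cdom e `&` U `&` proj @^-1` cdom d)).
    rewrite -setIA; apply: chart_image_open; first exact: (lie_group_chart lg Ae).
    by apply: openI => //; exact: open_proj_dom.
  exists (cmap e @` (cdom e `&` U `&` proj @^-1` cdom d)); first by exists q.
  by split=> //; apply: (H e (real_chart d)) => //; exists d.
split=> e Ae k; apply: Ck_on_local => u /(loc e k Ae)[W Wu [oW CW]]; exists W => //.
  apply: Ck_on_ext (((Ck_on_rowP _ _ oW).1 CW) (lshift n j)) => // w _ /=.
  by rewrite row_mxEl mxE.
apply: Ck_on_ext (((Ck_on_rowP _ _ oW).1 CW) (rshift n j)) => // w _ /=.
by rewrite row_mxEr mxE.
Qed.

Section FixedChart.
Variable d : chart R[i] n M.
Hypothesis Bd : B d.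
Let U := proj @^-1` cdom d.
Let oU : open U := open_proj_dom Bd.
Let Y x (f : G -> R[i]) := left_fieldC c (theta x) f.

Definition frame_coef (k j : 'I_n) (q : G) : R[i] := left_fieldC c (theta (X k)) (chart_coord d j) q.
Definition frame_mx (q : G) : 'M[R[i]]_n := \matrix_(k, j) frame_coef k j q.

Lemma csmooth_frame_coef k j : csmooth A U (frame_coef k j).
Proof. by apply: (csmooth_left_fieldC lg Ac c1 oU); exact: csmooth_chart_coord. Qed.

Lemma lie_field_form10 (f : G -> R[i]) q (V : set G) : open V -> V q -> csmooth A V f ->
  (forall x, Y (J x) f q = 'i%C * Y x f q) -> form10 J (fun x => Y x f q).
Proof.
move=> oV Vq sf fJ; have thL := lag_linear lag; split=> // [x y|a x]; rewrite /Y.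
  have -> : theta (x + y) = theta x + theta y by have := thL 1 x y; rewrite !scale1r.
  exact: (left_fieldC_add lg Ac c1 oV Vq).
have th0 : theta 0 = 0.
  by have := thL 1 0 0; rewrite !scale1r addr0 => /eqP; rewrite -subr_eq subrr => /eqP.
have -> : theta (a *: x) = a *: theta x by have := thL a x 0; rewrite th0 !addr0.
exact: (left_fieldC_scale lg Ac c1 oV Vq).
Qed.

Lemma coord_form10 q j : U q -> form10 J (fun x => Y x (chart_coord d j) q).
Proof.
move=> Uq; apply: (lie_field_form10 oU Uq); first exact: csmooth_chart_coord.
by move=> x; exact: (csm_complex_structure csm Bd Uq).
Qed.

Lemma coord_expand q j x : U q ->
  Y x (chart_coord d j) q = \sum_k gam k x * frame_coef k j q.
Proof.
move=> Uq; rewrite (form10_expand cof x (coord_form10 j Uq)).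
by apply: eq_bigr => k _; rewrite mulrC.
Qed.

Lemma lie_field_bracket (f : G -> R[i]) x y q : U q -> csmooth A U f ->
  Y (br x y) f q = Y x (Y y f) q - Y y (Y x f) q.
Proof.
move=> Uq [fr fi]; rewrite /Y /left_fieldC.
rewrite (lag_bracket lag oU fr x y Uq) (lag_bracket lag oU fi x y Uq).
have sub (a b a' b' : R) : ((a - b) +i* (a' - b'))%C = (a +i* a')%C - (b +i* b')%C by [].
exact: sub.
Qed.

(* The defect from the Cauchy-Riemann equation is a matrix acting on the frame
   whose trace is the antilinear trace of J x. *)
Lemma frame_coef_CR x k j q : U q ->
  Y (J x) (frame_coef k j) q = 'i%C * Y x (frame_coef k j) q +
    \sum_l (gam l (br (J x) (X k)) - 'i%C * gam l (br x (X k))) * frame_coef l j q.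
Proof.
move=> Uq; have sz := csmooth_chart_coord j Bd.
have E y : Y y (frame_coef k j) q = Y (br y (X k)) (chart_coord d j) q + Y (X k) (Y y (chart_coord d j)) q.
  by rewrite (lie_field_bracket _ _ Uq sz) subrK.
have EJ : Y (X k) (Y (J x) (chart_coord d j)) q = 'i%C * Y (X k) (Y x (chart_coord d j)) q.
  have s1 : csmooth A U (Y x (chart_coord d j)) by exact: (csmooth_left_fieldC lg Ac c1 oU).
  rewrite {1}/Y (@left_fieldC_ext _ _ _ _ _ lg Ac c1 U oU q Uq _ (fun q => 'i%C * Y x (chart_coord d j) q)).
    rewrite (left_fieldCM lg Ac c1 oU Uq)//; last exact: csmooth_cst.
    by rewrite left_fieldC_cst mulr0 addr0.
  by move=> q' Uq'; exact: (csm_complex_structure csm Bd Uq').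
rewrite !E EJ !(coord_expand j _ Uq) mulrDr addrAC; congr (_ + _).
rewrite mulr_sumr -big_split /=; apply: eq_bigr => l _.
by rewrite mulrBl -mulrA addrC subrK.
Qed.

Lemma csmooth_frame_det : csmooth A U (fun q => \det (frame_mx q)).
Proof. by apply: (csmooth_det lg oU) => k j; exact: csmooth_frame_coef. Qed.

Lemma frame_det_CR x q : U q -> antilinear_trace br J X gam (J x) = 0 ->
  Y (J x) (fun q => \det (frame_mx q)) q = 'i%C * Y x (fun q => \det (frame_mx q)) q.
Proof.
move=> Uq T0; have sf := csmooth_frame_coef.
rewrite /Y !(left_fieldC_det lg Ac c1 oU Uq _ sf) -/(frame_mx q).
pose N : 'M[R[i]]_n := \matrix_(k, l) (gam l (br (J x) (X k)) - 'i%C * gam l (br x (X k))).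
transitivity ('i%C * (\sum_k \sum_j left_fieldC c (theta x) (frame_coef k j) q * cofactor (frame_mx q) k j) +
   \sum_k \sum_j (N *m frame_mx q) k j * cofactor (frame_mx q) k j).
  rewrite mulr_sumr -big_split /=; apply: eq_bigr => k _.
  rewrite mulr_sumr -big_split /=; apply: eq_bigr => j _.
  rewrite mulrA -mulrDl; congr (_ * _); rewrite [LHS](frame_coef_CR _ _ _ Uq); congr (_ + _).
  by rewrite mxE; apply: eq_bigr => l _; rewrite !mxE.
rewrite [X in _ + X]exchange_big sum_replaced_columns.
have -> : \tr N = 0.
  rewrite -T0 (antilinear_traceJ acs); apply: eq_bigr => k _; rewrite mxE.
  by [].
by rewrite mul0r addr0.
Qed.

End FixedChart.
End HolomorphicFrame.

(** * Comparison of real and complex coordinates *)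

Section Realification.
Variables (R : realType).

Lemma normc_le_ReIm (z : R[i]) : `|z| <= (`|complex.Re z| + `|complex.Im z|)%:C%C.
Proof.
rewrite normc_def lecR; set a := complex.Re z; set b := complex.Im z.
have ab : 0 <= `|a| + `|b| by rewrite addr_ge0.
rewrite -[leRHS](ger0_norm ab) -sqrtr_sqr ler_wsqrtr// sqrrD !real_normK ?num_real//.
by rewrite addrAC lerDl mulrn_wge0// mulr_ge0.
Qed.

Lemma normc_ge_Im (z : R[i]) : `|complex.Im z|%:C%C <= `|z|.
Proof.
rewrite normc_def lecR -[leLHS]ger0_norm// -sqrtr_sqr ler_wsqrtr//.
by rewrite real_normK ?num_real// lerDr sqr_ge0.
Qed.

(** The order of [R[i]] is partial, and numbers comparable to 0 are real. This converts the norms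
    and radii of complex normed spaces, which are elements of [R[i]], into real ones. *)
Lemma nnegc_Re (z : R[i]) : 0 <= z -> z = (complex.Re z)%:C%C.
Proof. by case: z => a b; rewrite lecE /= => /andP[/eqP -> _]. Qed.

Lemma posc_Re (z : R[i]) : 0 < z -> 0 < complex.Re z.
Proof. by case: z => a b; rewrite ltcE /= => /andP[]. Qed.

Lemma mx_norm_le (K : numFieldType) m (h : 'rV[K]_m) (e : K) : 0 <= e ->
  (forall j, `|h 0 j| <= e) -> `|h| <= e.
Proof.
move=> e0 He; rewrite [leLHS]/Num.Def.normr /=.
have [->//|] := eqVneq (mx_norm h) 0.
by move=> /mx_norm_neq0[[i j] ->] /=; rewrite ord1.
Qed.

Lemma nbhs_mx_normP (K : numFieldType) m (x : 'rV[K]_m) (P : set 'rV[K]_m) :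
  nbhs x P <-> exists2 d : K, 0 < d & forall y, `|x - y| < d -> P y.
Proof.
split=> [/nbhs_ballP[d /= d0 H]|[d d0 H]].
  by exists d => // y xy; apply: H; rewrite mx_norm_ball.
by apply/nbhs_ballP; exists d => // y; rewrite mx_norm_ball; exact: H.
Qed.

Variable n : nat.
Local Notation C := (R[i] : numFieldType).

Definition realify (z : 'rV[C]_n) : 'rV[R]_(n + n) :=
  row_mx (map_mx (@complex.Re R) z) (map_mx (@complex.Im R) z).

Definition complexify (w : 'rV[R]_(n + n)) : 'rV[C]_n :=
  \row_j (lsubmx w 0 j +i* rsubmx w 0 j)%C.

Lemma realifyK : cancel realify complexify.
Proof.
by move=> z; apply/rowP => j; rewrite mxE row_mxKl row_mxKr !mxE; case: (z 0 j).
Qed.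

Lemma complexifyK : cancel complexify realify.
Proof.
move=> w; rewrite /realify -[RHS]hsubmxK; congr row_mx; apply/rowP => j;
  by rewrite !mxE.
Qed.

Lemma realifyD z z' : realify (z + z') = realify z + realify z'.
Proof.
by rewrite /realify add_row_mx; congr row_mx; apply/rowP => j; rewrite !mxE ?ReD ?ImD.
Qed.

Lemma realifyN z : realify (- z) = - realify z.
Proof.
by rewrite /realify opp_row_mx; congr row_mx; apply/rowP => j; rewrite !mxE; case: (z 0 j).
Qed.

Lemma norm_realify z : `|realify z|%:C%C <= `|z|.
Proof.
rewrite [leRHS]nnegc_Re// lecR; apply: mx_norm_le => [|j].
  by have := normr_ge0 z; rewrite {1}[`|z|]nnegc_Re// -[0]/(0%:C)%C lecR.
rewrite -lecR -nnegc_Re//.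
case: (split_ordP j) => k ->; rewrite ?row_mxEl ?row_mxEr mxE;
  apply: le_trans (coord_le_norm z k); [exact: normc_ge_Re|exact: normc_ge_Im].
Qed.

Lemma norm_complexify_le z : `|z| <= (2 * `|realify z|)%:C%C.
Proof.
apply: mx_norm_le => [|j].
  by rewrite -[0]/(0%:C)%C lecR mulr_ge0.
apply: le_trans (normc_le_ReIm _) _; rewrite lecR mulr_natl mulr2n.
have := coord_le_norm (realify z) (lshift n j); have := coord_le_norm (realify z) (rshift n j).
by rewrite /realify row_mxEl row_mxEr !mxE => H1 H2; exact: lerD.
Qed.

Lemma realify_nbhs z (P : set 'rV[R]_(n + n)) : nbhs (realify z) P -> nbhs z (realify @^-1` P).
Proof.
move=> /nbhs_ex_ball[d d0 H]; apply/(@nbhs_mx_normP C n); exists d%:C%C; first by rewrite ltcR.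
move=> z' zz'; apply: H; rewrite -realifyN -realifyD -ltcR.
exact: le_lt_trans (norm_realify _) zz'.
Qed.

Lemma realify_continuous : continuous realify.
Proof. by move=> z P; exact: realify_nbhs. Qed.

Lemma complexify_continuous : continuous complexify.
Proof.
move=> w P /(@nbhs_mx_normP C n)[e e0 H]; apply/(@nbhs_mx_normP R); exists (complex.Re e / 2).
  by rewrite divr_gt0// posc_Re.
move=> w' ww'; apply: H; apply: le_lt_trans (norm_complexify_le _) _.
rewrite [ltRHS]nnegc_Re ?ltW// ltcR realifyD realifyN !complexifyK.
by rewrite mulrC -ltr_pdivlMr.
Qed.

Lemma open_realify_image (D : set 'rV[C]_n) : open D -> open (realify @` D).
Proof.
move=> oD; have -> : realify @` D = complexify @^-1` D.
  apply/seteqP; split=> [_ [z Dz <-]|w Dw]; first by rewrite /preimage /= realifyK.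
  by exists (complexify w) => //; rewrite complexifyK.
by apply: open_comp oD => w _; exact: complexify_continuous.
Qed.

Lemma real_chart_is_chart (X : topologicalType) (d : chart R[i] n X) :
  is_chart d -> is_chart (real_chart d).
Proof.
move=> hd; have dr u : crange (real_chart d) u -> crange d (complexify u).
  by move=> [x dx <-]; exists x => //; rewrite [RHS]realifyK.
split.
- exact: chart_open hd.
- have -> : crange (real_chart d) = realify @` crange d.
    apply/seteqP; split=> [_ [x dx <-]|_ [_ [x dx <-] <-]]; last by exists x.
    by exists (cmap d x) => //; exists x.
  by apply: open_realify_image; exact: chart_open_range hd.
- by move=> x dx /=; rewrite -/(realify _) -/(complexify _) realifyK (chart_mapK hd).
- move=> x dx; apply: (@continuous_comp _ _ _ (cmap d) realify); first exact: chart_map_continuous.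
  exact: realify_continuous.
- move=> u /dr du; apply: (@continuous_comp _ _ _ complexify (cinv d)); first exact: complexify_continuous.
  exact: chart_inv_continuous.
Qed.

End Realification.

Section ChartLift.
Variables (R : realType) (n : nat) (g : vectType R) (br : g -> g -> g) (J : 'End(g)).
Variables (G : topGroupType) (A : set (chart R (n + n) G)) (c : chart R (n + n) G).
Variables (theta : g -> 'rV[R]_(n + n)) (Gamma : set G).
Variables (M : topologicalType) (B : set (chart R[i] n M)) (proj : G -> M).
Hypothesis csm : complex_solvmanifold br J A c theta Gamma B proj.

Let lg := csm_lie_group csm.
Let lag := csm_lie_algebra csm.
Let Ac := lag_chart lag.
Let c1 := lag_dom1 lag.
Let u0 := cmap c 1%g.

Lemma left_translation_coord d e b p k : A d -> A e -> cdom d p -> cdom e (b * p)%g ->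
  exists W, [/\ open W, W (cmap d p),
    Ck_on k W (fun u => cmap e (b * cinv d u)%g) &
    forall u, W u -> crange d u /\ cdom e (b * cinv d u)%g].
Proof.
move=> Ad Ae dp ebp; have [[_ _ /atlas_cover cov] _ _] := lg; have [f Af fb] := cov b.
have hf := lie_group_chart lg Af.
have [W [oW Wp sW HW]] := mul_coord_domain lg Af Ad Ae fb dp ebp.
pose emb (v : 'rV[R]_(n + n)) := row_mx (cmap f b) v.
have oU : open (emb @^-1` W).
  apply: open_comp oW => x _.
  suff : {for x, continuous (fun v : 'rV[R]_(n + n) => row_mx (cmap f b) v)} by [].
  by apply: row_mx_continuous_at; [exact: cst_continuous|].
exists (emb @^-1` W); split=> //.
  have CS := @Ck_on_slicer _ _ _ _ k (emb @^-1` W) W _ (cmap f b) oU oW (fun v H => H) (sW k).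
  apply: Ck_on_ext CS => // u _.
  by rewrite row_mxKl row_mxKr (chart_mapK hf fb).
by move=> u /HW[_]; rewrite row_mxKl row_mxKr (chart_mapK hf fb).
Qed.

(* Psi is a local inverse of v |-> proj (a * cinv c v) read in the charts c and d. *)
Lemma chart_lift d a : B d -> cdom d (proj a) ->
  let Phi v := realify (cmap d (proj (a * cinv c v)%g)) in
  exists (W : set 'rV[R]_(n + n)) (Psi : 'rV[R]_(n + n) -> 'rV[R]_(n + n)),
  [/\ open W /\ W (realify (cmap d (proj a))), Psi (realify (cmap d (proj a))) = u0,
     Ck_on 1 W Psi,
     forall w, W w -> cdom d (proj (a * cinv c (Psi w))%g) /\ Phi (Psi w) = w &
     \forall v \near u0, Psi (Phi v) = v].
Proof.
move=> Bd da Phi.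
have hc := lie_group_chart lg Ac.
have hd := complex_chart csm Bd; have hrd := real_chart_is_chart hd.
have ld : local_diffeomorphism A (real_atlas B) proj by case: csm.
have [U1 [s [[oU1 U1a oV] [sK _ [cs sm]]]]] := ld a; set V := proj @` U1 in oV cs sm.
have sV y : V y -> proj (s y) = y by move=> [q Uq <-]; rewrite sK.
have Va : V (proj a) by exists a.
have [[_ _ /atlas_cover cov] _ _] := lg; have [c' Ac' c'a] := cov a.
have hc' := lie_group_chart lg Ac'.
have [|W3 [oW3 W3a CW3 HW3]] := @left_translation_coord c' c (a^-1)%g a 1 Ac' Ac c'a.
  by rewrite mulVg.
pose rd := real_chart d.
pose W1 := cmap rd @` (cdom rd `&` V `&` s @^-1` cdom c').
have oVs : open (V `&` s @^-1` cdom c').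
  rewrite openE => y [Vy cy]; apply: filterI; first exact: open_nbhs_nbhs.
  by apply: (cs y Vy); apply: open_nbhs_nbhs; split=> //; exact: chart_open.
have oW1 : open W1 by rewrite /W1 -setIA; exact: (chart_image_open hrd).
have C1 : Ck_on 1 W1 (cmap c' \o s \o cinv rd).
  by apply: (sm rd c') => //; exists d.
pose Psi1 := cmap c' \o s \o cinv rd.
pose W := W1 `&` Psi1 @^-1` W3.
have oW : open W.
  rewrite openE => w [W1w W3w]; apply: filterI; first exact: open_nbhs_nbhs.
  by apply: (Ck_on_continuous C1 W1w); exact: open_nbhs_nbhs.
have w0E : cinv rd (realify (cmap d (proj a))) = proj a by exact: (chart_mapK hrd).
have sa : s (proj a) = a by exact: sK.
have Ww0 : W (realify (cmap d (proj a))).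
  split; last by rewrite /preimage /Psi1 /mkset /comp w0E sa.
  by exists (proj a) => //; split=> //; rewrite /= sa.
(* The local section s lifts the point of M back to G near a, and a^-1 brings it into the chart c at
   1. *)
pose Psi w := cmap c (a^-1 * s (cinv rd w))%g.
have WP w : W w -> exists y, [/\ cdom d y /\ V y, cdom c' (s y), w = cmap rd y,
    cinv rd w = y & cdom c (a^-1 * s y)%g].
  move=> [[y [[dy Vy] cy] <-] W3w].
  have iy : cinv rd (cmap rd y) = y by exact: (chart_mapK hrd).
  exists y; split=> //; have [_] := HW3 _ W3w.
  by rewrite /Psi1 /comp iy (chart_mapK hc' cy).
exists W, Psi; split=> //.
- by rewrite /Psi w0E sa mulVg.
- have CC := @Ck_on_comp_row R _ _ _ 1 W W3 (fun u => cmap c (a^-1 * cinv c' u)%g) Psi1 oW oW3.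
  have WW3 w : W w -> W3 (Psi1 w) by case.
  have CP1 : Ck_on 1 W Psi1 by apply: Ck_on_subset C1 => w [].
  have E w : W w -> ((fun u => cmap c (a^-1 * cinv c' u)%g) \o Psi1) w = Psi w.
    by move=> /WP[y [_ cy -> iy _]]; rewrite /Psi /Psi1 /comp !iy (chart_mapK hc' cy).
  exact: (Ck_on_ext oW E (CC WW3 CW3 CP1)).
- move=> w /WP[y [[dy Vy] _ -> iy cy]]; rewrite /Phi /Psi iy (chart_mapK hc cy) mulVKg.
  by rewrite (sV y Vy).
pose O := U1 `&` (proj @^-1` cdom d) `&` cdom c'.
have oO : open O.
  by apply: openI; [apply: openI => //; exact: (open_proj_dom csm)|exact: chart_open].
have cc : {for u0, continuous (fun u => (a * cinv c u)%g)}.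
  apply: (@continuous_comp _ _ _ (cinv c) (fun y => a * y)%g u0).
    by apply: (chart_inv_continuous hc); exact: cdom_crange.
  exact: (mulg_continuousl (lie_group_mul_continuous lg)).
have nO : nbhs u0 ((fun u => (a * cinv c u)%g) @^-1` O).
  by apply: cc; apply: open_nbhs_nbhs; split=> //; rewrite /u0 (chart_mapK hc c1) mulg1.
have nc : nbhs u0 (crange c).
  by apply: open_nbhs_nbhs; split; [exact: chart_open_range|exact: cdom_crange].
apply: filterS2 nO nc => v [[U1v dv] c'v] /(crangeP hc)[cv vE].
rewrite /Psi /Phi; have -> : cinv rd (realify (cmap d (proj (a * cinv c v)%g))) = proj (a * cinv c v)%g.
  exact: (chart_mapK hrd).
by rewrite sK// mulKg.
Qed.

End ChartLift.

Section ComplexDifferentiability.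
Variables (R : realType) (n : nat).
Local Notation C := (R[i] : numFieldType).

Lemma differentiable_near_eps (K : numFieldType) (V W : normedModType K) (f : V -> W) (x : V) (e : K) :
  differentiable f x -> 0 < e ->
  \forall h \near 0, `|f (h + x) - f x - 'd f x h| <= e * `|h|.
Proof.
move=> /diff_locallyP[_ /eqaddoP H] e0; have := H e e0; apply: filterS => h /=.
by rewrite /GRing.add /= /cst /= opprD addrA.
Qed.

(** Real differentiability together with C-linearity of the real differential, which the last
    hypothesis expresses, is complex differentiability: the real remainders of both parts are e / 2
    times the norm of the realified increment, which is at most its complex norm. *)
Lemma complex_differentiable (F : 'rV[C]_n -> R[i]) (z0 : 'rV[C]_n) (Hr Hi : 'rV[R]_(n + n) -> R)
    (l : 'I_n -> R[i]) :
  differentiable Hr (realify z0) -> differentiable Hi (realify z0) ->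
  (\forall z \near z0, F z = (Hr (realify z) +i* Hi (realify z))%C) ->
  (forall z : 'rV[C]_n, ('D_(realify z) Hr (realify z0) +i* 'D_(realify z) Hi (realify z0))%C =
     \sum_j z 0 j * l j) ->
  differentiable (F : 'rV[C]_n -> C^o) z0 /\
  forall z, 'd (F : 'rV[C]_n -> C^o) z0 z = \sum_j z 0 j * l j.
Proof.
move=> dr di FH DH.
pose L (z : 'rV[C]_n) : C^o := \sum_j z 0 j * l j.
have Llin : linear L.
  move=> a z z'; rewrite /L scaler_sumr -big_split; apply: eq_bigr => j _.
  by rewrite !mxE mulrDl -mulrA.
pose LL : {linear 'rV[C]_n -> C^o} := HB.pack L (GRing.isLinear.Build _ _ _ _ _ Llin).
have cL : continuous LL.
  move=> z; suff : {for z, continuous (fun z : 'rV[C]_n => \sum_j z 0 j * l j : C)} by [].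
  apply: (@continuous_at_sum C C) => j.
  by apply: (@continuous_atM C); [exact: coord_continuous|exact: cst_continuous].
have [|dF dE] := @differentiable_eps C _ C^o F z0 LL cL; last by split=> // z; rewrite dE.
move=> e e0; have e20 : 0 < complex.Re e / 2 by rewrite divr_gt0 ?posc_Re.
have Nr := differentiable_near_eps dr e20; have Ni := differentiable_near_eps di e20.
have r0 : realify (0 : 'rV[C]_n) = 0.
  by apply/rowP => j; rewrite /realify; case: (split_ordP j) => k ->; rewrite ?row_mxEl ?row_mxEr !mxE.
have N0 : \forall h \near (0 : 'rV[C]_n), F (h + z0) = (Hr (realify (h + z0)) +i* Hi (realify (h + z0)))%C.
  have cs : {for (0 : 'rV[C]_n), continuous (fun h : 'rV[C]_n => h + z0)}.
    by apply: (@continuous_atD C 'rV[C]_n); [|exact: cst_continuous].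
  by apply: (cs (fun z => F z = (Hr (realify z) +i* Hi (realify z))%C)); rewrite /= add0r.
have FE : F z0 = (Hr (realify z0) +i* Hi (realify z0))%C by exact: (nbhs_singleton FH).
have RN P : nbhs (0 : 'rV[R]_(n + n)) P -> nbhs (0 : 'rV[C]_n) (@realify R n @^-1` P).
  by have := @realify_nbhs R n 0 P; rewrite r0.
have Nr' : \forall h \near (0 : 'rV[C]_n), `|Hr (realify h + realify z0) - Hr (realify z0) - 'd Hr (realify z0) (realify h)| <= complex.Re e / 2 * `|realify h|.
  exact: RN Nr.
have Ni' : \forall h \near (0 : 'rV[C]_n), `|Hi (realify h + realify z0) - Hi (realify z0) - 'd Hi (realify z0) (realify h)| <= complex.Re e / 2 * `|realify h|.
  exact: RN Ni.
apply: filterS3 N0 Nr' Ni' => h -> ; rewrite -!deriveE// FE -realifyD => Br Bi.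
have -> : LL h = ('D_(realify h) Hr (realify z0) +i* 'D_(realify h) Hi (realify z0))%C by rewrite DH.
apply: le_trans (normc_le_ReIm _) _ => /=.
apply: (@le_trans _ _ (e * (`|realify h|)%:C%C)); last first.
  by apply: ler_wpM2l; [exact: ltW|exact: norm_realify].
have -> : e * (`|realify h|)%:C%C = (complex.Re e * `|realify h|)%:C%C.
  by rewrite {1}[e]nnegc_Re ?ltW// -rmorphM.
rewrite lecR.
by rewrite [complex.Re e]splitr mulrDl; exact: lerD.
Qed.

End ComplexDifferentiability.

(** * Descending functions on G that satisfy the Cauchy-Riemann equations *)

Section Descent.
Variables (R : realType) (n : nat) (g : vectType R) (br : g -> g -> g) (J : 'End(g)).
Variables (G : topGroupType) (A : set (chart R (n + n) G)) (c : chart R (n + n) G).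
Variables (theta : g -> 'rV[R]_(n + n)) (Gamma : set G).
Variables (M : topologicalType) (B : set (chart R[i] n M)) (proj : G -> M).
Hypothesis csm : complex_solvmanifold br J A c theta Gamma B proj.
Variables (X : 'I_n -> g) (gam : 'I_n -> g -> R[i]).
Hypothesis cof : adapted_coframe J X gam.
Local Notation C := (R[i] : numFieldType).

Let lg := csm_lie_group csm.
Let lag := csm_lie_algebra csm.
Let Ac := lag_chart lag.
Let c1 := lag_dom1 lag.
Let u0 := cmap c 1%g.
Let hc : is_chart c := lie_group_chart lg Ac.

Variables (d : chart R[i] n M) (a : G).
Hypotheses (Bd : B d) (da : cdom d (proj a)).
Let U := proj @^-1` cdom d.
Let oU : open U := open_proj_dom csm Bd.
Let Y x (f : G -> R[i]) := left_fieldC c (theta x) f.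
Let Phi v := realify (cmap d (proj (a * cinv c v)%g)).
Let P := frame_mx c theta proj X d a.
Let z0 := cmap d (proj a).

Let Phi0 : Phi u0 = realify z0.
Proof. by rewrite /Phi /u0 (chart_mapK hc c1) mulg1. Qed.

Let Phi_coord i : differentiable (fun v => Phi v 0 i) u0 /\
  forall v, 'D_v (fun v => Phi v 0 i) u0 =
    realify (\row_j left_fieldC c v (chart_coord proj d j) a) 0 i.
Proof.
rewrite /Phi /realify; case: (split_ordP i) => j -> ;
  rewrite ?row_mxEl ?row_mxEr; have [sr si] := csmooth_chart_coord csm j Bd.
  have -> : (fun v => row_mx (map_mx (@complex.Re R) (cmap d (proj (a * cinv c v)%g)))
      (map_mx (@complex.Im R) (cmap d (proj (a * cinv c v)%g))) 0 (lshift n j)) =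
    (fun v => complex.Re (chart_coord proj d j (a * cinv c v)%g)).
    by apply/funext => v; rewrite row_mxEl mxE.
  split; first exact: (smooth_fun_curve_diff lg Ac c1 oU sr da).
  by move=> v; rewrite row_mxEl !mxE /left_fieldC /= left_field_derive.
have -> : (fun v => row_mx (map_mx (@complex.Re R) (cmap d (proj (a * cinv c v)%g)))
    (map_mx (@complex.Im R) (cmap d (proj (a * cinv c v)%g))) 0 (rshift n j)) =
  (fun v => complex.Im (chart_coord proj d j (a * cinv c v)%g)).
  by apply/funext => v; rewrite row_mxEr mxE.
split; first exact: (smooth_fun_curve_diff lg Ac c1 oU si da).
by move=> v; rewrite row_mxEr !mxE /left_fieldC /= left_field_derive.
Qed.

Let Phi_derive v : is_derive u0 v Phi (realify (\row_j left_fieldC c v (chart_coord proj d j) a)).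
Proof.
have dP : derivable Phi u0 v.
  by apply/derivable_rowP => i; apply: diff_derivable; exact: (Phi_coord i).1.
apply: DeriveDef => //; apply/rowP => i; rewrite derive_row//.
exact: (Phi_coord i).2.
Qed.

Let coord_row x : \row_j Y x (chart_coord proj d j) a = (\row_k gam k x) *m P.
Proof.
apply/rowP => j; rewrite !mxE /Y (coord_expand csm cof Bd j x da); apply: eq_bigr => k _.
by rewrite !mxE.
Qed.

(** If w P = 0, the vector x with coordinates gam_k x = w_k annihilates all holomorphic coordinates,
    so the real differential of Phi kills theta x. Since Psi is a local left inverse of Phi, theta x
    = 0, hence x = 0 and w = 0. *)
Lemma frame_mx_unit : P \in unitmx.
Proof.
rewrite unitmxE unitfE; apply/negP => /det0P[w w0 wP].
have [gD gZ gJ] : [/\ forall k x y, gam k (x + y) = gam k x + gam k y,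
    forall k (s : R) x, gam k (s *: x) = s%:C%C * gam k x &
    forall k x, gam k (J x) = 'i%C * gam k x].
  by split=> k; have [] := coframe_form cof k.
have g0 k : gam k 0 = 0 by exact: form10_0 (coframe_form cof k).
pose x := \sum_k (complex.Re (w 0 k) *: X k + complex.Im (w 0 k) *: J (X k)).
have gx k : gam k x = w 0 k.
  rewrite /x (big_morph _ (gD k) (g0 k)) (bigD1 k)//= big1 ?addr0 => [|l lk].
    rewrite gD !gZ gJ (coframe_dual cof) eqxx; case: (w 0 k) => s t.
    by apply/eqP; rewrite eq_complex /=; apply/andP; split; apply/eqP; ring.
  by rewrite gD !gZ gJ (coframe_dual cof) eq_sym (negPf lk) !mulr0 addr0.
have [W [Psi [[oW Ww0] _ CPsi _ PsiPhi]]] := chart_lift csm Bd da.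
have dPhi : is_derive u0 (theta x) Phi 0.
  have := Phi_derive (theta x); rewrite -/(Y x) coord_row.
  have -> : \row_k gam k x = w by apply/rowP => k; rewrite mxE gx.
  rewrite wP; have -> : realify (0 : 'rV[C]_n) = 0; last by [].
  by apply/rowP => j; rewrite /realify; case: (split_ordP j) => k ->; rewrite ?row_mxEl ?row_mxEr !mxE.
have th0 : theta x = 0.
  apply/rowP => i; rewrite mxE.
  have dPi : differentiable (fun w => Psi w 0 i) (Phi u0).
    rewrite Phi0; apply: (Ck_on_differentiable oW) Ww0.
    exact: (Ck_on_rowP 1 Psi oW).1 CPsi i.
  have E := is_deriveE (is_derive_comp dPi dPhi).
  have E' : 'D_(theta x) ((fun w => Psi w 0 i) \o Phi) u0 = theta x 0 i.
    have -> : 'D_(theta x) ((fun w => Psi w 0 i) \o Phi) u0 = 'D_(theta x) (fun v : 'rV[R]_(n + n) => v 0 i) u0.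
      by apply: near_eq_derive; apply: filterS PsiPhi => v /= ->.
    rewrite -(@derive_row R 'rV[R]_(n + n) _ id u0 (theta x) i); last exact: derivable_id.
    by rewrite derive_id.
  rewrite -E' E deriveE//.
  pose dd : {linear 'rV[R]_(n + n) -> R} := 'd (fun w => Psi w 0 i) (Phi u0).
  exact: (linear0 dd).
have x0 : x = 0.
  have [th' thK _] := lag_bijective lag; have thL := lag_linear lag.
  apply: (can_inj thK); rewrite th0.
  by have := thL 1 0 0; rewrite !scale1r addr0 => /eqP; rewrite -subr_eq subrr => /eqP.
case/eqP: w0; apply/rowP => k; rewrite mxE -gx x0; exact: g0.
Qed.

(** Near z0, F is f composed with the lift Psi. A complex tangent vector z lifts to the x with row
    of values gam_k x equal to z P^-1, and the Cauchy-Riemann condition makes x |-> Y x f a a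
    (1,0)-form; the differential is therefore C-linear in z. *)
Lemma descend_differentiable (f : G -> R[i]) (V : set G) (F : 'rV[C]_n -> R[i]) :
  open V -> V a -> csmooth A V f ->
  (forall x, Y (J x) f a = 'i%C * Y x f a) ->
  (forall q, V q -> cdom d (proj q) -> F (cmap d (proj q)) = f q) ->
  differentiable (F : 'rV[C]_n -> C^o) z0 /\
  forall z, 'd (F : 'rV[C]_n -> C^o) z0 z = \sum_k (z *m invmx P) 0 k * Y (X k) f a.
Proof.
move=> oV Va [fr fi] CR FE.
have [W [Psi [[oW Ww0] Psi0 CPsi WP _]]] := chart_lift csm Bd da.
rewrite -/z0 in Ww0 Psi0; have Psi0' : Psi (realify z0) = u0 := Psi0.
have [V1 [oV1 V1u V1V CEr]] := smooth_fun_curve lg Ac c1 1 oV fr Va.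
have [V2 [oV2 V2u _ CEi]] := smooth_fun_curve lg Ac c1 1 oV fi Va.
pose W' := W `&` Psi @^-1` (V1 `&` V2).
have oW' : open W'.
  rewrite openE => w [Ww Vw]; apply: filterI; first exact: open_nbhs_nbhs.
  by apply: (Ck_on_continuous CPsi Ww); apply: open_nbhs_nbhs; split=> //; exact: openI.
have W'w0 : W' (realify z0) by split=> //; rewrite /preimage /= Psi0.
have CPsi' : Ck_on 1 W' Psi by apply: Ck_on_subset CPsi => w [].
pose Er u := complex.Re (f (a * cinv c u)%g); pose Ei u := complex.Im (f (a * cinv c u)%g).
have CHr : Ck_on 1 W' (Er \o Psi) by apply: (Ck_on_comp oW' oV1) CEr CPsi' => w [_ []].
have CHi : Ck_on 1 W' (Ei \o Psi) by apply: (Ck_on_comp oW' oV2) CEi CPsi' => w [_ []].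
have dEr : differentiable Er (Psi (realify z0)) by rewrite Psi0; exact: Ck_on_differentiable oV1 CEr V1u.
have dEi : differentiable Ei (Psi (realify z0)) by rewrite Psi0; exact: Ck_on_differentiable oV2 CEi V2u.
have [th' thK th'K] := lag_bijective lag.
(* The derivative of Psi along z is named theta x; differentiating Phi o Psi = id identifies z with
   the row of values of gam at x times P. *)
have Dz (z : 'rV[C]_n) : exists x, [/\ is_derive (realify z0) (realify z) Psi (theta x) &
    \row_k gam k x = z *m invmx P].
  have dPsi := derivableP (Ck_on_derivable (v := realify z) CPsi Ww0).
  exists (th' ('D_(realify z) Psi (realify z0))); rewrite th'K; split=> //.
  set x := th' _.
  suff -> : z = \row_j Y x (chart_coord proj d j) a by rewrite coord_row mulmxK// frame_mx_unit.
  apply: (can_inj (@realifyK R n)); apply/rowP => i.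
  have dPhii : differentiable (fun v => Phi v 0 i) (Psi (realify z0)) by rewrite Psi0; exact: (Phi_coord i).1.
  have E := is_deriveE (is_derive_comp dPhii dPsi).
  rewrite /Y th'K -(Phi_coord i).2 -Psi0' -E.
  have -> : 'D_(realify z) ((fun v => Phi v 0 i) \o Psi) (realify z0) =
      'D_(realify z) (fun w : 'rV[R]_(n + n) => w 0 i) (realify z0).
    apply: near_eq_derive; apply: filterS (_ : nbhs (realify z0) W); last exact: open_nbhs_nbhs.
    by move=> w /WP[_ PPw]; rewrite /comp [Phi _]PPw.
  rewrite -(@derive_row R 'rV[R]_(n + n) _ id (realify z0) (realify z) i); last exact: derivable_id.
  by rewrite derive_id.
pose l j := \sum_k invmx P j k * Y (X k) f a.
have lE (z : 'rV[C]_n) : \sum_j z 0 j * l j = \sum_k (z *m invmx P) 0 k * Y (X k) f a.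
  under eq_bigr do rewrite mulr_sumr; rewrite exchange_big; apply: eq_bigr => k _.
  by rewrite mxE mulr_suml; apply: eq_bigr => j _; rewrite mulrA.
have := @complex_differentiable R n F z0 (Er \o Psi) (Ei \o Psi) l _ _ _ _.
case=> [||||dF dE].
- exact: (Ck_on_differentiable oW' CHr W'w0).
- exact: (Ck_on_differentiable oW' CHi W'w0).
- have := @realify_nbhs R n z0 W'; move/(_ (open_nbhs_nbhs (conj oW' W'w0))).
  apply: filterS => z [/WP[dq Pq] [V1z _]].
  have zE : cmap d (proj (a * cinv c (Psi (realify z)))%g) = z.
    by apply: (can_inj (@realifyK R n)).
  rewrite -[z in LHS]zE FE//; last exact: V1V.
  by rewrite /comp /Er /Ei; case: (f _).
- move=> z; rewrite lE; have [x [dPsi gx]] := Dz z.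
  rewrite (is_deriveE (is_derive_comp dEr dPsi)) (is_deriveE (is_derive_comp dEi dPsi)).
  have -> : ('D_(theta x) Er (Psi (realify z0)) +i* 'D_(theta x) Ei (Psi (realify z0)))%C = Y x f a.
    by rewrite Psi0 /Y /left_fieldC !left_field_derive.
  have hf : form10 J (fun x => Y x f a) by exact: (lie_field_form10 csm oV Va (conj fr fi) CR).
  rewrite (form10_expand cof x hf); apply: eq_bigr => k _.
  by rewrite -gx mxE mulrC.
by split=> // z; rewrite dE lE.
Qed.

End Descent.

Lemma diff_coord (K : numFieldType) (V : normedModType K) p (f : V -> 'rV[K]_p) x v j :
  differentiable f x -> 'd (fun y => f y 0 j : K^o) x v = ('d f x v) 0 j.
Proof.
move=> df; have cl : linear (fun w : 'rV[K]_p => w 0 j : K^o) by move=> s w w'; rewrite !mxE.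
pose co : {linear 'rV[K]_p -> K^o} := HB.pack (fun w : 'rV[K]_p => w 0 j : K^o) (GRing.isLinear.Build _ _ _ _ _ cl).
have cc : continuous co by move=> w; exact: coord_continuous.
have -> : (fun y => f y 0 j : K^o) = co \o f by [].
rewrite diff_comp//; last exact: linear_differentiable.
by rewrite diff_lin.
Qed.

(** * The nowhere vanishing holomorphic form on the quotient *)

Section TrivialCanonicalBundle.
Variables (R : realType) (n : nat) (g : vectType R) (br : g -> g -> g) (J : 'End(g)).
Variables (G : topGroupType) (A : set (chart R (n + n) G)) (c : chart R (n + n) G).
Variables (theta : g -> 'rV[R]_(n + n)) (Gamma : set G).
Variables (M : topologicalType) (B : set (chart R[i] n M)) (proj : G -> M).
Hypothesis acs : abelian_complex_structure br J.
Hypothesis csm : complex_solvmanifold br J A c theta Gamma B proj.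
Variables (X : 'I_n -> g) (gam : 'I_n -> g -> R[i]).
Hypothesis cof : adapted_coframe J X gam.
Local Notation C := (R[i] : numFieldType).

Let frame d := frame_mx c theta proj X d.

(** The curves defining a left invariant field at y a are the left translates by y of those at a,
    and [proj] does not see left translations by Gamma. *)
Lemma frame_mx_fiber d a b : proj a = proj b -> frame d a = frame d b.
Proof.
move=> /(csm_fibers csm)[y Gy ->].
have py q : proj (y * q)%g = proj q by apply/esym/(csm_fibers csm); exists y.
have L v (h : M -> R) : left_field c v (fun q => h (proj q)) (y * a)%g =
    left_field c v (fun q => h (proj q)) a.
  by congr (derive1 _ 0); apply/funext => t; rewrite -mulgA py.
apply/matrixP => k j; rewrite !mxE /frame_coef /left_fieldC.
by rewrite (L _ (fun p => complex.Re (cmap d p 0 j))) (L _ (fun p => complex.Im (cmap d p 0 j))).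
Qed.

Hypothesis T0 : forall x, antilinear_trace br J X gam x = 0.

Theorem solvmanifold_trivial_canonical_bundle : trivial_canonical_bundle B.
Proof.
(* No regularity of [sec] is required: the frame matrix depends only on the point of M, and
   holomorphy is checked on G. *)
have [sec secK] := choice (csm_surjective csm).
have frame_sec d q : frame d (sec (proj q)) = frame d q by apply: frame_mx_fiber; rewrite secK.
have unit d q : B d -> cdom d (proj q) -> frame d q \in unitmx.
  by move=> Bd dq; exact: (frame_mx_unit csm cof Bd dq).
exists (fun d z => (\det (frame d (sec (cinv d z))))^-1).
  split=> [d Bd _ [x dx <-]|d e Bd Be x dx ex].
    have hd := complex_chart csm Bd.
    have da : cdom d (proj (sec x)) by rewrite secK.
    pose F z : R[i] := \det (frame d (sec (cinv d z))).
    have Fq q : cdom d (proj q) -> F (cmap d (proj q)) = \det (frame d q).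
      by move=> dq; rewrite /F (chart_mapK hd dq) frame_sec.
    have [|x'|q _|dF _] := @descend_differentiable R n g br J G A c theta Gamma M B proj csm X gam cof
      d (sec x) Bd da (fun q => \det (frame d q)) (proj @^-1` cdom d) F (open_proj_dom csm Bd) da.
    - exact: (csmooth_frame_det csm X Bd).
    - exact: (frame_det_CR acs csm cof Bd da (T0 _)).
    - exact: Fq.
    rewrite secK in dF; apply: (@differentiableV C 'rV[C]_n F (cmap d x) dF).
    by rewrite -(secK x) Fq// -unitfE -unitmxE; exact: unit.
  have hd := complex_chart csm Bd; have he := complex_chart csm Be.
  have da : cdom d (proj (sec x)) by rewrite secK.
  have ea : cdom e (proj (sec x)) by rewrite secK.
  rewrite !chart_mapK//; set a := sec x in da ea *.
  set Jac := jacobian _ _.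
  have [_ _ /atlas_transition tr] := csm_complex_manifold csm.
  have dt : differentiable (cmap e \o cinv d) (cmap d x) by apply: (tr d e Bd Be); exists x.
  (* The coordinates of the chart e are themselves functions on G to which [descend_differentiable]
     applies. Taking determinants gives exactly the transformation rule of the coefficients 1 / det
     P. *)
  have JacE : Jac = invmx (frame d a) *m frame e a.
    apply/row_matrixP => i; rewrite rowE (rowE _ (_ *m _)) -(deriveEjacobian _ dt).
    apply/rowP => j; rewrite (deriveE _ dt) -(diff_coord _ j dt).
    have [|q _ dq|dF dE] := @descend_differentiable R n g br J G A c theta Gamma M B proj csm X gam cof
      d a Bd da (chart_coord proj e j) (proj @^-1` cdom e) (fun z => (cmap e \o cinv d) z 0 j)
      (open_proj_dom csm Be) ea (csmooth_chart_coord csm j Be).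
    - by move=> x'; exact: (csm_complex_structure csm Be ea).
    - by rewrite /= (chart_mapK hd dq).
    rewrite secK in dF dE; rewrite dE mulmxA mxE.
    by apply: eq_bigr => k _; rewrite [frame e a k j]mxE.
  have cancel_det (u v : R[i]) : v != 0 -> u^-1 = v^-1 * (u^-1 * v).
    by move=> v0; rewrite mulrCA mulVf ?mulr1.
  rewrite JacE det_mulmx det_inv; apply: cancel_det.
  by rewrite -unitfE -unitmxE; exact: unit.
move=> d Bd _ [x dx <-]; have hd := complex_chart csm Bd.
by rewrite chart_mapK// invr_neq0// -unitfE -unitmxE; apply: unit; rewrite ?secK.
Qed.

End TrivialCanonicalBundle.

Theorem corollary3p6 (R : realType) (n : nat) (g : vectType R)
    (br : g -> g -> g) (J : 'End(g))
    (br_lie : lie_bracket br)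
    (dim_g : (\dim {:g} = 2 * n)%N)
    (J_abelian : abelian_complex_structure br J) :
  ((exists omega : ('I_n -> g) -> R[i],
      [/\ formn0 J omega, (exists x, (omega x <> 0)%R)
        & closed_form br omega])
   <-> unimodular br)
  /\
  (forall (G : topGroupType) (A : set (chart R (n + n) G))
     (c : chart R (n + n) G) (theta : g -> 'rV[R]_(n + n)) (Gamma : set G)
     (M : topologicalType) (B : set (chart R[i] n M))
     (proj : G -> M),
     complex_solvmanifold br J A c theta Gamma B proj ->
     trivial_canonical_bundle B).
Proof.
have [X [gam cof]] := adapted_coframe_exists J_abelian dim_g.
split; first exact: (closed_formn0_unimodular br_lie J_abelian cof).
move=> G A c theta Gamma M B proj csm.
apply: (solvmanifold_trivial_canonical_bundle J_abelian csm cof).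
apply/(unimodular_antilinear_trace br_lie J_abelian cof).
exact: solvmanifold_unimodular br_lie csm.
Qed.
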